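(* There exists a linear operator $T:W\to H$ (a trace operator), bounded in the sense that $\|Tu\|_H\le C\|u\|_W$ for all $u\in W$ with a constant $C$ independent of $u$, such that for every $u\in W$ and for $\sigma$-almost every $x\in\Gamma$, $$Tu(x)=\lim_{r\to0}\frac1{|B(x,r)|}\int_{B(x,r)}u(y)\,dy$$ and $$\lim_{r\to0}\frac1{|B(x,r)|}\int_{B(x,r)}|u(y)-Tu(x)|\,dy=0 .$$
   Context: Let $n\ge2$ and let $0<d<n-1$ be a real number. $\Gamma\subset\mathbb R^n$ is a nonempty closed set which is Ahlfors regular of dimension $d$: there is $C_0\ge1$ with $C_0^{-1}r^d\le\mathcal H^d(\Gamma\cap B(x,r))\le C_0r^d$ for all $x\in\Gamma$, $r>0$. Set $\Omega=\mathbb R^n\setminus\Gamma$, $\sigma=\mathcal H^d|_\Gamma$, $\delta(z)=\operatorname{dist}(z,\Gamma)$ and $w(z)=\delta(z)^{d+1-n}$. $W=\{u\in L^1_{loc}(\Omega):\nabla u\in L^2(\Omega,w)\}$, where $\nabla u$ is the distributional gradient in $\Omega$ and $L^2(\Omega,w)=L^2(\Omega,w\,dz)$; $\|u\|_W=\big(\int_\Omega|\nabla u|^2w\,dz\big)^{1/2}$ (a semi-norm). The set $\Gamma$ is Lebesgue-null, and every $u\in W$ actually belongs to $L^1_{loc}(\mathbb R^n)$, so the averages over balls centered on $\Gamma$ make sense. $H$ is the space of measurable functions $g$ on $\Gamma$ (modulo $\sigma$-null sets) with $\|g\|_H^2=\int_\Gamma\int_\Gamma\frac{|g(x)-g(y)|^2}{|x-y|^{d+1}}\,d\sigma(x)\,d\sigma(y)<\infty$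 ($\|\cdot\|_H$ is a semi-norm). *)

(* Defs.v *)
From HB Require Import structures.
From mathcomp Require Import all_boot all_order all_algebra.
From mathcomp Require Import all_classical all_reals all_analysis measurable_realfun zify lra.
Set Implicit Arguments.
Unset Strict Implicit.
Unset Printing Implicit Defensive.
Import Order.TTheory GRing.Theory Num.Theory.
Import numFieldNormedType.Exports.
Local Open Scope classical_set_scope.
Local Open Scope ring_scope.

(* 'rV[R]_n carries the Borel sigma-algebra of its topology. *)
Section borel_rV.
Variables (R : realType) (n : nat).

HB.instance Definition _ := @isMeasurable.Build
  default_measure_display 'rV[R]_n <<s @open 'rV[R]_n >>
  (@sigma_algebra0 _ setT _) (@sigma_algebraC _ _)
  (@sigma_algebra_bigcup _ setT _).

Lemma open_measurable_rV (U : set 'rV[R]_n) : open U -> measurable U.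
Proof. by move=> oU; exact: sub_sigma_algebra. Qed.

Lemma measurable_rV_fun d (T : measurableType d) (f : T -> 'rV[R]_n) :
  (forall U, open U -> measurable (f @^-1` U)) -> measurable_fun setT f.
Proof.
move=> mf; apply: (@measurability _ _ _ _ _ _ (@open 'rV[R]_n)) => //.
by move=> _ [U oU <-]; rewrite setTI; exact: mf.
Qed.

Lemma continuous_measurable_rV (f : 'rV[R]_n -> R) :
  continuous f -> measurable_fun setT f.
Proof.
move=> cf; apply: (@measurability _ _ _ _ _ _ _ (RGenOInfty.measurableE R)).
move=> _ [_ [a ->] <-]; rewrite setTI.
by apply: open_measurable_rV; move/continuousP: cf; apply.
Qed.

End borel_rV.

Section lebesgue_rV.
Variable R : realType.

Definition rV_cons n (p : R * 'rV[R]_n) : 'rV[R]_n.+1 :=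
  @row_mx R 1 1 n p.1%:M p.2.

Definition rV_uncons n (v : 'rV[R]_n.+1) : R * 'rV[R]_n :=
  (v ord0 ord0, @rsubmx R 1 1 n v).

Lemma rV_consE n (p : R * 'rV[R]_n) (i : 'I_n.+1) :
  rV_cons p ord0 i = if unlift ord0 i is Some j then p.2 ord0 j else p.1.
Proof.
rewrite /rV_cons; case: unliftP => [j ->|->].
  have -> : lift ord0 j = rshift 1 j :> 'I_(1 + n) by exact/val_inj.
  exact: (@row_mxEr R 1 1 n p.1%:M p.2 ord0 j).
have -> : ord0 = lshift n ord0 :> 'I_(1 + n) by exact/val_inj.
by rewrite (@row_mxEl R 1 1 n p.1%:M p.2 ord0 ord0) mxE eqxx.
Qed.

Lemma rV_consK n : cancel (@rV_cons n) (@rV_uncons n).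
Proof.
case=> a v; rewrite /rV_uncons; congr (_, _); last by rewrite row_mxKr.
by rewrite rV_consE unlift_none.
Qed.

Lemma rV_unconsK n : cancel (@rV_uncons n) (@rV_cons n).
Proof.
move=> v; apply/rowP => i; rewrite rV_consE; case: unliftP => [j ->|->//].
by rewrite /= mxE; congr (v _ _); exact/val_inj.
Qed.

Lemma rat_dense_rV n (v : 'rV[R]_n) (e : R) : 0 < e ->
  exists q : 'rV[rat]_n, ball v e (map_mx ratr q).
Proof.
move=> e0.
have /choice[q qP] : forall i, exists q : rat, ball (v ord0 i) e (ratr q : R).
  move=> i; have : v ord0 i < v ord0 i + e by rewrite ltrDl.
  move=> /rat_in_itvoo[q]; rewrite in_itv/= => /andP[q1 q2]; exists q.
  by rewrite /ball/= ltr_norml; apply/andP; split; rewrite ?ltrBlDr; lra.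
exists (\row_i q i); split => // i j; rewrite !mxE (ord1 i); exact: qP.
Qed.

Lemma measurable_rV_cons n : measurable_fun setT (@rV_cons n).
Proof.
apply: measurable_rV_fun => U oU.
pose F (c : rat * 'rV[rat]_n * nat) : set (R * 'rV[R]_n) :=
  [set p | (ball (ratr c.1.1 : R) (c.2.+1%:R^-1) `*`
            ball (map_mx ratr c.1.2 : 'rV[R]_n) (c.2.+1%:R^-1)) p /\
  ((ball (ratr c.1.1 : R) (c.2.+1%:R^-1) `*`
    ball (map_mx ratr c.1.2 : 'rV[R]_n) (c.2.+1%:R^-1))
    `<=` @rV_cons n @^-1` U)].
have -> : @rV_cons n @^-1` U = \bigcup_c F c.
  apply/seteqP; split => [[a v] /= Uav|p [c _ [cp cU]]]; last exact: cU.
  have /nbhs_ballP[e /= e0 eU] : nbhs (rV_cons (a, v)) U.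
    exact: open_nbhs_nbhs.
  have [k ke] : exists k, 2 * k.+1%:R^-1 < e.
    have [k] := ltr_add_invr (@divr_gt0 R e 2 e0 ltac:(by [])).
    by rewrite add0r => ke; exists k; move: ke; rewrite ltr_pdivlMr// mulrC.
  have k0 : 0 < k.+1%:R^-1 :> R by [].
  have [q qv] := rat_dense_rV v k0.
  have [p pa] := rat_dense_rV (\row_(i < 1) a) k0.
  have {}pa : ball a (k.+1%:R^-1) (ratr (p ord0 ord0) : R).
    by case: pa => _ /(_ ord0 ord0); rewrite !mxE.
  exists (p ord0 ord0, q, k) => //; split => /=.
    by split => /=; apply: ball_sym.
  move=> [b w] [/= pb qw]; apply: eU; split => // i j.
  rewrite (ord1 i) !rV_consE; apply: (le_ball (ltW ke)); rewrite mulr2n mulrDl mul1r.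
  case: unliftP => [l _|_] /=; last exact: ball_triangle pa pb.
  by apply: ball_triangle; [case: qv => _; apply|case: qw => _; apply].
apply: countable_bigcupT_measurable => [|c]; first exact: countableP.
rewrite /F.
have [H|H] := pselect ((ball (ratr c.1.1 : R) (c.2.+1%:R^-1) `*`
    ball (map_mx ratr c.1.2 : 'rV[R]_n) (c.2.+1%:R^-1))
    `<=` @rV_cons n @^-1` U); last first.
  by rewrite (_ : mkset _ = set0)//; apply/seteqP; split => // p [].
rewrite (_ : mkset _ = (ball (ratr c.1.1 : R) (c.2.+1%:R^-1) `*`
    ball (map_mx ratr c.1.2 : 'rV[R]_n) (c.2.+1%:R^-1))); last first.
  by apply/seteqP; split => [p []|p ?].
apply: measurableX; first exact: measurable_ball.
by apply: open_measurable_rV; exact: ball_open.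
Qed.

Lemma measurable_rV_uncons n : measurable_fun setT (@rV_uncons n).
Proof.
apply: measurable_fun_pair => /=.
  by apply: continuous_measurable_rV; exact: coord_continuous.
apply: measurable_rV_fun => U oU; apply: open_measurable_rV.
rewrite openE => v Uv.
have /nbhs_ballP[e /= e0 eU] : nbhs (@rsubmx R 1 1 n v) U.
  exact: open_nbhs_nbhs.
apply/nbhs_ballP; exists e => // w [_ vw]; apply: eU; split => // i j.
by rewrite !mxE.
Qed.

Section lebesgue_rV_step.
Variables (n : nat) (mu : {sigma_finite_measure set 'rV[R]_n -> \bar R}).

Definition lebesgue_rV_step (A : set 'rV[R]_n.+1) : \bar R :=
  (@lebesgue_measure R \x mu)%E (@rV_cons n @^-1` A).

Let measurable_preimage_rV_cons (A : set 'rV[R]_n.+1) : measurable A ->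
  measurable (@rV_cons n @^-1` A : set (measurableTypeR R * 'rV[R]_n)).
Proof. by move=> mA; rewrite -[X in measurable X]setTI; exact: measurable_rV_cons. Qed.

Let lebesgue_rV_step0 : lebesgue_rV_step set0 = 0%E.
Proof. by rewrite /lebesgue_rV_step preimage_set0 measure0. Qed.

Let lebesgue_rV_step_ge0 A : (0 <= lebesgue_rV_step A)%E.
Proof. exact: measure_ge0. Qed.

Let lebesgue_rV_step_sigma_additive : semi_sigma_additive lebesgue_rV_step.
Proof.
move=> F mF tF mUF; rewrite /lebesgue_rV_step preimage_bigcup.
apply: measure_semi_sigma_additive.
- by move=> k; exact: measurable_preimage_rV_cons.
- apply/trivIsetP => /= i j _ _ ij; rewrite -preimage_setI.
  by move/trivIsetP : tF => /(_ _ _ _ _ ij) ->//; rewrite preimage_set0.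
- by rewrite -preimage_bigcup; exact: measurable_preimage_rV_cons.
Qed.

HB.instance Definition _ := isMeasure.Build _ _ _ lebesgue_rV_step
  lebesgue_rV_step0 lebesgue_rV_step_ge0 lebesgue_rV_step_sigma_additive.

Let lebesgue_rV_step_sigma_finite : sigma_finite setT lebesgue_rV_step.
Proof.
have /sigma_finiteP[F [TF ndF Foo]] := sigma_finiteT (@lebesgue_measure R).
have /sigma_finiteP[G [TG ndG Goo]] := sigma_finiteT mu.
exists (fun k => @rV_uncons n @^-1` (F k `*` G k)).
  apply/seteqP; split => // v _.
  have [i _ Fi] : (\bigcup_i F i) (rV_uncons v).1 by rewrite -TF.
  have [j _ Gj] : (\bigcup_i G i) (rV_uncons v).2 by rewrite -TG.
  exists (maxn i j) => //; split.
    by move: (_.1) Fi; exact/subsetPset/ndF/leq_maxl.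
  by move: (_.2) Gj; exact/subsetPset/ndG/leq_maxr.
move=> k; have [mF Fk] := Foo k; have [mG Gk] := Goo k; split.
  rewrite -[X in measurable X]setTI; apply: measurable_rV_uncons => //.
  exact: measurableX.
rewrite /lebesgue_rV_step -comp_preimage.
rewrite (_ : @rV_uncons n \o @rV_cons n = id) ?preimage_id; last first.
  by apply/funext => p /=; exact: rV_consK.
by rewrite product_measure1E// lte_mul_pinfty// ge0_fin_numE.
Qed.

HB.instance Definition _ := @Measure_isSigmaFinite.Build _ _ _
  lebesgue_rV_step lebesgue_rV_step_sigma_finite.

End lebesgue_rV_step.

(* n-dimensional Lebesgue measure, as the n-fold product of the
   one-dimensional one. *)
Fixpoint lebesgue_rV n : {sigma_finite_measure set 'rV[R]_n -> \bar R} :=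
  if n is m.+1 then lebesgue_rV_step (lebesgue_rV m) else \d_(0 : 'rV[R]_0).

End lebesgue_rV.
Section euclidean.
Variables (R : realType) (n : nat).
Implicit Types (x y v : 'rV[R]_n) (A : set 'rV[R]_n).

(* The norm `|v| of the library on 'rV[R]_n is the sup norm. *)
Definition enorm v : R := Num.sqrt (\sum_(i < n) v ord0 i ^+ 2).

Definition eball x (r : R) : set 'rV[R]_n := [set y | enorm (x - y) < r].

Definition ediam A : \bar R :=
  ereal_sup [set (enorm (x - y))%:E | x in A & y in A].

Lemma enorm_ge0 v : 0 <= enorm v. Proof. exact: sqrtr_ge0. Qed.

Lemma ler_norm_enorm v : `|v| <= enorm v.
Proof.
rewrite -[leLHS]/(mx_norm v) mx_normrE; apply/bigmax_leP; split => [|[i j] _ /=].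
  exact: enorm_ge0.
rewrite (ord1 i) -sqrtr_sqr ler_wsqrtr// (bigD1 j)//= lerDl.
by apply: sumr_ge0 => k _; exact: sqr_ge0.
Qed.

End euclidean.

Section hausdorff.
Variables (R : realType) (n : nat) (s : R).
Implicit Types (A B X : set 'rV[R]_n) (U : (set 'rV[R]_n)^nat) (e : R).
Local Open Scope ereal_scope.

(* Without the case of the empty set, a cover padded with empty sets would have
   infinite cost when s = 0. *)
Definition hausdorff_gauge A : \bar R :=
  if A == set0 then 0 else ediam A `^ s.

Definition hausdorff_premeasure e A : \bar R :=
  ereal_inf [set \sum_(k <oo) hausdorff_gauge (U k) | U in
    [set U | (forall k, ediam (U k) <= e%:E) /\ A `<=` \bigcup_k U k]].

(* Without the normalizing factor found in some textbooks, which only affects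
   the constants in Ahlfors regularity and in norm estimates. *)
Definition hausdorff_measure A : \bar R :=
  ereal_sup [set hausdorff_premeasure e A | e in [set e | (0 < e)%R]].

Lemma hausdorff_gauge_ge0 A : 0 <= hausdorff_gauge A.
Proof. by rewrite /hausdorff_gauge; case: ifP => // _; exact: poweR_ge0. Qed.

Lemma hausdorff_gauge0 : hausdorff_gauge set0 = 0.
Proof. by rewrite /hausdorff_gauge eqxx. Qed.

Lemma ediam0 : ediam (set0 : set 'rV[R]_n) = -oo.
Proof.
rewrite /ediam (_ : [set _ | _ in _ & _ in _] = set0) ?ereal_sup0//.
by apply/seteqP; split => // x [].
Qed.

Let T := g_sigma_algebraType [set: set 'rV[R]_n].

Let gauge e (A : set T) : \bar R :=
  if ediam (A : set 'rV[R]_n) <= e%:E then hausdorff_gauge A else +oo.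

Let gauge_ge0 e A : 0 <= gauge e A.
Proof. by rewrite /gauge; case: ifP => // _; exact: hausdorff_gauge_ge0. Qed.

Let gauge0 e : gauge e set0 = 0.
Proof. by rewrite /gauge ediam0 leNye hausdorff_gauge0. Qed.

Let premeasureE e : hausdorff_premeasure e = mu_ext (gauge e).
Proof.
apply/funext => A; apply/eqP; rewrite eq_le; apply/andP; split.
  apply: le_ereal_inf_tmp => _ [U [_ AU] <-].
  have [Ue|] := pselect (forall k, ediam (U k : set 'rV[R]_n) <= e%:E).
    apply: ereal_inf_lbound; exists U => //.
    by apply: eq_eseriesr => k _; rewrite /gauge Ue.
  move=> /existsNP[k /negP Uk]; rewrite (@eseries_pinfty _ _ _ k) ?leey//.
    by move=> i _; rewrite -ltNye (lt_le_trans _ (gauge_ge0 _ _)).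
  by rewrite /gauge (negbTE Uk).
apply: ereal_inf_le_tmp => _ [U [Ue AU] <-]; exists U.
  by split => // k; exact: sub_sigma_algebra.
by apply: eq_eseriesr => k _; rewrite /gauge Ue.
Qed.

Lemma hausdorff_premeasure_ge0 e A : 0 <= hausdorff_premeasure e A.
Proof. by rewrite premeasureE; apply: mu_ext_ge0 => X; exact: gauge_ge0. Qed.

Lemma le_hausdorff_premeasure e :
  {homo hausdorff_premeasure e : A B / A `<=` B >-> A <= B}.
Proof. by rewrite premeasureE => A B; exact: (@le_mu_ext _ T). Qed.

Lemma hausdorff_premeasure_anti e e' A : (e <= e')%R ->
  hausdorff_premeasure e' A <= hausdorff_premeasure e A.
Proof.
move=> ee'; apply: ereal_inf_le_tmp => _ [U [Ue AU] <-]; exists U => //.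
by split => // k; rewrite (le_trans (Ue k)).
Qed.

Lemma hausdorff_premeasure_le e A : (0 < e)%R ->
  hausdorff_premeasure e A <= hausdorff_measure A.
Proof. by move=> e0; apply: ereal_sup_ubound; exists e. Qed.

Let hausdorff_measure0 : hausdorff_measure set0 = 0.
Proof.
apply/eqP; rewrite eq_le; apply/andP; split.
  apply: ge_ereal_sup => _ [e _ <-].
  by rewrite premeasureE mu_ext0//; exact: gauge_ge0.
exact: le_trans (hausdorff_premeasure_ge0 1 _) (hausdorff_premeasure_le _ _).
Qed.

Let hausdorff_measure_ge0 A : 0 <= hausdorff_measure A.
Proof.
exact: le_trans (hausdorff_premeasure_ge0 1 _) (hausdorff_premeasure_le _ _).
Qed.

Let le_hausdorff_measure :
  {homo hausdorff_measure : A B / A `<=` B >-> A <= B}.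
Proof.
move=> A B AB; apply: ge_ereal_sup => _ [e /= e0 <-].
by apply: le_trans (hausdorff_premeasure_le _ e0); exact: le_hausdorff_premeasure.
Qed.

Let hausdorff_measure_sigma_subadditive : sigma_subadditive hausdorff_measure.
Proof.
move=> F; apply: ge_ereal_sup => _ [e /= e0 <-].
apply: (@le_trans _ _ (\sum_(i <oo) hausdorff_premeasure e (F i))).
  rewrite premeasureE; apply: (@mu_ext_sigma_subadditive _ T) => X.
  exact: gauge_ge0.
apply: lee_nneseries => [i _ _|i _]; first exact: hausdorff_premeasure_ge0.
exact: hausdorff_premeasure_le.
Qed.

HB.instance Definition _ := isOuterMeasure.Build R 'rV[R]_n hausdorff_measure
  hausdorff_measure0 hausdorff_measure_ge0 le_hausdorff_measure
  hausdorff_measure_sigma_subadditive.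

Lemma hausdorff_measureU_separated A B (c : R) : (0 < c)%R ->
  (forall x y, A x -> B y -> (c <= enorm (x - y)%R)%R) ->
  hausdorff_measure A + hausdorff_measure B <= hausdorff_measure (A `|` B).
Proof.
move=> c0 ABc.
have H e : (0 < e)%R -> (e < c)%R -> hausdorff_premeasure e A +
    hausdorff_premeasure e B <= hausdorff_measure (A `|` B).
  move=> e0 ec; apply: le_trans (hausdorff_premeasure_le _ e0).
  apply: le_ereal_inf_tmp => _ [U [Ue ABU] <-].
  pose UA k := if U k `&` A == set0 then set0 else U k.
  pose UB k := if U k `&` A == set0 then U k else set0.
  have hA : hausdorff_premeasure e A <= \sum_(k <oo) hausdorff_gauge (UA k).
    apply: ereal_inf_lbound; exists UA => //; split.
      by move=> k; rewrite /UA; case: ifP => // _; rewrite ediam0 leNye.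
    move=> x Ax; have [k _ Ux] := ABU x (or_introl Ax); exists k => //.
    rewrite /UA; case: ifP => // /eqP UA0.
    by have : (U k `&` A) x by []; rewrite UA0.
  have hB : hausdorff_premeasure e B <= \sum_(k <oo) hausdorff_gauge (UB k).
    apply: ereal_inf_lbound; exists UB => //; split.
      by move=> k; rewrite /UB; case: ifP => // _; rewrite ediam0 leNye.
    move=> x Bx; have [k _ Ux] := ABU x (or_intror Bx); exists k => //.
    rewrite /UB; case: ifP => // /negbT/set0P[y [Uy Ay]].
    have := Ue k; rewrite leNgt => /negP; apply.
    apply: (@lt_le_trans _ _ c%:E); first by rewrite lte_fin.
    apply: (@le_trans _ _ (enorm (y - x)%R)%:E); first by rewrite lee_fin ABc.
    by apply: ereal_sup_ubound; exists y => //; exists x.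
  apply: (le_trans (leeD hA hB)).
  rewrite -nneseriesD; [|by move=> *; exact: hausdorff_gauge_ge0..].
  apply: lee_nneseries => [i _ _|i _].
    by rewrite adde_ge0 ?hausdorff_gauge_ge0.
  by rewrite /UA /UB; case: ifP => _; rewrite hausdorff_gauge0 ?add0e ?adde0.
have HH e e' : (0 < e)%R -> (0 < e')%R -> hausdorff_premeasure e A +
    hausdorff_premeasure e' B <= hausdorff_measure (A `|` B).
  move=> e0 e'0; pose m := Num.min (c / 2)%R (Num.min e e').
  have m0 : (0 < m)%R by rewrite !lt_min e0 e'0 divr_gt0.
  apply: le_trans (H m m0 _); last first.
    by rewrite gt_min; apply/orP; left; lra.
  by apply: leeD; apply: hausdorff_premeasure_anti; rewrite !ge_min lexx ?orbT.
have [->|Boo] := eqVneq (hausdorff_measure B) 0.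
  by rewrite adde0 le_hausdorff_measure.
have key e : (0 < e)%R -> hausdorff_premeasure e A + hausdorff_measure B <=
    hausdorff_measure (A `|` B).
  move=> e0; have [pA|] := boolP (hausdorff_premeasure e A \is a fin_num).
    rewrite -leeBrDl//; apply: ge_ereal_sup => _ [e' /= e'0 <-].
    by rewrite leeBrDl//; exact: HH.
  rewrite ge0_fin_numE ?hausdorff_premeasure_ge0// -leNgt leye_eq => /eqP pA.
  have := HH e 1%R e0 ltr01; rewrite pA addye; last first.
    by rewrite -ltNye (lt_le_trans _ (hausdorff_premeasure_ge0 _ _)).
  by rewrite leye_eq => /eqP ->; rewrite leey.
have [pB|] := boolP (hausdorff_measure B \is a fin_num).
  rewrite -leeBrDr//; apply: ge_ereal_sup => _ [e /= e0 <-].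
  by rewrite leeBrDr//; exact: key.
rewrite ge0_fin_numE// -leNgt leye_eq => /eqP pB.
have := key 1%R ltr01; rewrite pB addey; last first.
  by rewrite -ltNye (lt_le_trans _ (hausdorff_premeasure_ge0 _ _)).
by rewrite leye_eq => /eqP ->; rewrite leey.
Qed.


Let level (f : 'rV[R]_n -> R) X k := X `&` [set x | (k.+1%:R^-1 <= f x)%R].

Let layer (f : 'rV[R]_n -> R) X k :=
  X `&` [set x | (k.+2%:R^-1 <= f x < k.+1%:R^-1)%R].

Let layer_sum f X m : (forall x y, (f x - f y <= enorm (x - y))%R) ->
  \sum_(0 <= k < m.+1) hausdorff_measure (layer f X k) <=
  hausdorff_measure (level f X m) + hausdorff_measure (level f X m.+1).
Proof.
move=> fL; elim: m => [|m IH].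
  rewrite big_nat1; apply: (@le_trans _ _ (hausdorff_measure (level f X 1))).
    by apply: le_hausdorff_measure => x [Xx /= /andP[]].
  by rewrite leeDr.
rewrite big_nat_recr//=; apply: (le_trans (leeD2r _ IH)).
rewrite addeAC [leRHS]addeC leeD2r//.
pose c : R := (m.+1%:R^-1 - m.+2%:R^-1)%R.
apply: le_trans (hausdorff_measureU_separated (c := c) _ _) _.
- by rewrite /c subr_gt0 ltf_pV2 ?posrE// ltr_nat.
- move=> x y [_ /= fx] [_ /= /andP[_ fy]]; apply: le_trans (fL x y).
  by rewrite /c lerB// ltW.
apply: le_hausdorff_measure => x [[Xx /= fx]|[Xx /= /andP[fx _]]]; split => //=.
by apply: le_trans fx; rewrite lef_pV2 ?posrE// ler_nat; lia.
Qed.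

Let level_layer f X m : X `&` [set x | (0 < f x)%R] `<=`
  level f X m `|` \bigcup_k layer f X (k + m)%N.
Proof.
move=> x [Xx /= fx0].
have [fm|fm] := lerP (m.+1%:R^-1) (f x); first by left.
right.
have ex : exists k, (k.+2%:R^-1 <= f x)%R.
  have [k] := ltr_add_invr fx0; rewrite add0r => kf; exists k.
  by apply: le_trans (ltW kf); rewrite lef_pV2 ?posrE// ler_nat.
case: (ex_minnP ex) => j fj jmin.
have mj : (m <= j)%N.
  have : (m.+1%:R < j.+2%:R :> R)%R.
    by rewrite -ltf_pV2 ?posrE//; exact: le_lt_trans fj fm.
  by rewrite ltr_nat !ltnS.
exists (j - m)%N => //; rewrite subnK//; split => //=; apply/andP; split => //.
have [->//|jm] := eqVneq j m.
case: j fj jmin mj jm => [|j] fj jmin mj jm; first by move: mj jm; case: (m).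
rewrite ltNge; apply/negP => /jmin; lia.
Qed.

Let caratheodory_gt0 (f : 'rV[R]_n -> R) :
  (forall x y, (f x - f y <= enorm (x - y))%R) ->
  caratheodory_measurable hausdorff_measure [set x | (0 < f x)%R].
Proof.
move=> fL; apply: le_caratheodory_measurable => X /=.
have [->|Xoo] := eqVneq (hausdorff_measure X) +oo; first by rewrite leey.
have Xfin : hausdorff_measure X \is a fin_num by rewrite ge0_fin_numE// ltey.
set A := [set x | _].
have lX k : hausdorff_measure (level f X k) <= hausdorff_measure X.
  by apply: le_hausdorff_measure => x [].
have sfin : \sum_(k <oo) hausdorff_measure (layer f X k) < +oo.
  apply: (@le_lt_trans _ _ (hausdorff_measure X + hausdorff_measure X)).
    apply: lime_le; first exact: is_cvg_nneseries.
    apply: nearW => -[|k]; first by rewrite big_nil adde_ge0.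
    by apply: (le_trans (layer_sum _ _ fL)); exact: leeD.
  by rewrite lte_add_pinfty// ltey.
have tail := nneseries_tail_cvg sfin (fun k _ => hausdorff_measure_ge0 _).
have bound m : hausdorff_measure (X `&` A) + hausdorff_measure (X `&` ~` A) <=
    hausdorff_measure X + \sum_(m <= k <oo) hausdorff_measure (layer f X k).
  have XA : hausdorff_measure (X `&` A) <= hausdorff_measure (level f X m) +
      \sum_(m <= k <oo) hausdorff_measure (layer f X k).
    apply: (le_trans (le_hausdorff_measure (@level_layer f X m))).
    apply: (le_trans (outer_measureU2 _ _ _)).
    rewrite leeD2l//.
    apply: (le_trans (outer_measure_sigma_subadditive hausdorff_measure _)).
    by rewrite -(@nneseries_addn _ (fun k => hausdorff_measure (layer f X k))).
  apply: (le_trans (leeD2r _ XA)); rewrite addeAC leeD2r//.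
  apply: le_trans (hausdorff_measureU_separated (c := m.+1%:R^-1) _ _) _ => //.
    move=> x y [_ /= fx] [_ /= /negP]; rewrite -leNgt => fy.
    by apply: le_trans (fL x y); rewrite -[leLHS]subr0 lerB.
  by apply: le_hausdorff_measure => x [[]|[]].
rewrite -[leRHS]adde0.
have : hausdorff_measure X + \sum_(m <= k <oo) hausdorff_measure (layer f X k)
    @[m --> \oo] --> hausdorff_measure X + 0.
  by apply: cvgeD => //; [rewrite fin_num_adde_defr|exact: cvg_cst].
move=> /cvg_lim <-//; apply: lime_ge; last exact: nearW.
apply/cvg_ex; exists (hausdorff_measure X + 0).
by apply: cvgeD => //; [rewrite fin_num_adde_defr|exact: cvg_cst].
Qed.

Lemma open_caratheodory_hausdorff A : open A ->
  caratheodory_measurable hausdorff_measure A.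
Proof.
move=> oA; have [AT|AT] := pselect (A = setT).
  rewrite AT => X.
  by rewrite setIT setCT setI0 outer_measure0 adde0.
pose D x := [set `|x - y|%R | y in ~` A].
have D0 x : D x !=set0.
  by move/eqP/setTPn : AT => [y Ay]; exists `|x - y|%R; exists y.
have Dlb x : has_lbound (D x) by exists 0%R => _ [y _ <-].
have -> : A = [set x | (0 < inf (D x))%R].
  apply/seteqP; split => x /=.
    move=> Ax; have /nbhs_ballP[r /= r0 rA] : nbhs x A by exact: open_nbhs_nbhs.
    apply: (lt_le_trans r0); apply: lb_le_inf => // _ [y Ay <-].
    rewrite leNgt; apply/negP => xy; apply: Ay; apply: rA.
    by rewrite -ball_normE.
  move=> Dx0; apply: contrapT => Ax.
  have : (inf (D x) <= 0)%R.
    by apply: ge_inf => //; exists x => //; rewrite subrr normr0.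
  by rewrite leNgt Dx0.
apply: caratheodory_gt0 => x y.
rewrite lerBlDr -lerBlDl; apply: lb_le_inf => // _ [z Az <-].
rewrite lerBlDl; apply: (@le_trans _ _ `|x - z|%R).
  by apply: ge_inf => //; exists z.
apply: (le_trans (ler_distD y _ _)).
by rewrite lerD2r; exact: ler_norm_enorm.
Qed.

Lemma measurable_caratheodory_hausdorff A : measurable A ->
  caratheodory_measurable hausdorff_measure A.
Proof.
move=> mA; suff : <<s @open 'rV[R]_n >> `<=`
    caratheodory_measurable hausdorff_measure by exact.
apply: smallest_sub; last by move=> U; exact: open_caratheodory_hausdorff.
split; first exact: caratheodory_measurable_set0.
  by move=> B cB; rewrite setTD; exact: caratheodory_measurable_setC.
by move=> F cF; exact: caratheodory_measurable_bigcup.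
Qed.

Section restriction.
Variable G : set 'rV[R]_n.

Definition hausdorff_restr A : \bar R := hausdorff_measure (A `&` G).

Let hausdorff_restr0 : hausdorff_restr set0 = 0.
Proof. by rewrite /hausdorff_restr set0I outer_measure0. Qed.

Let hausdorff_restr_ge0 A : 0 <= hausdorff_restr A.
Proof. exact: outer_measure_ge0. Qed.

Let hausdorff_restr_sigma_additive : semi_sigma_additive hausdorff_restr.
Proof.
move=> F mF tF mUF; rewrite /hausdorff_restr.
have cF i : caratheodory_measurable hausdorff_measure (F i).
  exact: measurable_caratheodory_hausdorff.
have -> : hausdorff_measure (\bigcup_i F i `&` G) =
    \sum_(i <oo) hausdorff_measure (F i `&` G).
  under eq_eseriesr do rewrite setIC.
  rewrite setIC; apply/eqP; rewrite eq_le outer_measure_bigcup_lim/=.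
  have := caratheodory_lime_le cF tF (G `&` \bigcup_i F i).
  rewrite -setIA setICr setI0 outer_measure0 adde0.
  apply: le_trans; apply: lee_nneseries => [i _ _|i _]; first by [].
  apply: le_outer_measure => x [Gx Fx]; split => //; split => //.
  by exists i.
by apply: is_cvg_nneseries => i _ _.
Qed.

HB.instance Definition _ := isMeasure.Build _ _ _ hausdorff_restr
  hausdorff_restr0 hausdorff_restr_ge0 hausdorff_restr_sigma_additive.

End restriction.

End hausdorff.

Section test_functions.
Variables (R : realType) (n : nat).
Implicit Types (O : set 'rV[R]_n) (f u : 'rV[R]_n -> R).

Definition partial (i : 'I_n) f : 'rV[R]_n -> R := fun x => 'D_(delta_mx 0 i) f x.

Definition smooth f := forall l : seq 'I_n,
  let g := foldr partial f l in
  continuous g /\ forall i x, derivable g x (delta_mx 0 i).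

Definition test_function O f := smooth f /\
  exists K, [/\ compact K, K `<=` O & forall x, ~ K x -> f x = 0].

Definition locally_integrable_rV O f := [/\ measurable_fun O f, open O &
  forall K, K `<=` O -> compact K ->
    (\int[lebesgue_rV R n]_(x in K) `|f x|%:E < +oo)%E].

Definition weak_gradient O u (F : 'rV[R]_n -> 'rV[R]_n) := forall i : 'I_n,
  locally_integrable_rV O (fun x => F x ord0 i) /\
  forall phi, test_function O phi ->
    (\int[lebesgue_rV R n]_(x in O) (u x * partial i phi x)%:E =
     - \int[lebesgue_rV R n]_(x in O) (F x ord0 i * phi x)%:E)%E.

(* A distributional gradient is unique up to a null set of O; this is any
   choice of a representative, and 0 if there is none. *)
Definition grad O u : 'rV[R]_n -> 'rV[R]_n :=
  xget (fun=> 0) [set F | weak_gradient O u F].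

Definition ball_average u (x : 'rV[R]_n) (r : R) : \bar R :=
  ((lebesgue_rV R n (eball x r))^-1 *
   \int[lebesgue_rV R n]_(y in eball x r) (u y)%:E)%E.

End test_functions.

Section spaces.
Variables (R : realType) (n : nat) (d : R) (G : set 'rV[R]_n).
Implicit Types u g : 'rV[R]_n -> R.

Definition ahlfors_regular := exists2 C0 : R, 1 <= C0 &
  forall x r, G x -> 0 < r ->
    ((C0^-1 * r `^ d)%:E <= hausdorff_measure d (G `&` eball x r) /\
     hausdorff_measure d (G `&` eball x r) <= (C0 * r `^ d)%:E)%E.

Definition Omega : set 'rV[R]_n := ~` G.

Definition sigma := hausdorff_restr d G.
HB.instance Definition _ := Measure.on sigma.

Definition delta (z : 'rV[R]_n) : R := inf [set enorm (z - x) | x in G].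

Definition weight (z : 'rV[R]_n) : R := delta z `^ (d + 1 - n%:R).

Definition W_norm u : \bar R :=
  ((\int[lebesgue_rV R n]_(z in Omega)
      (enorm (grad Omega u z) ^+ 2 * weight z)%:E) `^ 2^-1)%E.

(* Classes of functions are represented by total functions that are Borel on
   Omega; the values on G are arbitrary. *)
Definition W_space u := [/\ locally_integrable_rV Omega u,
  exists F, weak_gradient Omega u F & (W_norm u < +oo)%E].

(* The integrand vanishes on the diagonal, where it reads 0 / 0 = 0; for d > 0
   the diagonal is null for the product measure. *)
Definition H_norm g : \bar R :=
  ((\int[sigma]_(x in G) \int[sigma]_(y in G)
      (`|g x - g y| ^+ 2 / enorm (x - y) `^ (d + 1))%:E) `^ 2^-1)%E.

(* Likewise, with Borel functions on G whose values outside G are arbitrary. *)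
Definition H_space g := measurable_fun G g /\ (H_norm g < +oo)%E.

End spaces.

(* Main.v *)
Require Import Defs.
From HB Require Import structures.
From mathcomp Require Import all_boot all_order all_algebra.
From mathcomp Require Import all_classical all_reals all_analysis measurable_realfun.
From mathcomp Require Import zify ring lra.
Set Implicit Arguments.
Unset Strict Implicit.
Unset Printing Implicit Defensive.
Import Order.TTheory GRing.Theory Num.Theory.
Import numFieldNormedType.Exports.
Local Open Scope classical_set_scope.
Local Open Scope ring_scope.

(* Since d < n - 1, almost every segment parallel to an axis misses G, so the
   extension of u in W by 0 is absolutely continuous along almost every such
   segment (test the weak gradient against tensor products of bumps), and summing
   over the axes gives a Poincare inequality on every cube Q of R^n, in which the
   gradient only enters through its integral over Q minus G.

   For x in G put V(x, r) = int_{|z - x| < r} |grad u|^2 |x - z|^(3/2 - n) dz, with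
   the sup norm.  By Poincare the mean oscillation of u on the cube of radius r at
   x is at most C r^(1/4) V(x, r)^(1/2), so that the averages of u on balls centered
   at x converge as soon as int |grad u|^2 |x - z|^(1 - n) dz is finite.  By
   Tonelli, and the bound delta(z)^(d + 1 - n) on the integral of |x - z|^(1 - n)
   over x in G coming from Ahlfors regularity, this integral is controlled by
   ||u||_W^2 after integration in x, hence finite for almost every x in G.

   Comparing the averages at x and y on balls of radius |x - y| bounds
   |Tu(x) - Tu(y)|^2 by |x - y|^(1/2) (V(x, 2|x - y|) + V(y, 2|x - y|)).  Integrating
   in y first, Tonelli again turns the H norm into the integral above. *)

(** * Lebesgue measure on row vectors *)

(** Absolute continuity on lines enters only in integrated form, for one displacement v = s e_i at a
    time. If phi is a bump, Phi(x) = s int_0^1 phi(x - t v) dt is smooth with compact support and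
    d_i Phi = phi - phi(. - v). Testing with Phi and transposing the translations gives u(x + v) -
    u(x) = s int_0^1 d_i u(x + t v) dt for almost every x whose segment avoids G. No special
    representative of u is chosen, and the exceptional set may depend on v, since the increments are
    integrated afterwards.

    Two norms coexist: the statement speaks of Euclidean balls, whereas the estimates live on
    sup-norm cubes, which contain the path between two of their points that changes one coordinate
    at a time. The comparison costs powers of n.

    The weight arises from 1 - n = -(d + (n - 1 - d)): on a d-dimensional set, the part of this
    kernel at distance at least t integrates to t^-(n - 1 - d), up to a constant. So d < n - 1
    serves twice, here and to make almost every segment miss G.

    An element of W is arbitrary on G and may fail to be measurable there; estimates concern its
    extension by 0, and averages do not see the change because G is Lebesgue-null. *)

Section lebesgue_rV_theory.
Variables (R : realType) (n : nat).
Implicit Types (a b h x y : 'rV[R]_n) (U : set 'rV[R]_n).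

Definition obox a b : set 'rV[R]_n :=
  [set x : 'rV[R]_n | forall i, a ord0 i < x ord0 i < b ord0 i].

Definition cbox a b : set 'rV[R]_n :=
  [set x : 'rV[R]_n | forall i, a ord0 i <= x ord0 i <= b ord0 i].

Lemma ball_obox x (r : R) : 0 < r ->
  ball x r = obox (x - const_mx r) (x + const_mx r).
Proof.
move=> r0; apply/seteqP; split => y.
  move=> [_ xy] i; have := xy ord0 i; rewrite /ball/= !mxE.
  by rewrite ltr_distlC.
move=> xy; split => // i j; rewrite (ord1 i); have := xy j.
by rewrite /ball/= !mxE ltr_distlC.
Qed.

Lemma open_obox a b : open (obox a b).
Proof.
rewrite openE => x xab.
suff: nbhs x (fun y : 'rV[R]_n => forall i, a ord0 i < y ord0 i < b ord0 i) by [].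
apply: (@filter_forall 'rV[R]_n _ _ (nbhs x)) => i; have /andP[ax xb] := xab i.
have ci := @coord_continuous R 1 n ord0 i x.
have H1 := cvgr_gt _ ci _ ax; have H2 := cvgr_lt _ ci _ xb.
by near=> y; apply/andP; split; near: y; [exact: H1|exact: H2].
Unshelve. all: by end_near. Qed.

Lemma measurable_obox a b : measurable (obox a b).
Proof. by apply: open_measurable_rV; exact: open_obox. Qed.

Lemma measurable_coord_rV (i : 'I_n) :
  measurable_fun setT (fun x : 'rV[R]_n => x ord0 i).
Proof. by apply: continuous_measurable_rV; exact: coord_continuous. Qed.

Definition rat_ball (c : 'rV[rat]_n * nat) : set 'rV[R]_n :=
  ball (map_mx ratr c.1 : 'rV[R]_n) c.2.+1%:R^-1.

(** Second countability: a rational centre within 1/(k+1) of a point x of U gives a ball around x,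
    and 2/(k+1) < e keeps it inside U. [set0] fills the indices that code no ball inside U. *)
Lemma open_bigcup_rat_ball U : open U -> exists F : (set 'rV[R]_n)^nat,
  U = \bigcup_k F k /\
  forall k, F k = set0 \/ exists2 c, F k = rat_ball c & rat_ball c `<=` U.
Proof.
move=> oU; exists (fun k => if unpickle k is Some c then
  if `[< rat_ball c `<=` U >] then rat_ball c else set0 else set0); split; last first.
  move=> k; case: unpickle => [c|]; last by left.
  by case: asboolP => cU; [right; exists c|left].
apply/seteqP; split => [x Ux|x [k _]]; last first.
  by case: unpickle => // c; case: asboolP => // cU; exact: cU.
have /nbhs_ballP[e /= e0 eU] : nbhs x U by exact: open_nbhs_nbhs.
have [k ke] : exists k, 2 * k.+1%:R^-1 < e.
  have [k] := ltr_add_invr (@divr_gt0 R e 2 e0 ltac:(by [])).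
  by rewrite add0r => ke; exists k; move: ke; rewrite ltr_pdivlMr// mulrC.
have k0 : 0 < k.+1%:R^-1 :> R by [].
have [q qx] := rat_dense_rV x k0.
exists (pickle (q, k)) => //; rewrite pickleK.
case: asboolP => [_|[]].
  exact: ball_sym.
move=> y /= qy; apply: eU; apply: (le_ball (ltW ke)).
by rewrite mulr2n mulrDl mul1r; exact: ball_triangle qx qy.
Qed.

(** The sigma-algebra is generated by the open sets, not defined as a product; an open set is a
    countable union of cubes, and the preimage of a cube is a finite intersection of coordinate
    preimages. *)
Lemma measurable_rV_coord d (T : measurableType d) (f : T -> 'rV[R]_n) :
  (forall i, measurable_fun setT (fun t => f t ord0 i)) -> measurable_fun setT f.
Proof.
move=> mf; apply: measurable_rV_fun => U /open_bigcup_rat_ball[F [-> FU]].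
rewrite preimage_bigcup; apply: bigcup_measurable => k _.
have [->|[c -> _]] := FU k; first by rewrite preimage_set0.
rewrite /rat_ball ball_obox//.
set a := _ - _; set b := _ + _.
have -> : f @^-1` obox a b =
    \bigcap_(i in [set` finset.setT]) ((fun t => f t ord0 i) @^-1` `]a ord0 i, b ord0 i[).
  apply/seteqP; split => t /= tab i; first by move=> _; rewrite /= in_itv/=; exact: tab.
  by have := tab i; rewrite /= in_itv/=; apply; rewrite inE.
apply: fin_bigcap_measurable; first exact: finite_finset.
by move=> i _; rewrite -[X in measurable X]setTI; apply: mf.
Qed.

Lemma measurable_rVD :
  measurable_fun setT (fun p : 'rV[R]_n * 'rV[R]_n => p.1 + p.2).
Proof.
apply: measurable_rV_coord => i.
under eq_fun do rewrite mxE.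
by apply: measurable_funD; apply: (measurableT_comp (measurable_coord_rV i)).
Qed.

Lemma measurable_rVB :
  measurable_fun setT (fun p : 'rV[R]_n * 'rV[R]_n => p.1 - p.2).
Proof.
apply: measurable_rV_coord => i.
under eq_fun do rewrite !mxE.
by apply: measurable_funB; apply: (measurableT_comp (measurable_coord_rV i)).
Qed.

Lemma measurable_rV_shift h : measurable_fun setT (fun x => x + h).
Proof.
apply: measurable_rV_coord => i.
under eq_fun do rewrite mxE.
by apply: measurable_funD => //; exact: measurable_coord_rV.
Qed.

Lemma measurable_rV_line (v : 'rV[R]_n) :
  measurable_fun setT (fun p : 'rV[R]_n * (measurableTypeR R) => p.1 + p.2 *: v).
Proof.
apply: measurable_rV_coord => i.
under eq_fun do rewrite !mxE.
apply: measurable_funD; first exact: (measurableT_comp (measurable_coord_rV i)).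
exact: measurable_funM.
Qed.

Lemma measurable_oboxE :
  @measurable _ 'rV[R]_n = <<s [set obox p.1 p.2 | p in [set: 'rV[R]_n * 'rV[R]_n]] >>.
Proof.
apply/seteqP; split; last first.
  apply: smallest_sub; first exact: sigma_algebra_measurable.
  by move=> _ [[a b] _ <-]; exact: measurable_obox.
apply: smallest_sub; first exact: smallest_sigma_algebra.
move=> U /open_bigcup_rat_ball[F [-> FU]].
have [sG0 _ sGU] := smallest_sigma_algebra setT
  [set obox p.1 p.2 | p in [set: 'rV[R]_n * 'rV[R]_n]].
apply: sGU => k; have [->|[c -> _]] := FU k; first exact: sG0.
apply: sub_sigma_algebra; rewrite /rat_ball ball_obox//.
by exists (map_mx ratr c.1 - const_mx c.2.+1%:R^-1, map_mx ratr c.1 + const_mx c.2.+1%:R^-1).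
Qed.

Lemma setI_closed_obox :
  setI_closed [set obox p.1 p.2 | p in [set: 'rV[R]_n * 'rV[R]_n]].
Proof.
move=> _ _ [[a b] _ <-] [[c e] _ <-] /=.
exists (\row_i Num.max (a ord0 i) (c ord0 i), \row_i Num.min (b ord0 i) (e ord0 i)) => //.
apply/seteqP; split => x /=.
  move=> H; split => i; have := H i; rewrite !mxE gt_max lt_min.
    by move=> /andP[/andP[-> _] /andP[-> _]].
  by move=> /andP[/andP[_ ->] /andP[_ ->]].
move=> [H1 H2] i; rewrite !mxE gt_max lt_min.
by move: (H1 i) (H2 i) => /andP[-> ->] /andP[-> ->].
Qed.

Lemma obox_cover : \bigcup_k obox (const_mx (- k%:R)) (const_mx k%:R) = setT.
Proof.
apply/seteqP; split => // x _.
exists (Num.bound `|x|) => // i; rewrite !mxE -ltr_norml.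
apply: (@le_lt_trans _ _ `|x|); last exact: archi_boundP.
by rewrite [leRHS]/Num.norm/= mx_normrE; apply: (le_bigmax _ _ (ord0, i)).
Qed.

(** The sets over which [f] integrates to 0 form a Dynkin system, and boxes are a generating
    pi-system. The hypothesis on the whole space supplies the full set and, with it, complements. *)
Lemma ae_eq0_obox (mu : {measure set 'rV[R]_n -> \bar R}) (f : 'rV[R]_n -> \bar R) :
  mu.-integrable setT f -> (\int[mu]_x f x = 0)%E ->
  (forall a b, \int[mu]_(x in obox a b) f x = 0)%E -> ae_eq mu setT f (cst 0%E).
Proof.
move=> fi f0 fab; apply: integral_ae_eq => // E _ mE.
rewrite integral0.
have : <<s [set obox p.1 p.2 | p in [set: 'rV[R]_n * 'rV[R]_n]] >> E.
  by rewrite -measurable_oboxE.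
move: E {mE}; apply: dynkin_induction.
- exact: measurable_oboxE.
- exact: setI_closed_obox.
- exact: f0.
- by move=> _ [[a b] _ <-]; exact: fab.
- move=> S mS Sf.
  have := f0; rewrite -(setUv S) integral_setU//=.
  + by rewrite Sf add0e.
  + exact: measurableC.
  + by rewrite setUv; exact: measurable_int fi.
  + exact/disj_setPCl.
- move=> F mF tF Ff; rewrite integral_bigcup//.
    by rewrite eseries0.
  by apply: integrableS fi => //; exact: bigcupT_measurable.
Qed.

Lemma measurable_rV_prod (A : 'I_n -> set R) : (forall i, measurable (A i)) ->
  measurable [set x : 'rV[R]_n | forall i, A i (x ord0 i)].
Proof.
move=> mA.
have -> : [set x : 'rV[R]_n | forall i, A i (x ord0 i)] =
    \bigcap_(i in [set` finset.setT]) ((fun x : 'rV[R]_n => x ord0 i) @^-1` A i).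
  apply/seteqP; split => t /= tab i; first by move=> _; exact: tab.
  by have := tab i; rewrite /=; apply; rewrite inE.
apply: fin_bigcap_measurable; first exact: finite_finset.
by move=> i _; rewrite -[X in measurable X]setTI; apply: measurable_coord_rV.
Qed.

End lebesgue_rV_theory.

Section lebesgue_rV_boxes.
Variable R : realType.

Lemma lebesgue_rV_prod n (A : 'I_n -> set R) (m : 'I_n -> R) :
  (forall i, measurable (A i)) ->
  (forall i, lebesgue_measure (A i : set (measurableTypeR R)) = (m i)%:E) ->
  lebesgue_rV R n [set x : 'rV[R]_n | forall i, A i (x ord0 i)] =
    (\prod_(i < n) m i)%:E.
Proof.
elim: n A m => [|n IH] A m mA mE.
  by rewrite big_ord0/= /dirac indicE mem_set// => -[].
rewrite /= /lebesgue_rV_step.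
pose B := [set x : 'rV[R]_n | forall i, A (lift ord0 i) (x ord0 i)].
have -> : @rV_cons R n @^-1` [set x : 'rV[R]_n.+1 | forall i, A i (x ord0 i)] =
    A ord0 `*` B.
  apply/seteqP; split => -[a v] /=.
    move=> H; split => [|i]; first by have := H ord0; rewrite rV_consE unlift_none.
    by have := H (lift ord0 i); rewrite rV_consE liftK.
  move=> [Aa Bv] i; rewrite rV_consE; case: unliftP => [j ->|->] //; exact: Bv.
rewrite product_measure1E; [|exact: mA|by apply: (measurable_rV_prod (A := fun i => A (lift ord0 i)))].
by rewrite (IH (fun i => A (lift ord0 i)) (fun i => m (lift ord0 i)))// [X in (X * _)%E]mE big_ord_recl EFinM.
Qed.

Variable n : nat.
Implicit Types (a b h x y : 'rV[R]_n) (U : set 'rV[R]_n).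
Local Notation leb := (lebesgue_rV R n).

Let oitv a b i : set R := `]a ord0 i, b ord0 i[%classic.
Let citv a b i : set R := `[a ord0 i, b ord0 i]%classic.

Let oboxE a b : obox a b = [set x : 'rV[R]_n | forall i, oitv a b i (x ord0 i)].
Proof.
by apply/seteqP; split => x H i; have := H i; rewrite /oitv /= in_itv.
Qed.

Let cboxE a b : cbox a b = [set x : 'rV[R]_n | forall i, citv a b i (x ord0 i)].
Proof.
by apply/seteqP; split => x H i; have := H i; rewrite /citv /= in_itv.
Qed.

Lemma lebesgue_obox_fine a b : leb (obox a b) =
  (\prod_(i < n) fine (lebesgue_measure (oitv a b i : set (measurableTypeR R))))%:E.
Proof.
rewrite oboxE; apply: (lebesgue_rV_prod (A := oitv a b)) => i; first exact: measurable_itv.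
by rewrite fineK// lebesgue_measure_itv/=; case: ifP.
Qed.

Lemma lebesgue_obox a b : (forall i, a ord0 i <= b ord0 i) ->
  leb (obox a b) = (\prod_(i < n) (b ord0 i - a ord0 i))%:E.
Proof.
move=> ab; rewrite lebesgue_obox_fine; congr (_%:E); apply: eq_bigr => i _.
rewrite lebesgue_measure_itv/= lte_fin; case: ltP => //= ba.
by apply/eqP; rewrite eq_sym subr_eq0 eq_le ba ab.
Qed.

Lemma lebesgue_cbox a b : (forall i, a ord0 i <= b ord0 i) ->
  leb (cbox a b) = (\prod_(i < n) (b ord0 i - a ord0 i))%:E.
Proof.
move=> ab; rewrite cboxE; apply: (lebesgue_rV_prod (A := citv a b)) => i; first exact: measurable_itv.
rewrite lebesgue_measure_itv/= lte_fin; case: ltP => //= ba.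
by congr (_%:E); apply/eqP; rewrite eq_sym subr_eq0 eq_le ba ab.
Qed.

Lemma measurable_cbox a b : measurable (cbox a b).
Proof.
by rewrite cboxE; apply: (measurable_rV_prod (A := citv a b)) => i; exact: measurable_itv.
Qed.

Lemma lebesgue_ball x (r : R) : 0 < r -> leb (ball x r) = ((2 * r) ^+ n)%:E.
Proof.
move=> r0; rewrite ball_obox// lebesgue_obox; last by move=> i; rewrite !mxE; lra.
congr (_%:E); under eq_bigr => i _.
  rewrite !mxE (_ : _ - _ = 2 * r); last by lra.
  over.
by rewrite prodr_const card_ord.
Qed.

Lemma lebesgue_obox_lty a b : (leb (obox a b) < +oo)%E.
Proof. by rewrite lebesgue_obox_fine ltry. Qed.

Lemma preimage_shift_obox h a b : [set x | obox a b (x + h)] = obox (a - h) (b - h).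
Proof.
by apply/seteqP; split => x H i; have := H i; rewrite !mxE ltrBlDr ltrBrDr.
Qed.

(** The measure and its pushforward agree on boxes, a generating pi-system that exhausts the space
    by sets of finite measure. *)
Lemma lebesgue_rV_translate h U : measurable U ->
  leb [set x | U (x + h)] = leb U.
Proof.
move=> mU; have mh := measurable_rV_shift h.
apply: (measure_unique [set obox p.1 p.2 | p in [set: 'rV[R]_n * 'rV[R]_n]]
  (fun k => obox (const_mx (- k%:R)) (const_mx k%:R)) _ _ _ _
  (pushforward leb (fun x => x + h)) leb) => //.
- exact: measurable_oboxE.
- exact: setI_closed_obox.
- by move=> k; exists (const_mx (- k%:R), const_mx k%:R).
- exact: obox_cover.
- move=> _ [[a b] _ <-] /=; rewrite /pushforward.
  rewrite [X in leb X = _]preimage_shift_obox !lebesgue_obox_fine.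
  congr (_%:E); apply: eq_bigr => i _; congr fine.
  rewrite !lebesgue_measure_itv/= !mxE !lte_fin ltrD2r; case: ifP => // _.
  by rewrite -!EFinB; congr (_%:E); lra.
- move=> k; rewrite /= /pushforward [X in leb X]preimage_shift_obox.
  exact: lebesgue_obox_lty.
Qed.

Lemma ge0_integral_translate h (f : 'rV[R]_n -> \bar R) :
  measurable_fun setT f -> (forall x, 0 <= f x)%E ->
  (\int[leb]_x f (x + h)%R = \int[leb]_x f x)%E.
Proof.
move=> mf f0; have mh := measurable_rV_shift h.
have := @ge0_integral_pushforward _ _ _ _ R _ mh leb setT f measurableT mf (fun x _ => f0 x).
rewrite preimage_setT => /= <-; apply: eq_measure_integral => A mA _.
exact: lebesgue_rV_translate.
Qed.

Lemma integrable_translate h (f : 'rV[R]_n -> \bar R) :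
  leb.-integrable setT f -> leb.-integrable setT (fun x => f (x + h)).
Proof.
move=> /integrableP[mf fi]; apply/integrableP; split.
  by apply: measurableT_comp => //; exact: measurable_rV_shift.
by rewrite (@ge0_integral_translate h (fun x => `|f x|%E))//; exact: measurableT_comp.
Qed.

Lemma integral_translate h (f : 'rV[R]_n -> \bar R) :
  leb.-integrable setT f -> (\int[leb]_x f (x + h)%R = \int[leb]_x f x)%E.
Proof.
move=> /integrableP[mf fi].
have mp := measurable_funepos mf; have mn := measurable_funeneg mf.
rewrite integralE [RHS]integralE; congr (_ - _)%E.
  have := ge0_integral_translate h mp (funepos_ge0 f); move=> <-.
  by apply: eq_integral => x _; rewrite !funeposE.
have := ge0_integral_translate h mn (funeneg_ge0 f); move=> <-.
by apply: eq_integral => x _; rewrite !funenegE.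
Qed.

Lemma ae_translate h (P : 'rV[R]_n -> Prop) :
  {ae leb, forall x, P x} -> {ae leb, forall x, P (x + h)}.
Proof.
move=> [N [mN N0 PN]]; exists [set x | N (x + h)]; split.
- by rewrite -[X in measurable X]setTI; exact: measurable_rV_shift.
- by rewrite lebesgue_rV_translate.
- by move=> x /= Px; apply: PN.
Qed.

End lebesgue_rV_boxes.

(** * Smooth bumps *)

Section smooth_line.
Variable R : realType.
Implicit Types (f g : R -> R) (C : set (R -> R)).

Definition derivation_closed C := forall g, C g ->
  exists2 g', C g' & forall x : R, is_derive x 1 g (g' x).

(* A function of class C^oo on the line, described coinductively. *)
Definition smooth1 f := exists2 C, derivation_closed C & C f.

Lemma smooth1_derive f : smooth1 f ->
  exists2 f', smooth1 f' & forall x : R, is_derive x 1 f (f' x).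
Proof.
by move=> [C CC Cf]; have [f' Cf' ff'] := CC _ Cf; exists f' => //; exists C.
Qed.

Lemma smooth1_continuous f : smooth1 f -> continuous f.
Proof.
move=> /smooth1_derive[f' _ ff'] x.
by apply: differentiable_continuous; apply/derivable1_diffP; case: (ff' x).
Qed.

Lemma smooth1_primitive f F : smooth1 f -> (forall x : R, is_derive x 1 F (f x)) ->
  smooth1 F.
Proof.
move=> [C CC Cf] Ff; exists (C `|` [set F]); last by right.
move=> g [Cg|->]; last by exists f => //; left.
by have [g' Cg' gg'] := CC _ Cg; exists g' => //; left.
Qed.

(** By Leibniz the derivative of a product is a sum of products, so the class that witnesses
    smoothness of [f * g] has to be closed under sums. *)
Inductive product_span C1 C2 : set (R -> R) :=
| Product_span_mul f g : C1 f -> C2 g -> product_span C1 C2 (f * g)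
| Product_span_add f g : product_span C1 C2 f -> product_span C1 C2 g ->
    product_span C1 C2 (f + g).

Lemma smooth1M f g : smooth1 f -> smooth1 g -> smooth1 (f * g).
Proof.
move=> [C1 C1C C1f] [C2 C2C C2g]; exists (product_span C1 C2); last exact: Product_span_mul.
move=> h; elim=> [u v Cu Cv|u v _ [u' Cu' uu'] _ [v' Cv' vv']].
  have [[u' Cu' uu'] [v' Cv' vv']] := (C1C _ Cu, C2C _ Cv).
  exists (u * v' + u' * v).
    by apply: Product_span_add; exact: Product_span_mul.
  move=> x; have := is_deriveM (uu' x) (vv' x).
  by rewrite /GRing.scale/= [X in _ + X]mulrC.
exists (u' + v'); first exact: Product_span_add.
by move=> x; exact: is_deriveD.
Qed.

(** The scalar m collects the factors c that the chain rule produces at each derivation. *)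
Definition affine_span C : set (R -> R) :=
  [set h | exists c m e g, C g /\ h = (fun t => m * g (c * t + e))].

Lemma smooth1_affine f (c e : R) : smooth1 f -> smooth1 (fun t => f (c * t + e)).
Proof.
move=> [C CC Cf]; exists (affine_span C); last first.
  by exists c, 1, e, f; split => //; apply/funext => t; rewrite mul1r.
move=> _ [c' [m [e' [g [/CC[g' Cg' gg'] ->]]]]].
exists (fun t => (m * c') * g' (c' * t + e')); first by exists c', (m * c'), e', g'.
move=> x.
have H1 : is_derive x 1 (fun t : R => c' * t + e') c'.
  have := is_deriveD (is_deriveZ c' (is_derive_id x (1 : R))) (is_derive_cst e' x 1).
  by rewrite addr0 /GRing.scale/= mulr1.
have H2 := is_derive1_comp (g := fun t => c' * t + e') (gg' (c' * x + e')) H1.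
have := is_deriveZ m H2.
by rewrite /GRing.scale/= mulrCA mulrC mulrAC.
Qed.

Lemma smooth1B f g : smooth1 f -> smooth1 g -> smooth1 (f - g).
Proof.
move=> [C1 C1C C1f] [C2 C2C C2g].
exists [set h | exists u v, [/\ C1 u, C2 v & h = u - v]]; last by exists f, g.
move=> _ [u [v [/C1C[u' Cu' uu'] /C2C[v' Cv' vv'] ->]]].
exists (u' - v'); first by exists u', v'.
by move=> x; apply: is_deriveB.
Qed.

(** The polynomial makes the family of functions p(1/t) exp(-1/t) stable under derivation, which
    sends p to X^2 (p - p'). The case p = 1 is the classical flat function. *)
Definition flat (p : {poly R}) (t : R) : R :=
  if 0 < t then p.[t^-1] * expR (- t^-1) else 0.

Let flat_poly_bound (p : {poly R}) (s : R) : 1 <= s ->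
  `|p.[s]| <= (\sum_(i < size p) `|p`_i|) * s ^+ size p.
Proof.
move=> s1; rewrite horner_coef mulr_suml.
apply: (le_trans (ler_norm_sum _ _ _)); apply: ler_sum => i _.
rewrite normrM ler_wpM2l// ger0_norm; last by rewrite exprn_ge0//; lra.
by rewrite ler_weXn2l// ltnW.
Qed.

(** A quadratic bound near 0 makes the difference quotients at 0 vanish in the limit. It follows
    from exp(s) >= s^(N+2) / (N+2)! at s = 1/t, with N the size of [p]. *)
Lemma flat_bound (p : {poly R}) : exists K, forall t, t <= 1 -> `|flat p t| <= K * t ^+ 2.
Proof.
exists ((\sum_(i < size p) `|p`_i|) * (size p).+2`!%:R) => t t1.
have S0 : 0 <= \sum_(i < size p) `|p`_i| by apply: sumr_ge0.
rewrite /flat; case: ltP => [t0|_]; last first.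
  by rewrite normr0 mulr_ge0 ?sqr_ge0// mulr_ge0.
have s1 : 1 <= t^-1 by rewrite invf_ge1.
have s0 : 0 < t^-1 by rewrite invr_gt0.
rewrite normrM (ger0_norm (expR_ge0 _)).
apply: (le_trans (ler_wpM2r (expR_ge0 _) (flat_poly_bound p s1))).
rewrite -!mulrA ler_wpM2l//.
have e1 : t^-1 ^+ (size p).+2 / (size p).+2`!%:R <= expR t^-1.
  by apply: le_trans (expR_ge1Dxn (size p).+1 (ltW s0)); rewrite lerDr.
rewrite expRN ler_pdivrMr ?expR_gt0//.
rewrite -ler_pdivrMl; last by rewrite mulr_gt0 ?exprn_gt0// ltr0n fact_gt0.
apply: le_trans e1; rewrite le_eqVlt; apply/orP; left; apply/eqP.
set N := _`!%:R; set s := t^-1.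
by rewrite invfM -exprVn -/s [in RHS]exprS [in RHS]exprS; ring.
Qed.

Lemma derivation_closed_flat : derivation_closed (range flat).
Proof.
move=> _ [p _ <-]; exists (flat ('X^2 * (p - p^`()))); first by exists ('X^2 * (p - p^`())).
move=> x; have [x0|x0|->] := ltgtP x 0.
- rewrite /flat ltNge (ltW x0)/=.
  apply: (near_eq_is_derive (f := cst 0) _ (is_derive_cst (0 : R) x 1)).
  by near=> y; rewrite /= ltNge (ltW _)//; near: y; exact: lt_nbhsl.
- have iV : is_derive x 1 (fun t : R => t^-1) (- x ^- 2).
    have := is_deriveV (lt0r_neq0 x0) (is_derive_id x (1 : R)).
    by rewrite /GRing.scale/= mulr1.
  have H1 := is_derive1_comp (is_derive_poly p x^-1) iV.
  have H2 := is_derive1_comp (g := fun t => - t^-1) (is_derive_expR (- x^-1)) (is_deriveN iV).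
  have H3 : is_derive x 1 (fun t => p.[t^-1] * expR (- t^-1)) (flat ('X^2 * (p - p^`())) x).
    apply: (is_derive_eq (is_deriveM H1 H2)).
    rewrite /flat x0 !hornerE /GRing.scale/=; field.
    by rewrite gt_eqF.
  apply: near_eq_is_derive H3.
  by near=> y; rewrite /flat (_ : 0 < y)//; near: y; exact: lt_nbhsr.
- have [K pK] := flat_bound p.
  have f0 : flat p 0 = 0 by rewrite /flat ltxx.
  have -> : flat ('X^2 * (p - p^`())) 0 = 0 by rewrite /flat ltxx.
  have L : h^-1 *: ((flat p \o shift 0) (h *: 1) - flat p 0) @[h --> 0^'] --> (0 : R).
    apply/cvgr0Pnorm_le => e e0.
    near=> h.
    have h0 : h != 0 by near: h; exact: nbhs_dnbhs_neq.
    rewrite f0 subr0 /= addr0 /GRing.scale/= mulr1 normrM normfV.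
    rewrite ler_pdivrMl ?normr_gt0//.
    have h1 : `|h| < 1.
      by near: h; apply: dnbhs0_lt.
    apply: (le_trans (pK _ _)); first by rewrite (le_trans (ler_norm _))// ltW.
    have hK : `|h| < e / (`|K| + 1).
      by near: h; apply: dnbhs0_lt; rewrite divr_gt0// ltr_wpDl.
    rewrite -real_normK ?num_real// expr2 mulrA mulrC ler_wpM2l//.
    apply: (@le_trans _ _ ((`|K| + 1) * `|h|)).
      by rewrite ler_wpM2r// (le_trans (ler_norm _))// lerDl.
    by rewrite -ler_pdivlMl ?ltr_wpDl// mulrC ltW.
  apply: DeriveDef; first by apply/cvg_ex; exists 0.
  exact/cvg_lim.
Unshelve. all: by end_near. Qed.

Lemma smooth1_flat p : smooth1 (flat p).
Proof. by exists (range flat); [exact: derivation_closed_flat|exists p]. Qed.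

(** The parameter k is a steepness: the bumps take values in [0, 1], vanish off ]a, b[ and converge
    pointwise to its indicator as k grows, which is what dominated convergence asks for. *)
Definition line_bump (k : nat) (a b : R) : R -> R :=
  (fun t => flat 1 (k%:R * t + - (k%:R * a))) * (fun t => flat 1 (- k%:R * t + k%:R * b)).

Lemma flat1_ge0 t : 0 <= flat 1 t.
Proof.
by rewrite /flat; case: ifP => // _; rewrite hornerC mul1r expR_ge0.
Qed.

Lemma flat1_le1 t : flat 1 t <= 1.
Proof.
rewrite /flat; case: ifP => // t0.
by rewrite hornerC mul1r expR_le1 oppr_le0 invr_ge0 ltW.
Qed.

Lemma bump_ge0 k a b t : 0 <= line_bump k a b t.
Proof. by apply: mulr_ge0; exact: flat1_ge0. Qed.

Lemma bump_le1 k a b t : line_bump k a b t <= 1.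
Proof.
by rewrite -[leRHS]mulr1; apply: ler_pM; rewrite ?flat1_ge0 ?flat1_le1.
Qed.

Lemma bump_out k a b t : ~~ (a < t < b) -> line_bump k a b t = 0.
Proof.
rewrite negb_and -!leNgt /line_bump => /orP[ta|bt]; apply/eqP; rewrite mulf_eq0 /flat.
  by rewrite [X in 0 < X](_ : _ = k%:R * (t - a)) ?ltNge ?mulr_ge0_le0 ?subr_le0 ?eqxx//; ring.
rewrite [X in _ || ((if 0 < X then _ else _) == _)](_ : _ = k%:R * (b - t)); last by ring.
by rewrite [0 < _ * _]ltNge mulr_ge0_le0 ?subr_le0 ?eqxx ?orbT//.
Qed.

Let cvg_flat1 (c : R) : 0 < c -> flat 1 (k%:R * c) @[k --> \oo] --> (1 : R).
Proof.
move=> c0.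
have H : expR (- (c^-1 * k.+1%:R^-1)) @[k --> \oo] --> (1 : R).
  rewrite [X in _ --> X](_ : 1 = expR (- (c^-1 * 0))); last by rewrite mulr0 oppr0 expR0.
  apply: continuous_cvg; first exact: continuous_expR.
  by apply: cvgN; apply: cvgM; [exact: cvg_cst|exact: cvg_harmonic].
rewrite -(cvg_shiftS (fun k => flat 1 (k%:R * c))).
apply: cvg_trans H; apply: near_eq_cvg; near=> k.
by rewrite /flat/= mulr_gt0// hornerC mul1r invfM mulrC.
Unshelve. all: by end_near. Qed.

Lemma cvg_bump a b t : line_bump k a b t @[k --> \oo] --> ((a < t < b)%R%:R : R).
Proof.
case: (boolP (a < t < b)) => [/andP[ta tb]|tab] /=; last first.
  by under eq_fun do rewrite bump_out//; exact: cvg_cst.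
have H1 : flat 1 (k%:R * t + - (k%:R * a)) @[k --> \oo] --> (1 : R).
  under eq_fun do rewrite -mulrBr.
  by apply: cvg_flat1; rewrite subr_gt0.
have H2 : flat 1 (- k%:R * t + k%:R * b) @[k --> \oo] --> (1 : R).
  under eq_fun do rewrite mulNr addrC -mulrBr.
  by apply: cvg_flat1; rewrite subr_gt0.
by rewrite -[X in _ --> X]mulr1; exact: cvgM H1 H2.
Qed.

End smooth_line.

(** * Tensor products of functions of one variable *)

Section tensor.
Variables (R : realType) (n : nat).
Implicit Types (g : 'I_n -> R -> R) (x : 'rV[R]_n).

Definition tensor g x : R := \prod_(i < n) g i (x ord0 i).

Definition update g (i : 'I_n) (h : R -> R) : 'I_n -> R -> R :=
  fun j => if j == i then h else g j.

Lemma tensor_update g i h x :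
  tensor (update g i h) x = h (x ord0 i) * \prod_(j < n | j != i) g j (x ord0 j).
Proof.
rewrite /tensor (bigD1 i)//= /update eqxx; congr (_ * _).
by apply: eq_bigr => j /negbTE ->.
Qed.

Lemma tensorD1 g i x :
  tensor g x = g i (x ord0 i) * \prod_(j < n | j != i) g j (x ord0 j).
Proof. by rewrite /tensor (bigD1 i). Qed.

Lemma is_derive_tensor g i h x : (forall t : R, is_derive t 1 (g i) (h t)) ->
  is_derive x (delta_mx 0 i) (tensor g) (tensor (update g i h) x).
Proof.
move=> gh; set P := \prod_(j < n | j != i) g j (x ord0 j).
have E : (fun t : R => t^-1 *: ((tensor g \o shift x) (t *: delta_mx 0 i) - tensor g x)) =
    (fun t : R => (t^-1 *: ((g i \o shift (x ord0 i)) (t *: (1 : R)) - g i (x ord0 i))) * P).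
  apply/funext => t; rewrite /= !(tensorD1 g i) -/P.
  have -> : \prod_(j < n | j != i) g j ((t *: delta_mx 0 i + x) ord0 j) = P.
    apply: eq_bigr => j ji; congr (g j _); rewrite !mxE eqxx/= (negbTE ji).
    by rewrite mulr0 add0r.
  by rewrite -mulrBl scalerAl !mxE !eqxx/= [t *: 1]/GRing.scale/=.
have [d1 d2] := gh (x ord0 i).
have C : t^-1 *: ((tensor g \o shift x) (t *: delta_mx 0 i) - tensor g x) @[t --> 0^'] -->
    tensor (update g i h) x.
  rewrite E tensor_update -/P; apply: cvgM; last exact: cvg_cst.
  by rewrite -d2; exact: d1.
apply: DeriveDef; first by apply/cvg_ex; eexists; exact: C.
exact/cvg_lim.
Qed.

Lemma partial_tensor g i h : (forall t : R, is_derive t 1 (g i) (h t)) ->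
  partial i (tensor g) = tensor (update g i h).
Proof.
by move=> gh; apply/funext => x; have [_] := is_derive_tensor x gh.
Qed.

Lemma continuous_tensor g : (forall i, continuous (g i)) -> continuous (tensor g).
Proof.
move=> cg; rewrite /tensor.
apply: (@continuous_big R _ *%R 1 xpredT _ 'rV[R]_n _ (fun i x => g i (x ord0 i))) => [|i _]; first exact: mul_continuous.
by move=> x; apply: continuous_comp; [exact: coord_continuous|exact: cg].
Qed.

(** A partial derivative replaces one factor by its derivative, so every iterated partial derivative
    of a tensor product is again one, with smooth factors. *)
Lemma smooth_tensor g : (forall i, smooth1 (g i)) -> smooth (tensor g).
Proof.
move=> sg l.
have [g' sg' ->] : exists2 g', (forall i, smooth1 (g' i)) & foldr (@partial R n) (tensor g) l = tensor g'.
  elim: l => [|i l [g' sg' /= ->]]; first by exists g.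
  have [h sh hE] := smooth1_derive (sg' i).
  exists (update g' i h); last exact: partial_tensor.
  by move=> j; rewrite /update; case: ifP.
split; first by apply: continuous_tensor => i; exact: smooth1_continuous.
move=> i x; have [h sh hE] := smooth1_derive (sg' i).
by have [] := is_derive_tensor x hE.
Qed.

Lemma tensor_neq0 g x : tensor g x != 0 -> forall i, g i (x ord0 i) != 0.
Proof. by move=> /prodf_neq0 H i; exact: H. Qed.

End tensor.

(** * Primitives on the line *)

Section primitives.
Variable R : realType.
Local Notation lam := (@lebesgue_measure R).

Lemma continuous_support_primitive (b : R -> R) (l r : R) : continuous b ->
  (forall t, ~~ (l < t < r) -> b t = 0) ->
  exists A : R -> R, forall t : R, is_derive t 1 A (b t).
Proof.
move=> cb b0.
have ib : lam.-integrable setT (EFin \o b).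
  have : lam.-integrable `[l, r] (EFin \o b).
    apply: continuous_compact_integrable; first exact: segment_compact.
    exact: continuous_subspaceT.
  move=> /integrable_mkcond => /(_ ltac:(by [])).
  apply: eq_integrable => // t _; rewrite patchE.
  case: ifPn => // /negP; rewrite inE/= in_itv/= => /negP tlr.
  by rewrite /= b0//; apply: contra tlr => /andP[/ltW -> /ltW ->].
exists (fun x => \int[lam]_(t in `]-oo, x]) b t)%R => t.
have tt1 : t < t + 1 by rewrite ltrDl.
have it : lam.-integrable `]-oo, (t + 1)] (EFin \o b).
  by apply: (integrableS _ _ _ ib).
have [d1 d2] := continuous_FTC1 tt1 it (ltNyr _) (cb t).
by apply: DeriveDef; [exact: d1|rewrite -derive1E].
Qed.

(** Parametrizing the segment from t to t - s by [0, 1] treats both signs of [s] at once. *)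
Lemma primitive_difference (A b : R -> R) (t s : R) : continuous b ->
  (forall t : R, is_derive t 1 A (b t)) ->
  ((A t - A (t - s))%:E = s%:E * \int[lam]_(x in `[0%R, 1%R]) (b (t - x * s))%:E)%E.
Proof.
move=> cb Ab.
have Lc : continuous (fun x : R => t - x * s).
  by move=> x; apply: cvgB; [exact: cvg_cst|apply: cvgM; [exact: cvg_id|exact: cvg_cst]].
have Gd (x : R) : is_derive x 1 (fun x : R => - A (t - x * s)) (s * b (t - x * s)).
  have H1 : is_derive x 1 (fun x : R => t - x * s) (- s).
    have := is_deriveB (is_derive_cst t x (1 : R))
      (is_deriveM (is_derive_id x (1 : R)) (is_derive_cst s x (1 : R))).
    by rewrite /GRing.scale/= mulr0 mulr1 !add0r.
  have := is_deriveN (is_derive1_comp (g := fun x : R => t - x * s) (Ab (t - x * s)) H1).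
  by rewrite mulrN opprK mulrC.
have Gc : continuous (fun x : R => - A (t - x * s)).
  move=> x; apply: differentiable_continuous; apply/derivable1_diffP.
  by case: (Gd x).
have fc : continuous (fun x : R => b (t - x * s)).
  by move=> x; apply: continuous_comp; [exact: Lc|exact: cb].
have fi : lam.-integrable `[0, 1] (fun x => (b (t - x * s))%:E).
  apply: (@continuous_compact_integrable R (fun x => b (t - x * s))); first exact: segment_compact.
  exact: continuous_subspaceT.
rewrite -integralZl//.
have := @continuous_FTC2 R (fun x => s * b (t - x * s)) (fun x => - A (t - x * s)) 0 1 ltr01.
move=> ->.
- by rewrite mul1r mul0r subr0 -EFinB opprK addrC.
- apply: continuous_subspaceT => x.
  by apply: cvgM; [exact: cvg_cst|exact: fc].
- split.
  + by move=> x _; case: (Gd x).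
  + exact: cvg_at_right_filter (Gc 0).
  + exact: cvg_at_left_filter (Gc 1).
- by move=> x _; rewrite derive1E; case: (Gd x).
Qed.

End primitives.

(** * Weak derivatives along segments *)

Section compact_thickening.
Variables (R : realType) (n : nat).
Implicit Types (a b v : 'rV[R]_n).

(** The Minkowski sum of the box and the segment from 0 to v. It contains the support of the test
    functions built below, as well as all segments of direction v issued from the box. *)
Definition swept_cbox a b v : set 'rV[R]_n :=
  [set p.1 + p.2 *: v | p in cbox a b `*` (`[0, 1]%classic : set R)].

Lemma compact_cbox a b : compact (cbox a b).
Proof.
have -> : cbox a b =
  [set x : 'rV[R]_n | forall i, (`[a ord0 i, b ord0 i]%classic : set R) (x ord0 i)].
  by apply/seteqP; split => x H i; have := H i; rewrite /= in_itv.
by apply: (rV_compact (A := fun i => `[a ord0 i, b ord0 i]%classic)) => i; exact: segment_compact.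
Qed.

Lemma compact_swept_cbox a b v : compact (swept_cbox a b v).
Proof.
apply: continuous_compact; last first.
  by apply: compact_setX; [exact: compact_cbox|exact: segment_compact].
apply: continuous_subspaceT => p; apply: cvgD; first exact: cvg_fst.
by apply: cvgZr_tmp; exact: cvg_snd.
Qed.

Lemma measurable_compact_rV (K : set 'rV[R]_n) : compact K -> measurable K.
Proof.
move=> cK; rewrite -(setCK K); apply: measurableC; apply: open_measurable_rV.
by apply: closed_openC; apply: compact_closed => //; exact: norm_hausdorff.
Qed.

End compact_thickening.

Section measurable_EFin.
Context d (T : measurableType d) (R : realType).

Lemma measurable_EFin (D : set T) (f : T -> R) :
  measurable_fun D f -> measurable_fun D (fun x => (f x)%:E).
Proof. by move=> /measurable_EFinP. Qed.

Lemma measurable_EFin_norm (D : set T) (f : T -> R) :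
  measurable_fun D f -> measurable_fun D (fun x => `|f x|%:E).
Proof. by move=> mf; apply: measurable_EFin; exact: measurableT_comp. Qed.

End measurable_EFin.

Section weak_derivative_on_lines.
Variables (R : realType) (n : nat) (i : 'I_n) (s : R).
Local Notation leb := (lebesgue_rV R n).
Local Notation lam := (@lebesgue_measure R).
Local Notation unit01 := (`[0%R, 1%R]%classic : set (measurableTypeR R)).
Let v : 'rV[R]_n := s *: delta_mx 0 i.

Let lam01 : lam unit01 = 1%E.
Proof. by rewrite lebesgue_measure_itv/= lte_fin ltr01 sube0. Qed.

Let measurable_indic01 : measurable_fun setT (\1_unit01 : measurableTypeR R -> R).
Proof. by apply: measurable_indic. Qed.

Lemma integral_indic01 (M : \bar R) : (0 <= M)%E ->
  (\int[lam]_t ((\1_unit01 t)%:E * M) = M)%E.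
Proof.
move=> M0; rewrite ge0_integralZr//=; last exact: measurable_EFin.
rewrite -[X in _ = X]mul1e; congr (_ * _)%E.
by rewrite integral_indic// setIT; exact: lam01.
Qed.

(** An indicator carries the restriction of t to [0, 1], so that Fubini applies on the whole product
    space. *)
Let strip (f : 'rV[R]_n -> R) (p : 'rV[R]_n * measurableTypeR R) : \bar R :=
  (f (p.1 + p.2 *: v) * \1_unit01 p.2)%:E.

Let integrable_strip f : leb.-integrable setT (EFin \o f) ->
  (leb \x lam)%E.-integrable setT (strip f).
Proof.
move=> /integrableP[/measurable_EFinP mf fi].
have ms : measurable_fun setT (strip f).
  apply/measurable_EFinP; apply: measurable_funM.
    by apply: measurableT_comp => //; exact: measurable_rV_line.
  exact: (measurableT_comp measurable_indic01).
apply/(integrable21ltyP _ _ ms) => /=.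
set M := (\int[leb]_x `|(EFin \o f) x|)%E in fi.
rewrite (_ : (\int[lam]_t _ = \int[lam]_t ((\1_unit01 t)%:E * M))%E); last first.
  apply: eq_integral => t _; rewrite /strip/=.
  under eq_integral do rewrite normrM EFinM muleC.
  rewrite ge0_integralZl//=; last first.
    apply: measurable_EFin_norm; apply: measurableT_comp => //.
    exact: measurable_rV_shift.
  rewrite ger0_norm//; congr (_ * _)%E.
  apply: (ge0_integral_translate (t *: v) (f := fun x => `|f x|%:E)) => //.
  exact: measurable_EFin_norm.
by rewrite integral_indic01//; exact: integral_ge0.
Qed.

Let integrable_strip_cst f : leb.-integrable setT (EFin \o f) ->
  (leb \x lam)%E.-integrable setT
    (fun p : 'rV[R]_n * measurableTypeR R => (f p.1 * \1_unit01 p.2)%:E).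
Proof.
move=> /integrableP[/measurable_EFinP mf fi].
have ms : measurable_fun setT
    (fun p : 'rV[R]_n * measurableTypeR R => (f p.1 * \1_unit01 p.2)%:E).
  apply/measurable_EFinP; apply: measurable_funM.
    exact: (measurableT_comp mf).
  exact: (measurableT_comp measurable_indic01).
apply/(integrable21ltyP _ _ ms) => /=.
set M := (\int[leb]_x `|(EFin \o f) x|)%E in fi.
rewrite (_ : (\int[lam]_t _ = \int[lam]_t ((\1_unit01 t)%:E * M))%E); last first.
  apply: eq_integral => t _.
  under eq_integral do rewrite normrM EFinM muleC.
  rewrite ge0_integralZl//=; last exact: measurable_EFin_norm.
  by rewrite ger0_norm.
by rewrite integral_indic01//; exact: integral_ge0.
Qed.

Let integrable_mul_le1 d (T : measurableType d) (mu : {measure set T -> \bar R})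
    (f g : T -> R) : measurable_fun setT g -> (forall x, `|g x| <= 1) ->
  mu.-integrable setT (EFin \o f) -> mu.-integrable setT (fun x => (f x * g x)%:E).
Proof.
move=> mg g1 fi.
have mf : measurable_fun setT f by apply/measurable_EFinP; exact: measurable_int fi.
apply: le_integrable fi => //.
  by apply: measurable_EFin; exact: measurable_funM.
by move=> x _; rewrite lee_fin normrM ler_piMr.
Qed.

Lemma measurable_tensor (g : 'I_n -> R -> R) : (forall j, continuous (g j)) ->
  measurable_fun setT (tensor g).
Proof. by move=> cg; apply: continuous_measurable_rV; exact: continuous_tensor. Qed.

(** Averaging along v and averaging along -v are adjoint: Fubini, then the translation by [t *: v]
    for each t, moves the average from [f] to [phi]. *)
Let strip_swap (f : 'rV[R]_n -> R) (phi : 'rV[R]_n -> R) :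
  leb.-integrable setT (EFin \o f) -> measurable_fun setT phi ->
  (forall x, 0 <= phi x <= 1) ->
  leb.-integrable setT
    (fun y => (f y)%:E * \int[lam]_(t in unit01) (phi (y - t *: v))%:E)%E /\
  (\int[leb]_y ((\int[lam]_t strip f (y, t)) * (phi y)%:E) =
   \int[leb]_y ((f y)%:E * \int[lam]_(t in unit01) (phi (y - t *: v))%:E))%E.
Proof.
move=> fi mphi phi01.
have phi1 x : `|phi x| <= 1 by have /andP[? ?] := phi01 x; rewrite ger0_norm.
have si := integrable_strip fi.
have spi : (leb \x lam)%E.-integrable setT
    (fun p => (f (p.1 + p.2 *: v) * \1_unit01 p.2 * phi p.1)%:E).
  apply: (@integrable_mul_le1 _ _ _ (fun p : 'rV[R]_n * measurableTypeR R => f (p.1 + p.2 *: v) * \1_unit01 p.2)) => //.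
  exact: (measurableT_comp mphi).
have sqi : (leb \x lam)%E.-integrable setT
    (fun p => (f p.1 * \1_unit01 p.2 * phi (p.1 - p.2 *: v))%:E).
  apply: (@integrable_mul_le1 _ _ _ (fun p : 'rV[R]_n * measurableTypeR R => f p.1 * \1_unit01 p.2)) => //.
    apply: measurableT_comp => //.
    under eq_fun do rewrite -scalerN.
    exact: measurable_rV_line.
  exact: integrable_strip_cst.
have qE : fubini_F lam (fun p => (f p.1 * \1_unit01 p.2 * phi (p.1 - p.2 *: v))%:E) =
    (fun y => (f y)%:E * \int[lam]_(t in unit01) (phi (y - t *: v))%:E)%E.
  apply/funext => y; apply/esym.
  rewrite [X in (_ * X)%E]integral_mkcond -integralZl//=; last first.
    rewrite (_ : _ \_ _ = fun t => ((\1_unit01 t) * phi (y - t *: v))%:E); last first.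
      by apply/funext => t; rewrite patchE indicE; case: ifP => _; rewrite ?mul1r ?mul0r.
    apply: integrable_mul_le1 => //.
      apply: measurableT_comp => //.
      under eq_fun do rewrite -scalerN.
      exact: (measurableT_comp (measurable_rV_line _) (pair1_measurable _)).
    apply/integrableP; split; first exact/measurable_EFinP.
    under eq_integral do rewrite /= ger0_norm//.
    by rewrite integral_indic// setIT [X in (X < _)%E]lam01 ltry.
  apply: eq_integral => t _; rewrite patchE indicE; case: ifP => _ /=.
    by rewrite mulr1 EFinM.
  by rewrite mulr0 mul0r mule0.
split; first by rewrite -qE; exact: integrable_fubini_F.
rewrite -qE.
transitivity (\int[leb]_y \int[lam]_t (f (y + t *: v) * \1_unit01 t * phi y)%:E)%E.
  apply: ae_eq_integral => //.
  - apply: emeasurable_funM; last exact/measurable_EFinP.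
    by have := integrable_fubini_F si; exact: measurable_int.
  - by have := integrable_fubini_F spi; exact: measurable_int.
  apply: filterS (ae_integrable1 si) => y yi _.
  by rewrite -integralZr//; exact: eq_integral.
rewrite (Fubini spi) /=.
transitivity (\int[lam]_t \int[leb]_y (f y * \1_unit01 t * phi (y - t *: v))%:E)%E.
  apply: eq_integral => t _.
  rewrite -(@integral_translate _ _ (t *: v) (fun y => (f y * \1_unit01 t * phi (y - t *: v))%:E)).
    by apply: eq_integral => y _; rewrite addrK.
  apply: (@integrable_mul_le1 _ _ _ (fun y => f y * \1_unit01 t)) => //.
    by apply: measurableT_comp => //; exact: measurable_rV_shift.
  apply: integrable_mul_le1 => // _.
  by rewrite ger0_norm// indicE; case: (_ \in _).
by rewrite -(Fubini sqi).
Qed.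

Let bumps k (c e : 'rV[R]_n) (j : 'I_n) : R -> R := line_bump k (c ord0 j) (e ord0 j).

Let smooth1_bump k (c e : R) : smooth1 (line_bump k c e).
Proof.
apply: smooth1M.
  exact: (smooth1_affine _ (- (k%:R * c)) (smooth1_flat 1)).
exact: (smooth1_affine (- k%:R) (k%:R * e) (smooth1_flat 1)).
Qed.

Let tensor_bumps01 k c e (x : 'rV[R]_n) : 0 <= tensor (bumps k c e) x <= 1.
Proof.
rewrite /tensor; apply/andP; split.
  by apply: prodr_ge0 => j _; exact: bump_ge0.
by apply: prodr_ile1 => j; rewrite bump_ge0 bump_le1.
Qed.

Let tensor_bumps_out k c e (x : 'rV[R]_n) : ~ obox c e x -> tensor (bumps k c e) x = 0.
Proof.
move=> cex; apply/eqP/negPn/negP => /tensor_neq0 H; apply: cex => j.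
by apply/negPn/negP => /bump_out b0; have := H j; rewrite /bumps b0 eqxx.
Qed.

Let cvg_tensor_bumps c e (x : 'rV[R]_n) :
  tensor (bumps k c e) x @[k --> \oo] --> (\1_(obox c e) x : R).
Proof.
have -> : \1_(obox c e) x = \prod_(j < n) (c ord0 j < x ord0 j < e ord0 j)%R%:R :> R.
  rewrite indicE; case: (boolP (x \in obox c e)) => [/set_mem xce|/negP xce].
    by rewrite big1// => j _; rewrite xce.
  apply/esym/eqP; rewrite prodf_seq_eq0; apply/negPn/negP => /hasPn H.
  apply: xce; apply/mem_set => j; apply/negPn/negP => xj.
  by have := H j (mem_index_enum j); rewrite (negbTE xj) eqxx.
apply: (@cvg_big R _ *%R 1 xpredT _ _ _ _ (fun j k => bumps k c e j (x ord0 j))).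
  exact: mul_continuous.
by move=> j _; exact: cvg_bump.
Qed.

Let shift_coord (x : 'rV[R]_n) (t : R) j :
  (x - t *: v) ord0 j = if j == i then x ord0 i - t * s else x ord0 j.
Proof.
by rewrite !mxE eqxx/= eq_sym; case: eqP => [->|_]; rewrite ?mulr1 ?mulr0 ?subr0.
Qed.

Let tensor_shift (g : 'I_n -> R -> R) (x : 'rV[R]_n) (t : R) :
  tensor g (x - t *: v) = g i (x ord0 i - t * s) * \prod_(j < n | j != i) g j (x ord0 j).
Proof.
rewrite (tensorD1 g i) shift_coord eqxx; congr (_ * _).
by apply: eq_bigr => j /negbTE ji; rewrite shift_coord ji.
Qed.

Section bump_primitive.
Variables (k : nat) (c e : 'rV[R]_n).
Let phi := tensor (bumps k c e).

(** A primitive A of the i-th factor is in general not compactly supported, but B(t) = A(t) - A(t -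
    s) is, and its derivative is a difference of two bumps. Replacing the i-th factor by B gives
    Phi; the integral formula shows where Phi vanishes and that it averages [phi] along -v. *)
Let swept_bump : exists Phi : 'rV[R]_n -> R, [/\ smooth Phi,
  partial i Phi = fun x => phi x - phi (x - v) &
  forall x, ((Phi x)%:E = s%:E * \int[lam]_(t in unit01) (phi (x - t *: v))%:E)%E].
Proof.
have cb : continuous (bumps k c e i) by apply: smooth1_continuous; exact: smooth1_bump.
have [A Ab] := @continuous_support_primitive _ _ (c ord0 i) (e ord0 i) cb (@bump_out _ _ _ _).
have sA : smooth1 A by apply: smooth1_primitive Ab; exact: smooth1_bump.
pose B (t : R) := A t - A (1 * t + - s).
have sB : smooth1 B by apply: smooth1B => //; exact: smooth1_affine.
exists (tensor (update (bumps k c e) i B)); split.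
- by apply: smooth_tensor => j; rewrite /update; case: ifP => // _; exact: smooth1_bump.
- have dB (t : R) : is_derive t 1 (update (bumps k c e) i B i)
      (bumps k c e i t - bumps k c e i (t - s)).
    rewrite /update eqxx.
    have H1 : is_derive t 1 (fun t : R => 1 * t + - s) 1.
      have := is_deriveD (is_deriveZ 1 (is_derive_id t (1 : R))) (is_derive_cst (- s) t 1).
      by rewrite addr0 /GRing.scale/= mulr1.
    have H2 := is_derive1_comp (g := fun t => 1 * t + - s) (Ab (1 * t + - s)) H1.
    by have := is_deriveB (Ab t) H2; rewrite mulr1 mul1r.
  rewrite (partial_tensor dB); apply/funext => x.
  have -> : x - v = x - 1 *: v by rewrite scale1r.
  rewrite /phi tensor_update tensor_shift (tensorD1 (bumps k c e) i) mul1r.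
  rewrite -mulrBl; congr (_ * _).
  by apply: eq_bigr => j /negbTE ji; rewrite /update ji.
- move=> x; rewrite tensor_update EFinM /B mul1r (primitive_difference _ _ cb Ab).
  rewrite -muleA; congr (_ * _)%E; rewrite -integralZr//.
    by apply: eq_integral => t _; rewrite /phi tensor_shift EFinM.
  have ct (g : R -> R) : continuous g -> continuous (fun t : R => g (x ord0 i - t * s)).
    move=> cg t; apply: continuous_comp; last exact: cg.
    by apply: cvgB; [exact: cvg_cst|apply: cvgM; [exact: cvg_id|exact: cvg_cst]].
  apply: (@continuous_compact_integrable R (fun t => bumps k c e i (x ord0 i - t * s))).
    exact: segment_compact.
  by apply: continuous_subspaceT; exact: ct.
Qed.

Variables (O : set 'rV[R]_n) (a b : 'rV[R]_n) (u f : 'rV[R]_n -> R).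
Hypothesis wf : forall psi, test_function O psi ->
  (\int[leb]_(x in O) (u x * partial i psi x)%:E =
   - \int[leb]_(x in O) (f x * psi x)%:E)%E.
Let K := swept_cbox a b v.
Hypotheses (KO : K `<=` O) (ac : forall j, a ord0 j <= c ord0 j)
  (eb : forall j, e ord0 j <= b ord0 j).

Let phi_out x (t : R) : 0 <= t <= 1 -> ~ K x -> phi (x - t *: v) = 0.
Proof.
move=> t01 Kx; apply: tensor_bumps_out => cex; apply: Kx.
exists (x - t *: v, t); last by rewrite /= subrK.
split; last by rewrite /= in_itv.
move=> j /=; have /andP[H1 H2] := cex j.
by rewrite (le_trans (ac j) (ltW H1)) (le_trans (ltW H2) (eb j)).
Qed.

(** The weak gradient is tested against Phi. Both Phi and its partial derivative vanish off [K], so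
    cutting [u] and [f] off to [K] costs nothing and makes them integrable on the whole space. *)
Let weak_swept_bump :
  (\int[leb]_x (u x * \1_K x * (phi x - phi (x - v)))%:E =
   - \int[leb]_x ((f x * \1_K x)%:E *
       (s%:E * \int[lam]_(t in unit01) (phi (x - t *: v))%:E)))%E.
Proof.
have [Phi [sPhi dPhi PhiE]] := swept_bump.
have Phi0 x : ~ K x -> Phi x = 0.
  move=> Kx; apply: EFin_inj; rewrite PhiE.
  under eq_integral => t /set_mem /= t01.
    rewrite phi_out//.
    over.
  by rewrite integral0 mule0.
have tPhi : test_function O Phi.
  by split => //; exists K; split => //; exact: compact_swept_cbox.
have := wf tPhi; rewrite dPhi => W.
transitivity (\int[leb]_(x in O) (u x * (phi x - phi (x - v)))%:E)%E.
  rewrite [RHS]integral_mkcond; apply: eq_integral => x _; rewrite patchE indicE.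
  have [xK|xK] := boolP (x \in K).
    by rewrite mulr1 mem_set//; apply: KO; exact: set_mem.
  rewrite mulr0 mul0r; case: ifP => // _.
  have Kx : ~ K x by move=> /mem_set; rewrite (negbTE xK).
  have p0 : phi (x - 0 *: v) = 0 by apply: phi_out => //; lra.
  have p1 : phi (x - 1 *: v) = 0 by apply: phi_out => //; lra.
  by rewrite scale0r subr0 in p0; rewrite scale1r in p1; rewrite p0 p1 subrr mulr0.
rewrite W [in LHS]integral_mkcond; congr (- _)%E; apply: eq_integral => x _.
rewrite patchE indicE -PhiE.
have [xK|xK] := boolP (x \in K).
  by rewrite mulr1 mem_set//; apply: KO; exact: set_mem.
have Kx : ~ K x by move=> /mem_set; rewrite (negbTE xK).
by rewrite mulr0 mul0e Phi0// mulr0 if_same.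
Qed.

Hypotheses (ui : leb.-integrable setT (fun x => (u x * \1_K x)%:E))
  (fi : leb.-integrable setT (fun x => (f x * \1_K x)%:E)).

Let uK x := u x * \1_K x.
Let fK x := f x * \1_K x.

(** Transposing the shift by v and the average along v onto [phi] leaves exactly the two sides of
    the weak formulation against Phi, which cancel. *)
Lemma difference_quotient_defect_bump :
  (\int[leb]_x (((uK (x + v) - uK x)%:E - s%:E * \int[lam]_t strip fK (x, t)) *
     (phi x)%:E) = 0)%E.
Proof.
have cphi : continuous phi.
  by apply: continuous_tensor => j; apply: smooth1_continuous; exact: smooth1_bump.
have mphi : measurable_fun setT phi by exact: continuous_measurable_rV.
have phi01 x : 0 <= phi x <= 1 by exact: tensor_bumps01.
have phi1 x : `|phi x| <= 1 by have /andP[? ?] := phi01 x; rewrite ger0_norm.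
have [fPi fP] := strip_swap fi mphi phi01.
have J : leb.-integrable setT (fun x => (\int[lam]_t strip fK (x, t))%E).
  exact: integrable_fubini_F (integrable_strip fi).
have mJ := measurable_int _ J.
have uvi : leb.-integrable setT (fun x => (uK (x + v))%:E).
  exact: (integrable_translate v ui).
have mshift : measurable_fun setT (fun x : 'rV[R]_n => phi (x - v)).
  by apply: measurableT_comp => //; exact: measurable_rV_shift.
have I1 : leb.-integrable setT (fun x => (uK (x + v) * phi x)%:E).
  exact: integrable_mul_le1.
have I2 : leb.-integrable setT (fun x => (uK x * phi x)%:E) by exact: integrable_mul_le1.
have I3 : leb.-integrable setT (fun x => (uK x * phi (x - v))%:E) by exact: integrable_mul_le1.
have I4 : leb.-integrable setT (fun x => ((\int[lam]_t strip fK (x, t)) * (phi x)%:E))%E.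
  apply: le_integrable J => //.
    apply: emeasurable_funM; last exact: measurable_EFin.
    exact: mJ.
  by move=> x _; rewrite abseM -[leRHS]mule1 lee_wpmul2l// abse_EFin lee_fin.
have E1 : (\int[leb]_x (uK (x + v) * phi x)%:E = \int[leb]_x (uK x * phi (x - v))%:E)%E.
  rewrite -(integral_translate v I3); apply: eq_integral => x _.
  by rewrite addrK.
transitivity (\int[leb]_x (((uK (x + v) * phi x)%:E - (uK x * phi x)%:E) -
   s%:E * ((\int[lam]_t strip fK (x, t)) * (phi x)%:E)))%E.
  apply: eq_integral => x _; rewrite muleBl// -muleA; last first.
  by rewrite -EFinM mulrBl EFinB.
rewrite integralB; [|by []|exact: integrableB|exact: integrableZl].
rewrite integralB; [|by []|exact: I1|exact: I2].
rewrite E1 integralZl; [|by []|exact: I4].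
rewrite fP.
have -> : (s%:E * \int[leb]_y ((fK y)%:E * \int[lam]_(t in unit01) (phi (y - t *: v))%:E) =
    - \int[leb]_x (uK x * (phi x - phi (x - v)))%:E)%E.
  rewrite weak_swept_bump oppeK -integralZl; [|by []|exact: fPi].
  by apply: eq_integral => x _; rewrite muleCA.
rewrite oppeK -integralB; [|by []|exact: I3|exact: I2].
have I5 : leb.-integrable setT (fun x => (uK x * (phi x - phi (x - v)))%:E).
  by under eq_fun do rewrite mulrBr EFinB; exact: integrableB.
rewrite -integralD; [|by []|exact: integrableB|exact: I5].
apply: integral0_eq => x _.
by rewrite -EFinB -EFinD mulrBr; congr (_%:E); ring.
Qed.

End bump_primitive.

Variables (O : set 'rV[R]_n) (a b : 'rV[R]_n) (u f : 'rV[R]_n -> R).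
Hypothesis wf : forall psi, test_function O psi ->
  (\int[leb]_(x in O) (u x * partial i psi x)%:E =
   - \int[leb]_(x in O) (f x * psi x)%:E)%E.
Let K := swept_cbox a b v.
Let uK x := u x * \1_K x.
Let fK x := f x * \1_K x.
Hypotheses (KO : K `<=` O)
  (ui : leb.-integrable setT (fun x => (uK x)%:E))
  (fi : leb.-integrable setT (fun x => (fK x)%:E)).

Let defect x := ((uK (x + v) - uK x)%:E - s%:E * \int[lam]_t strip fK (x, t))%E.

Let integrable_defect : leb.-integrable setT defect.
Proof.
have J : leb.-integrable setT (fun x => (\int[lam]_t strip fK (x, t))%E).
  exact: integrable_fubini_F (integrable_strip fi).
have uvi : leb.-integrable setT (fun x => (uK (x + v))%:E).
  exact: (integrable_translate v ui).
have I1 : leb.-integrable setT (fun x => (uK (x + v) - uK x)%:E).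
  by under eq_fun do rewrite EFinB; exact: integrableB.
by apply: integrableB => //; exact: integrableZl.
Qed.

(** The bumps are at most 1 and converge to the indicator of the box, so dominated convergence
    replaces them by it. *)
Let integral_defect_obox (c e : 'rV[R]_n) : (forall j, a ord0 j <= c ord0 j) ->
  (forall j, e ord0 j <= b ord0 j) -> (\int[leb]_(x in obox c e) defect x = 0)%E.
Proof.
move=> ac eb.
have mb k : measurable_fun setT (tensor (bumps k c e)).
  by apply: measurable_tensor => j; apply: smooth1_continuous; exact: smooth1_bump.
have mD := measurable_int _ integrable_defect.
pose g k x := (defect x * (tensor (bumps k c e) x)%:E)%E.
pose l x := (defect x * (\1_(obox c e) x)%:E)%E.
have mg k : measurable_fun setT (g k) by apply: emeasurable_funM => //; exact: measurable_EFin.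
have ml : measurable_fun setT l.
  apply: emeasurable_funM => //; apply: measurable_EFin; apply: measurable_indic.
  exact: measurable_obox.
have gl : {ae leb, forall x, setT x -> g k x @[k --> \oo] --> l x}.
  apply: filterS (integrable_ae measurableT integrable_defect) => x /(_ I) fx _.
  by apply: cvgeZl => //; apply: cvg_EFin; [exact: nearW|exact: cvg_tensor_bumps].
have g1 : {ae leb, forall x k, setT x -> (`|g k x| <= `|defect x|)%E}.
  apply: aeW => x k _; rewrite abseM -[leRHS]mule1 lee_wpmul2l// abse_EFin lee_fin.
  by have /andP[? ?] := tensor_bumps01 k c e x; rewrite ger0_norm.
have [_ _] := dominated_convergence measurableT mg ml gl (integrable_abse integrable_defect) g1.
rewrite (_ : (\int[leb]_x l x = \int[leb]_(x in obox c e) defect x)%E); last first.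
  rewrite [RHS]integral_mkcond; apply: eq_integral => x _.
  by rewrite patchE /l indicE; case: ifP => _; rewrite ?mule1 ?mule0.
rewrite [X in X @ _ --> _](_ : _ = cst 0%E); last first.
  by apply/funext => k; exact: (difference_quotient_defect_bump k wf KO ac eb ui fi).
by move=> /cvg_lim <-//; rewrite lim_cst.
Qed.

Let defect_ae0 : {ae leb, forall x, obox a b x -> defect x = 0%E}.
Proof.
have iD : leb.-integrable setT (defect \_ (obox a b)).
  apply/(integrable_mkcond defect (measurable_obox a b)).
  by apply: integrableS integrable_defect => //; exact: measurable_obox.
(* An arbitrary box meets [obox a b] in a box contained in it, to which the bump argument
   applies. *)
have H c e : (\int[leb]_(x in obox c e) (defect \_ (obox a b)) x = 0)%E.
  rewrite -integral_mkcondr.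
  have -> : obox c e `&` obox a b =
      obox (\row_j Num.max (a ord0 j) (c ord0 j)) (\row_j Num.min (b ord0 j) (e ord0 j)).
    apply/seteqP; split => x.
      by move=> [H1 H2] j; rewrite !mxE gt_max lt_min; move: (H1 j) (H2 j) => /andP[-> ->] /andP[-> ->].
    move=> H; split => j; have := H j; rewrite !mxE gt_max lt_min.
      by move=> /andP[/andP[_ ->] /andP[_ ->]].
    by move=> /andP[/andP[-> _] /andP[-> _]].
  apply: integral_defect_obox => j; rewrite !mxE; first by rewrite le_max lexx.
  by rewrite ge_min lexx.
have H0 : (\int[leb]_x (defect \_ (obox a b)) x = 0)%E.
  by rewrite -integral_mkcond; exact: integral_defect_obox.
apply: filterS (ae_eq0_obox iD H0 H) => x /(_ I) + abx.
by rewrite patchE mem_set.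
Qed.

(** For x in the box the whole segment lies in [K], where the cut-off functions are [u] and [f]. For
    almost every x the line integral is finite, so a vanishing defect is an equality of real
    numbers. *)
Lemma ae_weak_derivative_bound : {ae leb, forall x, obox a b x ->
  (`|u (x + v) - u x|%:E <= `|s|%:E * \int[lam]_(t in unit01) `|f (x + t *: v)|%:E)%E}.
Proof.
apply: filterS2 defect_ae0 (ae_integrable1 (integrable_strip fi)) => x Dx si abx.
have xK t : 0 <= t <= 1 -> K (x + t *: v).
  move=> t01; exists (x, t) => //; split; last by rewrite /= in_itv.
  by move=> j; have /andP[/ltW -> /ltW ->] := abx j.
have uE t : 0 <= t <= 1 -> uK (x + t *: v) = u (x + t *: v).
  by move=> /xK Kt; rewrite /uK indicE mem_set// mulr1.
have -> : u (x + v) = uK (x + v) by rewrite -[v]scale1r uE// ler01 lexx.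
have -> : u x = uK x by rewrite -[x]addr0 -(scale0r v) uE// ler01 lexx.
have Jfin := integrable_fin_num measurableT si.
have -> : (`|uK (x + v) - uK x|%:E = `|s%:E * \int[lam]_t strip fK (x, t)|)%E.
  rewrite -abse_EFin; congr (`| _ |)%E.
  have := Dx abx; rewrite /defect; move: Jfin.
  case: (\int[lam]_t strip fK (x, t))%E => //= r _.
  by rewrite -EFinM -EFinB => -[/eqP]; rewrite subr_eq0 => /eqP ->.
rewrite abseM abse_EFin lee_wpmul2l//.
apply: (le_trans (le_abse_integral _ _ _)) => //; first exact: measurable_int si.
rewrite [leRHS]integral_mkcond le_eqVlt; apply/orP; left; apply/eqP.
apply: eq_integral => t _; rewrite patchE /strip /= indicE.
case: ifPn => [t01|_]; last by rewrite mulr0 normr0.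
rewrite mulr1 /fK indicE mem_set ?mulr1//; apply: xK.
by move: t01; rewrite inE /= in_itv.
Qed.

End weak_derivative_on_lines.

Section weak_derivative_on_segments.
Variables (R : realType) (n : nat).
Local Notation leb := (lebesgue_rV R n).
Local Notation lam := (@lebesgue_measure R).
Local Notation unit01 := (`[0%R, 1%R]%classic : set (measurableTypeR R)).
Implicit Types (O : set 'rV[R]_n) (x v : 'rV[R]_n) (u f : 'rV[R]_n -> R).

Lemma locally_integrable_indic O u (K : set 'rV[R]_n) : locally_integrable_rV O u ->
  compact K -> K `<=` O -> leb.-integrable setT (fun x => (u x * \1_K x)%:E).
Proof.
move=> [mu oO ui] cK KO; have mK := measurable_compact_rV cK.
have -> : (fun x => (u x * \1_K x)%:E) = (EFin \o u) \_ K.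
  by apply/funext => x; rewrite patchE indicE; case: ifP => _; rewrite ?mulr1 ?mulr0.
apply/(integrable_mkcond _ mK); apply/integrableP; split; last exact: ui.
apply/measurable_EFinP; apply: measurable_funS mu => //.
exact: open_measurable_rV.
Qed.

(** A tube lemma: compactness of [0, 1] makes the radius uniform along the segment. *)
Lemma segment_thickening O x v : open O -> (forall t, 0 <= t <= 1 -> O (x + t *: v)) ->
  exists2 e : R, 0 < e & forall t, 0 <= t <= 1 -> ball (x + t *: v) e `<=` O.
Proof.
move=> oO xO.
have /compact_near_coveringP cov := @segment_compact R 0 1.
have near_e : \forall e \near (0 : R)^'+,
    `[0, 1]%classic `<=` (fun t => ball (x + t *: v) e `<=` O).
  apply: (cov R (0^'+) (fun e t => ball (x + t *: v) e `<=` O)) => t0 /=.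
  rewrite in_itv/= => t01.
  have /nbhs_ballP[r /= r0 rO] : nbhs (x + t0 *: v) O.
    by apply: open_nbhs_nbhs; split => //; exact: xO.
  have ct : x + t *: v @[t --> t0] --> x + t0 *: v.
    by apply: cvgD; [exact: cvg_cst|apply: cvgZr_tmp; exact: cvg_id].
  have r20 : 0 < r / 2 by rewrite divr_gt0.
  have bt : \forall t \near t0, ball (x + t0 *: v) (r / 2) (x + t *: v).
    by apply: ct; exact: nbhsx_ballx.
  near=> t e; apply: subset_trans rO => y ye.
  have t_near : ball (x + t0 *: v) (r / 2) (x + t *: v) by near: t.
  have e_small : e <= r / 2 by near: e; exact: nbhs_right_le.
  rewrite [r]splitr; apply: ball_triangle t_near _.
  exact: le_ball e_small _ ye.
near (0 : R)^'+ => e.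
exists e; first by near: e; exact: nbhs_right_gt.
have eO : `[0, 1]%classic `<=` (fun t => ball (x + t *: v) e `<=` O) by near: e.
by move=> t t01; apply: eO; rewrite /= in_itv.
Unshelve. all: by end_near. Qed.

(** The exceptional set depends on the box, but countably many rational boxes suffice: around a
    segment inside O, a small enough rational box containing its origin sweeps out a subset of the
    tube given by [segment_thickening]. *)
Lemma ae_weak_derivative_segment O u f (i : 'I_n) (s : R) (v := s *: delta_mx 0 i) :
  locally_integrable_rV O u -> locally_integrable_rV O f ->
  (forall psi, test_function O psi ->
    (\int[leb]_(x in O) (u x * partial i psi x)%:E =
     - \int[leb]_(x in O) (f x * psi x)%:E)%E) ->
  {ae leb, forall x, (forall t, 0 <= t <= 1 -> O (x + t *: v)) ->
    (`|u (x + v) - u x|%:E <= `|s|%:E * \int[lam]_(t in unit01) `|f (x + t *: v)|%:E)%E}.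
Proof.
move=> lu lf wf; have oO : open O by case: lu.
pose lo (c : 'rV[rat]_n * nat) : 'rV[R]_n := map_mx ratr c.1 - const_mx c.2.+1%:R^-1.
pose hi (c : 'rV[rat]_n * nat) : 'rV[R]_n := map_mx ratr c.1 + const_mx c.2.+1%:R^-1.
pose Q x := (`|u (x + v) - u x|%:E <=
  `|s|%:E * \int[lam]_(t in unit01) `|f (x + t *: v)|%:E)%E.
have H c : {ae leb, forall x, swept_cbox (lo c) (hi c) v `<=` O -> obox (lo c) (hi c) x -> Q x}.
  have [KO|nKO] := pselect (swept_cbox (lo c) (hi c) v `<=` O); last exact: aeW.
  have cK := @compact_swept_cbox R n (lo c) (hi c) v.
  apply: filterS (ae_weak_derivative_bound wf KO
    (locally_integrable_indic lu cK KO) (locally_integrable_indic lf cK KO)) => x + _.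
  exact.
have : {ae leb, forall x (k : nat), if unpickle k is Some c then
    swept_cbox (lo c) (hi c) v `<=` O -> obox (lo c) (hi c) x -> Q x else True}.
  by apply: ae_foralln => k; case: unpickle => [c|]; [exact: H|exact: aeW].
apply: filterS => x xQ xO.
have [e e0 eO] := segment_thickening oO xO.
have [k ke] : exists k, 2 * k.+1%:R^-1 < e.
  have [k] := ltr_add_invr (@divr_gt0 R e 2 e0 ltac:(by [])).
  by rewrite add0r => ke; exists k; move: ke; rewrite ltr_pdivlMr// mulrC.
have k0 : 0 < k.+1%:R^-1 :> R by [].
have [q qx] := rat_dense_rV x k0.
have := xQ (pickle (q, k)); rewrite pickleK; apply.
  move=> _ [[p t] [/= pc + <-]]; rewrite in_itv/= => t01.
  apply: (eO t t01); split => // l j; rewrite (_ : l = ord0); last exact: ord1.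
  rewrite /ball/= !mxE; have := pc j; rewrite !mxE /= => /andP[p1 p2].
  have [_ /(_ ord0 j)] := qx; rewrite /ball/= !mxE ltr_distlC => /andP[q1 q2].
  rewrite opprD addrACA subrr addr0 ltr_norml; move: ke p1 p2 q1 q2.
  move: (k.+1%:R^-1) (ratr (q ord0 j)) (x ord0 j) (p ord0 j) => k' q' x' p' *.
  by apply/andP; split; lra.
rewrite /lo /hi -ball_obox//; exact: ball_sym.
Qed.

End weak_derivative_on_segments.

(** * Segments that meet an Ahlfors regular set *)

Section hausdorff_null.
Variables (R : realType) (n : nat) (d : R) (i : 'I_n) (s : R).
Hypotheses (d_gt0 : 0 < d) (d_lt : d < n%:R - 1).
Local Notation leb := (lebesgue_rV R n).
Let v : 'rV[R]_n := s *: delta_mx 0 i.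
Implicit Types (A U : set 'rV[R]_n).

Let swept U := [set y | exists2 t, 0 <= t <= 1 & U (y + t *: v)].

Let n_gt1 : (1 < n)%N.
Proof. by rewrite -(ltr_nat R); move: d_gt0 d_lt; lra. Qed.

Let C : R := 2 ^+ n.-1 * (2 + 2 * `|s|).

(** A set of diameter D <= e <= 1 swept along s e_i fits in a box with n - 1 sides 2 D and one side
    2 D + 2 |s|, which is at most 2 + 2 |s|; hence [C]. The remaining D^(n-1) is at most e^(n-1-d)
    D^d, and D^d is the gauge. *)
Let swept_cover U e : 0 < e -> e <= 1 -> (ediam U <= e%:E)%E ->
  exists B, [/\ measurable B, swept U `<=` B &
    (leb B <= (C * e `^ (n%:R - 1 - d))%:E * hausdorff_gauge d U)%E].
Proof.
move=> e0 e1 Ue; have [->|/set0P[p Up]] := eqVneq U set0.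
  exists set0; split => //; first by move=> y [].
  by rewrite measure0 hausdorff_gauge0 mule0.
have D0 : (0 <= ediam U)%E.
  apply: (@le_trans _ _ (enorm (p - p))%:E); first by rewrite lee_fin enorm_ge0.
  by apply: ereal_sup_ubound; exists p => //; exists p.
have Dfin : ediam U \is a fin_num by rewrite ge0_fin_numE// (le_lt_trans Ue) ?ltry.
pose D := fine (ediam U).
have DE : ediam U = D%:E by rewrite fineK.
have {}D0 : 0 <= D by rewrite -lee_fin -DE.
have De : D <= e by rewrite -lee_fin -DE.
pose w : 'rV[R]_n := const_mx D + `|s| *: delta_mx 0 i.
exists (cbox (p - w) (p + w)); split; first exact: measurable_cbox.
  move=> y [t /andP[t0 t1] Uy] j.
  have : `|(y + t *: v - p) ord0 j| <= D.
    apply: (@le_trans _ _ `|y + t *: v - p|).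
      by rewrite [leRHS]/Num.norm/= mx_normrE; apply: (le_bigmax _ _ (ord0, j)).
    apply: (le_trans (ler_norm_enorm _)); rewrite -lee_fin -DE.
    by apply: ereal_sup_ubound; exists (y + t *: v) => //; exists p.
  rewrite /v /w !mxE eqxx/=; case: (j == i) => /=; rewrite ?mulr1 ?mulr0 ?addr0.
    have ts : `|t * s| <= `|s| by rewrite normrM (ger0_norm t0) ler_piMl.
    rewrite ler_distlC; move: ts; rewrite ler_norml => /andP[? ?] /andP[? ?].
    by apply/andP; split; lra.
  by rewrite ler_distl.
have w0 j : 0 <= w ord0 j.
  by rewrite /w !mxE eqxx; case: (j == i); rewrite ?mulr1 ?mulr0 ?addr0// addr_ge0.
rewrite lebesgue_cbox; last by move=> j; rewrite !mxE; have := w0 j; rewrite !mxE; lra.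
rewrite /hausdorff_gauge ifF; last by apply/negbTE/set0P; exists p.
rewrite DE poweR_EFin -EFinM lee_fin (bigD1 i)//=.
have -> : \prod_(j < n | j != i) ((p + w) ord0 j - (p - w) ord0 j) = (2 * D) ^+ n.-1.
  rewrite (eq_bigr (fun=> 2 * D)); last first.
    by move=> j /negbTE ji; rewrite /w !mxE eqxx ji mulr0 addr0; ring.
  rewrite prodr_const; congr (_ ^+ _).
  have := cardC1 i; rewrite card_ord => <-.
  by apply: eq_card => j; rewrite !inE.
have -> : (p + w) ord0 i - (p - w) ord0 i = 2 * D + 2 * `|s|.
  by rewrite /w !mxE !eqxx/= mulr1; ring.
rewrite exprMn mulrCA /C -!mulrA ler_wpM2l//.
apply: ler_pM => //.
- by rewrite addr_ge0// mulr_ge0.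
- by rewrite exprn_ge0.
- by rewrite lerD2r ler_piMr// (le_trans De).
(* Splitting D^(n-1) into real powers asks for D > 0. For D = 0 the left side vanishes because n - 1
   > 0. *)
have [->|Dn0] := eqVneq D 0.
  rewrite expr0n; case: n.-1 (ltn_predK n_gt1) n_gt1 => [<-//|m _ _] /=.
  by rewrite mulr_ge0// powR_ge0.
have {}D0 : 0 < D by rewrite lt_neqAle eq_sym Dn0.
rewrite -powR_mulrn; last exact: ltW.
have -> : n.-1%:R = (n%:R - 1 - d) + d :> R.
  by rewrite -subn1 natrB ?subrK// ltnW.
rewrite powRD; last by rewrite (gt_eqF D0) implybT.
rewrite ler_wpM2r ?powR_ge0// ge0_ler_powR//.
- by rewrite subr_ge0 ltW.
- by rewrite nnegrE ltW.
- by rewrite nnegrE ltW.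
Qed.

Lemma negligible_small_cover (N : set 'rV[R]_n) :
  (forall e, 0 < e -> exists B, [/\ measurable B, N `<=` B & (leb B <= e%:E)%E]) ->
  leb.-negligible N.
Proof.
move=> H.
have /choice[B BP] : forall k : nat, exists B, [/\ measurable B, N `<=` B & (leb B <= (k.+1%:R^-1)%:E)%E].
  by move=> k; apply: H.
have mB : measurable (\bigcap_k B k) by apply: bigcapT_measurable => k; have [] := BP k.
exists (\bigcap_k B k); split => //; last by move=> x Nx k _; have [_ NB _] := BP k; exact: NB.
apply/eqP; rewrite eq_le measure_ge0 andbT; apply/lee_addgt0Pr => e e0.
have [k ke] := ltr_add_invr e0; rewrite !add0r in ke *.
apply: (@le_trans _ _ (k.+1%:R^-1)%:E); last by rewrite lee_fin ltW.
have [mBk _ kle] := BP k; apply: le_trans kle; apply: le_measure; rewrite ?inE//.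
exact: bigcap_inf.
Qed.

(** A cover of [A] by sets of diameter at most e sweeps out a measure at most C e^(n-1-d) times its
    cost. The costs stay bounded by [L] while e tends to 0, and n - 1 - d > 0. *)
Lemma negligible_swept A : (hausdorff_measure d A < +oo)%E -> leb.-negligible (swept A).
Proof.
move=> Aoo; apply: negligible_small_cover => eta eta0.
have Afin : hausdorff_measure d A \is a fin_num.
  by rewrite ge0_fin_numE// outer_measure_ge0.
pose L := fine (hausdorff_measure d A) + 1.
have L0 : 0 < L by rewrite ltr_wpDl// fine_ge0// outer_measure_ge0.
have C0 : 0 <= C by rewrite mulr_ge0 ?exprn_ge0// addr_ge0// mulr_ge0.
have a0 : 0 < n%:R - 1 - d by rewrite subr_gt0.
set a := n%:R - 1 - d in a0.
(* The choice of [e] ensures C L e^a <= eta; the added 1 keeps the denominator positive. *)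
pose q := eta / (C * L + 1).
have q0 : 0 < q by rewrite divr_gt0// ltr_wpDl// mulr_ge0// ltW.
pose e := Num.min 1 (q `^ a^-1).
have e0 : 0 < e by rewrite lt_min ltr01 powR_gt0.
have e1 : e <= 1 by rewrite ge_min lexx.
have ea : e `^ a <= q.
  apply: (@le_trans _ _ ((q `^ a^-1) `^ a)).
    apply: ge0_ler_powR; [exact: ltW|by rewrite nnegrE ltW|by rewrite nnegrE powR_ge0|].
    by rewrite ge_min lexx orbT.
  by rewrite -powRrM mulVf ?gt_eqF// powRr1// ltW.
have pA : (hausdorff_premeasure d e A <= hausdorff_measure d A)%E by exact: hausdorff_premeasure_le.
have pfin : hausdorff_premeasure d e A \is a fin_num.
  by rewrite ge0_fin_numE ?hausdorff_premeasure_ge0// (le_lt_trans pA).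
have [_ [U [Ue AU] <-] Ulim] := lb_ereal_inf_adherent ltr01 pfin.
have UL : (\sum_(k <oo) hausdorff_gauge d (U k) <= L%:E)%E.
  by rewrite (le_trans (ltW Ulim))// /L EFinD fineK// leeD2r.
have /choice[B BP] := fun k => swept_cover e0 e1 (Ue k).
have mB k : measurable (B k) by have [] := BP k.
exists (\bigcup_k B k); split; first exact: bigcupT_measurable.
  move=> y [t t01 /AU[k _ Uk]]; exists k => //.
  by have [_ UB _] := BP k; apply: UB; exists t.
apply: (le_trans (measure_sigma_subadditive _ mB (bigcupT_measurable _ mB) _)) => //.
apply: (@le_trans _ _ (\sum_(k <oo) ((C * e `^ a)%:E * hausdorff_gauge d (U k)))%E).
  by apply: lee_nneseries => // k _; have [] := BP k.
rewrite nneseriesZl; last by move=> k _; exact: hausdorff_gauge_ge0.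
apply: (@le_trans _ _ ((C * e `^ a)%:E * L%:E)%E).
  by rewrite lee_wpmul2l// lee_fin mulr_ge0 ?powR_ge0.
rewrite -EFinM lee_fin mulrAC.
apply: (@le_trans _ _ (C * L * q)); first by rewrite ler_wpM2l// mulr_ge0// ltW.
rewrite /q mulrCA -[leRHS]mulr1 ler_wpM2l ?(ltW eta0)//.
by rewrite ler_pdivrMr ?mul1r ?lerDl// ltr_wpDl// mulr_ge0// ltW.
Qed.

End hausdorff_null.

Section locally_finite_hausdorff.
Variables (R : realType) (n : nat) (d : R) (G : set 'rV[R]_n).
Hypotheses (d_gt0 : 0 < d) (d_lt : d < n%:R - 1) (G_closed : closed G)
  (G_regular : ahlfors_regular d G).
Local Notation leb := (lebesgue_rV R n).

Lemma ahlfors_regular_bigcup : exists F : (set 'rV[R]_n)^nat,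
  G `<=` \bigcup_k F k /\ forall k, (hausdorff_measure d (F k) < +oo)%E.
Proof.
have [C0 _ reg] := G_regular.
have [->|/set0P[x Gx]] := eqVneq G set0.
  by exists (fun=> set0); split => // k; rewrite outer_measure0 ltry.
exists (fun k => G `&` eball x k.+1%:R); split.
  move=> y Gy; exists (Num.bound (enorm (x - y))) => //; split => //.
  rewrite /eball/=; apply: (lt_le_trans (archi_boundP (enorm_ge0 _))).
  by rewrite ler_nat.
by move=> k; have [_ H] := reg x k.+1%:R Gx ltac:(by []); rewrite (le_lt_trans H)// ltry.
Qed.

Lemma ae_segment_avoids (i : 'I_n) (s : R) :
  {ae leb, forall x t, 0 <= t <= 1 -> ~ G (x + t *: (s *: delta_mx 0 i))}.
Proof.
have [F [GF Foo]] := ahlfors_regular_bigcup.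
have H : leb.-negligible (\bigcup_k [set y | exists2 t, 0 <= t <= 1 & F k (y + t *: (s *: delta_mx 0 i))]).
  by apply: negligible_bigcup => k; exact: (@negligible_swept R n d i s d_gt0 d_lt _ (Foo k)).
apply: negligibleS H => x /= /existsNP[t /not_implyP[t01 /contrapT /GF[k _ Fk]]].
by exists k => //; exists t.
Qed.

Lemma measurable_closed_rV : measurable G.
Proof.
by rewrite -(setCK G); apply: measurableC; apply: open_measurable_rV; exact: closed_openC.
Qed.

(** A degenerate segment, with s = 0, is a point. *)
Lemma lebesgue_ahlfors0 : (0 < n)%N -> leb G = 0%E.
Proof.
move=> n0; apply/(negligibleP _ measurable_closed_rV).
apply: negligibleS (ae_segment_avoids (Ordinal n0) 0) => x Gx /(_ 0).
by rewrite scale0r addr0 lexx ler01 => /(_ isT); exact.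
Qed.

End locally_finite_hausdorff.

(** * Integrals of functions that need not be measurable on a null set *)

Section integral_null_set.
Context d (T : measurableType d) (R : realType) (mu : {measure set T -> \bar R}).
Variable N : set T.
Hypotheses (mN : measurable N) (N0 : mu N = 0%E).
Implicit Types (f g : T -> \bar R) (D : set T).
Local Open Scope ereal_scope.

Import HBNNSimple.

(** Even without measurability the integral is a supremum over the simple functions below [f].
    Multiplying these by the indicator of the complement of [N] preserves their integrals and puts
    them below [g]. *)
Let ge0_le_integral_off_null f g : (forall x, 0 <= f x) -> (forall x, 0 <= g x) ->
  (forall x, ~ N x -> f x = g x) -> \int[mu]_x f x <= \int[mu]_x g x.
Proof.
move=> f0 g0 fg; rewrite !ge0_integralTE//.
apply: ge_ereal_sup => _ [h /= hf <-].
have mCN : measurable (~` N) by exact: measurableC.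
pose k := mul_nnsfun h (indic_nnsfun R mCN).
have -> : sintegral mu h = sintegral mu k.
  rewrite -!integralT_nnsfun; apply: ae_eq_integral => //.
  - exact/measurable_EFinP.
  - exact/measurable_EFinP.
  exists N; split => // x /= /not_implyP[_]; apply: contra_notP => Nx.
  by rewrite /mindic indicE mem_set// mulr1.
apply: ereal_sup_ubound; exists k => // x /=.
rewrite /mindic indicE; have [xN|xN] := boolP (x \in ~` N).
  by rewrite mulr1 -fg//; exact: set_mem.
by rewrite mulr0.
Qed.

Let ge0_eq_integral_off_null f g : (forall x, 0 <= f x) -> (forall x, 0 <= g x) ->
  (forall x, ~ N x -> f x = g x) -> \int[mu]_x f x = \int[mu]_x g x.
Proof.
move=> f0 g0 fg; apply/eqP; rewrite eq_le; apply/andP; split.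
  exact: ge0_le_integral_off_null.
by apply: ge0_le_integral_off_null => // x /fg.
Qed.

(* f and g may be non-measurable on N, as elements of W are on G. *)
Lemma eq_integral_off_null D f g : (forall x, D x -> ~ N x -> f x = g x) ->
  \int[mu]_(x in D) f x = \int[mu]_(x in D) g x.
Proof.
move=> fg; rewrite integral_mkcond [RHS]integral_mkcond.
have {}fg x : ~ N x -> (f \_ D) x = (g \_ D) x.
  by move=> Nx; rewrite !patchE; case: ifPn => // /set_mem Dx; exact: fg.
rewrite integralE [RHS]integralE; congr (_ - _); apply: ge0_eq_integral_off_null => //.
  by move=> x /fg; rewrite !funeposE => ->.
by move=> x /fg; rewrite !funenegE => ->.
Qed.

End integral_null_set.

(** * A Poincare inequality on cubes *)

Section poincare.
Variables (R : realType) (n : nat) (u f : 'rV[R]_n -> R).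
Local Notation leb := (lebesgue_rV R n).
Local Notation lam := (@lebesgue_measure R).
Local Notation unit01 := (`[0%R, 1%R]%classic : set (measurableTypeR R)).
Hypotheses (mu : measurable_fun setT u) (mf : measurable_fun setT f)
  (f_ge0 : forall x, 0 <= f x).
Hypothesis line_bound : forall (i : 'I_n) (s : R), {ae leb, forall x,
  (`|u (x + s *: delta_mx 0 i) - u x|%:E <=
   `|s|%:E * \int[lam]_(t in unit01) (f (x + t *: (s *: delta_mx 0 i)))%:E)%E}.
Variables (x0 : 'rV[R]_n) (r : R).
Hypothesis r_gt0 : 0 < r.
Let Q : set 'rV[R]_n := ball x0 r.

Let mQ : measurable Q.
Proof. by apply: open_measurable_rV; exact: ball_open. Qed.

Let mQ1 : measurable_fun setT (\1_Q : 'rV[R]_n -> R).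
Proof. exact: measurable_indic. Qed.

Let m01 : measurable_fun setT (\1_unit01 : measurableTypeR R -> R).
Proof. exact: measurable_indic. Qed.

Let I := (\int[leb]_(y in Q) (f y)%:E)%E.

Let q z := f z * \1_Q z.

Let mq : measurable_fun setT q.
Proof. by apply: measurable_funM => //; exact: measurable_indic. Qed.

Let q_ge0 z : 0 <= q z. Proof. by rewrite mulr_ge0. Qed.

Let qE : (\int[leb]_y (q y)%:E = I)%E.
Proof.
rewrite /I [RHS]integral_mkcond; apply: eq_integral => y _.
by rewrite patchE /q indicE; case: ifP; rewrite ?mulr1 ?mulr0.
Qed.

(** By Tonelli each t in [0, 1] contributes the integral of a translate of [q], which is I whatever
    the displacement. *)
Let integral_strip (p v : 'rV[R]_n) :
  (\int[leb]_y \int[lam]_(t in unit01) (q (y + p + t *: v))%:E = I)%E.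
Proof.
pose g (z : 'rV[R]_n * measurableTypeR R) := ((\1_unit01 z.2) * q (z.1 + p + z.2 *: v))%:E.
have mg : measurable_fun setT g.
  apply: measurable_EFin; apply: measurable_funM.
    exact: (measurableT_comp m01).
  apply: measurableT_comp => //.
  under eq_fun do rewrite addrAC.
  exact: (measurableT_comp (measurable_rV_shift p) (measurable_rV_line v)).
have g0 z : (0 <= g z)%E by rewrite lee_fin mulr_ge0.
transitivity (\int[leb]_y \int[lam]_t g (y, t))%E.
  apply: eq_integral => y _; rewrite integral_mkcond; apply: eq_integral => t _.
  by rewrite patchE /g indicE; case: ifP => _; rewrite ?mul1r ?mul0r.
rewrite (fubini_tonelli g)//; under eq_integral => t _.
  rewrite /g /=; under eq_integral do rewrite EFinM -addrA.
  rewrite ge0_integralZl//=; last first.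
  - by move=> y _; rewrite lee_fin.
  - by apply: measurable_EFin; apply: measurableT_comp => //; exact: measurable_rV_shift.
  rewrite (ge0_integral_translate (p + t *: v) (f := fun y => (q y)%:E)) ?qE//; last first.
    exact: measurable_EFin.
  over.
by apply: integral_indic01; apply: integral_ge0 => y _; rewrite lee_fin.
Qed.

Let measurable_strip (p v : 'rV[R]_n) :
  measurable_fun setT (fun y : 'rV[R]_n => \int[lam]_(t in unit01) (q (y + p + t *: v))%:E)%E.
Proof.
pose g (z : 'rV[R]_n * measurableTypeR R) := ((\1_unit01 z.2) * q (z.1 + p + z.2 *: v))%:E.
have mg : measurable_fun setT g.
  apply: measurable_EFin; apply: measurable_funM.
    exact: (measurableT_comp m01).
  apply: measurableT_comp => //.
  under eq_fun do rewrite addrAC.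
  exact: (measurableT_comp (measurable_rV_shift p) (measurable_rV_line v)).
have g0 z : (0 <= g z)%E by rewrite lee_fin mulr_ge0.
rewrite (_ : (fun y => _) = fubini_F lam g); first exact: measurable_fun_fubini_tonelli_F.
apply/funext => y; rewrite integral_mkcond; apply: eq_integral => t _.
by rewrite patchE /g indicE; case: ifP => _; rewrite ?mul1r ?mul0r.
Qed.

Section shift.
Variable h : 'rV[R]_n.

(** A staircase from 0 to h: increments of u are controlled along the axes only, so h is reached one
    coordinate at a time and the increments are telescoped. *)
Let path (k : nat) : 'rV[R]_n := \row_j (if (j < k)%N then h ord0 j else 0).

Let pathS (k : 'I_n) : path k.+1 = path k + h ord0 k *: delta_mx 0 k.
Proof.
apply/rowP => j; rewrite !mxE eqxx/= ltnS leq_eqVlt -val_eqE.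
by case: eqVneq => [/val_inj ->|_]; rewrite /= ?ltnn ?mulr1 ?add0r ?mulr0 ?addr0.
Qed.

Let path0 : path 0 = 0. Proof. by apply/rowP => j; rewrite !mxE. Qed.

Let pathn : path n = h. Proof. by apply/rowP => j; rewrite !mxE ltn_ord. Qed.

Let inQ y := \1_Q y * \1_Q (y + h) : R.

Let inQ01 y : inQ y = if (y \in Q) && (y + h \in Q) then 1 else 0.
Proof.
by rewrite /inQ !indicE; case: (_ \in Q); case: (_ \in Q); rewrite ?mulr1 ?mulr0.
Qed.

Let minQ : measurable_fun setT inQ.
Proof.
apply: measurable_funM; first exact: measurable_indic.
exact: (measurableT_comp mQ1 (measurable_rV_shift h)).
Qed.

(** With y and y + h, a cube contains the whole box that they span, hence the staircase between
    them. A Euclidean ball may lack the corners, which is why the inequality is proved on sup-norm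
    balls. *)
Let path_in_ball (k : 'I_n) y t : Q y -> Q (y + h) -> 0 <= t <= 1 ->
  Q (y + path k + t *: (h ord0 k *: delta_mx 0 k)).
Proof.
move=> [_ Qy] [_ Qyh] /andP[t0 t1]; split => // l j.
rewrite (_ : l = ord0); last exact: ord1.
have := Qy ord0 j; have := Qyh ord0 j; rewrite /ball/= !mxE eqxx/=.
move: (x0 ord0 j) (y ord0 j) => a b; rewrite -val_eqE.
have [jk|kj|jk] := ltngtP j k.
- by rewrite !mulr0 addr0.
- by rewrite !mulr0 !addr0.
- have -> : k = j by exact/val_inj.
  rewrite /= mulr1 addr0 !ltr_norml => /andP[H1 H2] /andP[H3 H4].
  have [h0|h0] := leP 0 (h ord0 j).
    have th0 : 0 <= t * h ord0 j by rewrite mulr_ge0.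
    have th1 : t * h ord0 j <= h ord0 j by rewrite ler_piMl.
    by apply/andP; split; lra.
  have th0 : t * h ord0 j <= 0 by rewrite mulr_ge0_le0// ltW.
  have th1 : h ord0 j <= t * h ord0 j by rewrite ler_niMl// ltW.
  by apply/andP; split; lra.
Qed.

Let shift_step (k : 'I_n) :
  (\int[leb]_y (inQ y * `|u (y + path k.+1) - u (y + path k)|)%:E <=
   `|h ord0 k|%:E * I)%E.
Proof.
pose v : 'rV[R]_n := h ord0 k *: delta_mx 0 k.
rewrite -(integral_strip (path k) v) -ge0_integralZl//; last first.
  by move=> y _; apply: integral_ge0 => t _; rewrite lee_fin.
apply: ae_ge0_le_integral => //.
- by move=> y _; rewrite lee_fin mulr_ge0// inQ01; case: ifP.
- apply: measurable_EFin; apply: measurable_funM => //.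
  apply: measurableT_comp => //; apply: measurable_funB.
    by apply: measurableT_comp => //; exact: measurable_rV_shift.
  by apply: measurableT_comp => //; exact: measurable_rV_shift.
- move=> y _; rewrite mule_ge0// integral_ge0// => t _; by rewrite lee_fin.
- by apply: measurable_funeM.
have := ae_translate (path k) (line_bound k (h ord0 k)).
apply: filterS => y Hy _; rewrite inQ01; case: ifPn => [/andP[/set_mem yQ /set_mem yhQ]|_]; last first.
  by rewrite mul0r mule_ge0// integral_ge0// => t _; rewrite lee_fin.
rewrite mul1r pathS addrA (le_trans Hy)// lee_wpmul2l// le_eqVlt; apply/orP; left; apply/eqP.
apply: eq_integral => t /set_mem/=; rewrite in_itv/= => t01.
by rewrite /q indicE mem_set ?mulr1//; exact: path_in_ball.
Qed.

Lemma shift_bound :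
  (\int[leb]_y (inQ y * `|u (y + h) - u y|)%:E <= (\sum_(k < n) `|h ord0 k|)%:E * I)%E.
Proof.
have mstep k : measurable_fun setT (fun y => (inQ y * `|u (y + path k.+1) - u (y + path k)|)%:E).
  apply: measurable_EFin; apply: measurable_funM => //.
  apply: measurableT_comp => //; apply: measurable_funB.
    by apply: measurableT_comp => //; exact: measurable_rV_shift.
  by apply: measurableT_comp => //; exact: measurable_rV_shift.
have inQ0 y : 0 <= inQ y by rewrite inQ01; case: ifP.
apply: (@le_trans _ _ (\int[leb]_y (\sum_(k < n)
    (inQ y * `|u (y + path k.+1) - u (y + path k)|)%:E))%E).
  apply: ge0_le_integral => //.
  - by move=> y _; rewrite lee_fin mulr_ge0.
  - apply: measurable_EFin; apply: measurable_funM => //.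
    apply: measurableT_comp => //; apply: measurable_funB => //.
    by apply: measurableT_comp => //; exact: measurable_rV_shift.
  - by apply: emeasurable_sum => k; exact: mstep.
  move=> y _; rewrite sumEFin lee_fin -mulr_sumr ler_wpM2l//.
  apply: le_trans (ler_norm_sum _ _ _).
  rewrite -(big_mkord xpredT (fun k => u (y + path k.+1) - u (y + path k))).
  by rewrite telescope_sumr// pathn path0 addr0.
rewrite ge0_integral_sum//; last by move=> k y _; rewrite lee_fin mulr_ge0.
have I0 : (0 <= I)%E by apply: integral_ge0 => y _; rewrite lee_fin.
rewrite -sumEFin ge0_sume_distrl; last by move=> k _; rewrite lee_fin.
by apply: lee_sum => k _; exact: shift_step.
Qed.

End shift.

(** Put z = y + h. Both points lie in [Q] only if h lies in the cube of radius 2 r, of measure (4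
    r)^n, and then the sum of the |h_k| in [shift_bound] is at most n (2 r). *)
Lemma poincare_ball :
  (\int[leb]_(y in Q) \int[leb]_(z in Q) (`|u z - u y|)%:E <=
   (n%:R * (2 * r) * (4 * r) ^+ n)%:E * I)%E.
Proof.
pose B0 : set 'rV[R]_n := ball 0 (2 * r).
have mB : measurable B0 by apply: open_measurable_rV; exact: ball_open.
have r20 : 0 < 2 * r by rewrite mulr_gt0.
have I0 : (0 <= I)%E by apply: integral_ge0 => y _; rewrite lee_fin.
pose g (p : 'rV[R]_n * 'rV[R]_n) := (\1_Q p.1 * \1_Q (p.1 + p.2) * `|u (p.1 + p.2) - u p.1|)%:E.
have mg : measurable_fun setT g.
  apply: measurable_EFin; apply: measurable_funM.
    apply: measurable_funM; first exact: (measurableT_comp mQ1).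
    exact: (measurableT_comp mQ1 (@measurable_rVD R n)).
  apply: measurableT_comp => //; apply: measurable_funB.
    exact: (measurableT_comp mu (@measurable_rVD R n)).
  exact: (measurableT_comp mu).
have g0 p : (0 <= g p)%E by rewrite lee_fin !mulr_ge0.
have -> : (\int[leb]_(y in Q) \int[leb]_(z in Q) (`|u z - u y|)%:E =
    \int[leb]_y \int[leb]_h g (y, h))%E.
  rewrite integral_mkcond; apply: eq_integral => y _; rewrite patchE.
  have -> : (\int[leb]_h g (y, h) = \int[leb]_z (\1_Q y * \1_Q z * `|u z - u y|)%:E)%E.
    rewrite -(ge0_integral_translate y (f := fun z => (\1_Q y * \1_Q z * `|u z - u y|)%:E)).
    - by apply: eq_integral => h _; rewrite /g /= addrC.
    - apply: measurable_EFin; apply: measurable_funM.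
        by apply: measurable_funM => //; exact: measurable_indic.
      by apply: measurableT_comp => //; exact: measurable_funB.
    - by move=> z; rewrite lee_fin !mulr_ge0.
  case: ifPn => yQ.
    rewrite integral_mkcond; apply: eq_integral => z _; rewrite patchE !indicE yQ mul1r.
    by case: ifP => _; rewrite ?mul1r ?mul0r.
  rewrite integral0_eq// => z _; by rewrite !indicE (negbTE yQ) !mul0r.
rewrite (fubini_tonelli g)//.
apply: (@le_trans _ _ (\int[leb]_h ((\1_B0 h)%:E * ((n%:R * (2 * r))%:E * I)))%E).
  apply: ge0_le_integral => //.
  - by move=> h _; exact: integral_ge0.
  - exact: measurable_fun_fubini_tonelli_G.
  - apply: emeasurable_funM => //; apply: measurable_EFin; exact: measurable_indic.
  move=> h _; rewrite indicE.
  have [/set_mem [_ hr]|hB] := boolP (h \in B0); last first.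
    rewrite mul0e integral0_eq// => y _; rewrite /g /= !indicE.
    have [/set_mem [_ yQ]|_] := boolP (y \in Q); last by rewrite !mul0r.
    have [/set_mem [_ yhQ]|_] := boolP (y + h \in Q); last by rewrite mulr0 mul0r.
    move/negP : hB; case; apply/mem_set; split => // l j.
    rewrite (_ : l = ord0); last exact: ord1.
    have := yQ ord0 j; have := yhQ ord0 j; rewrite /ball/= !mxE sub0r.
    rewrite !ltr_norml => /andP[? ?] /andP[? ?]; apply/andP; split; lra.
  rewrite mul1e; apply: (le_trans (shift_bound h)).
  rewrite lee_wpmul2r// lee_fin.
  apply: (@le_trans _ _ (\sum_(k < n) (2 * r))); last by rewrite sumr_const card_ord -[leLHS]mulr_natl.
  apply: ler_sum => k _; have := hr ord0 k; rewrite /ball/= !mxE sub0r normrN.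
  exact: ltW.
rewrite ge0_integralZr//=; last 2 first.
- exact: measurable_EFin.
- by rewrite mule_ge0// lee_fin mulr_ge0// ltW.
rewrite integral_indic// setIT [X in (X * _ <= _)%E]lebesgue_ball//.
rewrite muleA -EFinM (_ : 2 * (2 * r) = 4 * r); last by ring.
by rewrite [_ ^+ n * _]mulrC.
Qed.

End poincare.

(** * The increment bound for elements of W extended by zero *)

Section sobolev_line_bound.
Variables (R : realType) (n : nat) (d : R) (G : set 'rV[R]_n).
Hypotheses (d_gt0 : 0 < d) (d_lt : d < n%:R - 1) (G_closed : closed G)
  (G_regular : ahlfors_regular d G).
Local Notation leb := (lebesgue_rV R n).
Local Notation lam := (@lebesgue_measure R).
Local Notation unit01 := (`[0%R, 1%R]%classic : set (measurableTypeR R)).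
Local Notation O := (Omega G).

Lemma open_Omega : open O. Proof. exact: closed_openC. Qed.

Lemma measurable_Omega : measurable O.
Proof. by apply: open_measurable_rV; exact: open_Omega. Qed.

Lemma measurable_extend0 (g : 'rV[R]_n -> R) : measurable_fun O g ->
  measurable_fun setT (fun x => g x * \1_O x).
Proof.
move=> /(measurable_restrictT _ measurable_Omega).
congr (measurable_fun _ _); apply/funext => x.
by rewrite patchE indicE; case: ifP; rewrite ?mulr1 ?mulr0.
Qed.

Lemma measurable_enorm : measurable_fun setT (@enorm R n).
Proof.
apply: (measurableT_comp (continuous_measurable_fun (@sqrt_continuous R))).
apply: measurable_sum => i; apply: measurable_funX; exact: measurable_coord_rV.
Qed.

Lemma coord_le_enorm (x : 'rV[R]_n) i : `|x ord0 i| <= enorm x.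
Proof.
apply: le_trans (ler_norm_enorm x).
by rewrite [leRHS]/Num.norm/= mx_normrE; apply: (le_bigmax _ _ (ord0, i)).
Qed.

Variables (u : 'rV[R]_n -> R) (F : 'rV[R]_n -> 'rV[R]_n).
Hypotheses (lu : locally_integrable_rV O u) (uF : weak_gradient O u F).

(** Elements of W are Borel on the complement of G and arbitrary on G; the extension by 0 is Borel
    on the whole space, as Tonelli requires. *)
Definition extend0 (g : 'rV[R]_n -> R) (x : 'rV[R]_n) : R := g x * \1_O x.

Lemma extend0E g x : O x -> extend0 g x = g x.
Proof. by move=> Ox; rewrite /extend0 indicE mem_set// mulr1. Qed.

Lemma measurable_grad_norm : measurable_fun setT (extend0 (fun x => enorm (F x))).
Proof.
apply: measurable_extend0; apply: (measurableT_comp (continuous_measurable_fun (@sqrt_continuous R))).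
apply: measurable_sum => i; apply: measurable_funX.
by have [[]] := uF i.
Qed.

Lemma sobolev_line_bound (i : 'I_n) (s : R) : {ae leb, forall x,
  (`|extend0 u (x + s *: delta_mx 0 i) - extend0 u x|%:E <=
   `|s|%:E * \int[lam]_(t in unit01)
     (extend0 (fun x => enorm (F x)) (x + t *: (s *: delta_mx 0 i)))%:E)%E}.
Proof.
have [lF wF] := uF i; have [mF _ _] := lF.
pose v : 'rV[R]_n := s *: delta_mx 0 i.
apply: filterS2 (ae_weak_derivative_segment s lu lF wF)
  (ae_segment_avoids d_gt0 d_lt G_regular i s) => x H xG.
have xO t : 0 <= t <= 1 -> O (x + t *: v) by exact: xG.
rewrite !extend0E; last 2 first.
- by have := xO 0; rewrite scale0r addr0; apply; rewrite lexx ler01.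
- by have := xO 1; rewrite scale1r; apply; rewrite lexx ler01.
apply: (le_trans (H xO)); rewrite lee_wpmul2l//.
have ml (g : 'rV[R]_n -> R) : measurable_fun setT g ->
    measurable_fun setT (fun t : measurableTypeR R => g (x + t *: v)).
  move=> mg; apply: measurableT_comp => //.
  exact: (measurableT_comp (measurable_rV_line v) (pair1_measurable x)).
rewrite (eq_integral (fun t : measurableTypeR R => `|extend0 (fun x => F x ord0 i) (x + t *: v)|%:E)); last first.
  by move=> t /set_mem /=; rewrite in_itv/= => t01; rewrite extend0E//; exact: xO.
apply: ge0_le_integral => //.
- apply: measurable_EFin; apply: measurableT_comp => //; apply: measurable_funTS.
  by apply: ml; exact: measurable_extend0.
- apply: measurable_EFin; apply: measurable_funTS; apply: ml; exact: measurable_grad_norm.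
by move=> t t01; rewrite lee_fin normrM [`|\1_O _|]ger0_norm// ler_wpM2r// coord_le_enorm.
Qed.

End sobolev_line_bound.

Lemma integral_cst_on d (T : measurableType d) (R : realType)
    (mu : {measure set T -> \bar R}) D (a c : R) : measurable D -> mu D = a%:E ->
  (\int[mu]_(x in D) c%:E = (c * a)%:E)%E.
Proof. by move=> mD Da; rewrite integral_cst// Da. Qed.

(** * Oscillation and averages *)

Section averages.
Variables (R : realType) (n : nat) (u f : 'rV[R]_n -> R).
Local Notation leb := (lebesgue_rV R n).
Hypotheses (n_gt1 : (1 < n)%N) (mu : measurable_fun setT u) (mf : measurable_fun setT f)
  (f_ge0 : forall x, 0 <= f x).
Hypothesis poincare : forall x0 r, 0 < r ->
  (\int[leb]_(y in ball x0 r) \int[leb]_(z in ball x0 r) (`|u z - u y|)%:E <=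
   (n%:R * (2 * r) * (4 * r) ^+ n)%:E * \int[leb]_(y in ball x0 r) (f y)%:E)%E.
Implicit Types (x y z : 'rV[R]_n) (A B : set 'rV[R]_n).

Let n2 : 2 <= n%:R :> R. Proof. by rewrite ler_nat. Qed.

Lemma measurable_ball_rV x r : measurable (ball x r : set 'rV[R]_n).
Proof. by apply: open_measurable_rV; exact: ball_open. Qed.

Lemma measurable_norm_sub x : measurable_fun setT (fun z : 'rV[R]_n => `|x - z|).
Proof.
apply: continuous_measurable_rV => z.
apply: (@continuous_comp _ _ _ (fun z : 'rV[R]_n => x - z)); last exact: norm_continuous.
by apply: continuousB; [exact: cst_continuous|exact: cvg_id].
Qed.

(* Any exponent strictly between 1 - n and 2 - n would do: the gap below 2 - n
   makes the oscillation at x summable over dyadic radii, and the excess over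
   1 - n makes the tail integral over G converge. *)
Definition energy_near x r :=
  (\int[leb]_(z in ball x r) (f z ^+ 2 * `|x - z| `^ (3 / 2 - n%:R))%:E)%E.

Let measurable_energy D x : measurable D ->
  measurable_fun D (fun z => (f z ^+ 2 * `|x - z| `^ (3 / 2 - n%:R))%:E).
Proof.
move=> mD; apply: measurable_funTS; apply: measurable_EFin; apply: measurable_funM.
  exact: measurable_funX.
exact: (measurableT_comp (measurable_powR _) (measurable_norm_sub x)).
Qed.

Let energy_ge0 x z : 0 <= f z ^+ 2 * `|x - z| `^ (3 / 2 - n%:R).
Proof. by rewrite mulr_ge0 ?sqr_ge0 ?powR_ge0. Qed.

Lemma energy_near_ge0 x r : (0 <= energy_near x r)%E.
Proof. by apply: integral_ge0 => z _; rewrite lee_fin. Qed.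

Lemma le_energy_near x r s : r <= s -> (energy_near x r <= energy_near x s)%E.
Proof.
move=> rs; apply: ge0_subset_integral => //; try exact: measurable_ball_rV.
- by apply: measurable_energy; exact: measurable_ball_rV.
- by move=> z _; rewrite lee_fin.
- exact: le_ball.
Qed.

Let integral_ball_gt0 x r w : f x = 0 -> 0 < r -> 0 < w ->
  (energy_near x r <= (w ^+ 2)%:E)%E ->
  (\int[leb]_(z in ball x r) (f z)%:E <= (2 ^+ n * r `^ (n%:R - 3 / 4) * w)%:E)%E.
Proof.
(* This l balances the two terms of AM-GM after integration: l (2 r)^n / 2 and k w^2 are both
   multiples of r^(n - 3/4) w. In k the factor r^(n - 3/2) bounds |x - z|^(n - 3/2) on the ball. *)
move=> fx r0 w0 Vw; pose l := r `^ (- (3 / 4)) * w.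
have l0 : 0 < l by rewrite mulr_gt0// powR_gt0.
pose k := 2^-1 * l^-1 * r `^ (n%:R - 3 / 2).
have k0 : 0 <= k by rewrite !mulr_ge0 ?powR_ge0// invr_ge0 ltW.
have fl z : ball x r z ->
    f z <= 2^-1 * l + k * (f z ^+ 2 * `|x - z| `^ (3 / 2 - n%:R)).
  move=> [_ xz].
  have fr : f z ^+ 2 <= r `^ (n%:R - 3 / 2) * (f z ^+ 2 * `|x - z| `^ (3 / 2 - n%:R)).
    (* At z = x the real power of 0 is 0 by convention, so the right side is 0 and the bound rests
       on f x = 0, which holds at points of G. *)
    have [<-|zx] := eqVneq x z; first by rewrite fx expr0n !mul0r mulr0.
    have xz0 : 0 < `|x - z| by rewrite normr_gt0 subr_eq0.
    rewrite mulrCA -[leLHS]mulr1 ler_wpM2l ?sqr_ge0//.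
    have -> : 3 / 2 - n%:R = - (n%:R - 3 / 2) :> R by lra.
    rewrite powRN ler_pdivlMr ?powR_gt0// mul1r.
    apply: ge0_ler_powR; rewrite ?nnegrE//; [by move: n2; lra|exact: ltW|].
    rewrite [leLHS]/Num.norm/= mx_normrE.
    apply: bigmax_le => [|[i j] _ /=]; first exact: ltW.
    by have := xz i j; rewrite /ball/= !mxE => /ltW.
  (* AM-GM replaces the Cauchy-Schwarz inequality *)
  have AG : f z <= 2^-1 * l + 2^-1 * l^-1 * f z ^+ 2.
    have : 0 <= 2^-1 * l^-1 * (f z - l) ^+ 2.
      by have l0' := ltW l0; rewrite mulr_ge0 ?sqr_ge0// mulr_ge0 ?invr_ge0.
    have -> : 2^-1 * l^-1 * (f z - l) ^+ 2 = 2^-1 * l + 2^-1 * l^-1 * f z ^+ 2 - f z.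
      by field; rewrite gt_eqF.
    by rewrite subr_ge0.
  apply: (le_trans AG); rewrite lerD2l /k -[leRHS]mulrA.
  by apply: ler_wpM2l => //; rewrite mulr_ge0// invr_ge0 ltW.
have mB := measurable_ball_rV x r.
apply: (@le_trans _ _ (\int[leb]_(z in ball x r) ((2^-1 * l)%:E +
    k%:E * (f z ^+ 2 * `|x - z| `^ (3 / 2 - n%:R))%:E))%E).
  apply: ge0_le_integral => //.
  - by move=> z _; rewrite lee_fin.
  - by apply: measurable_EFin; exact: measurable_funTS.
  - by apply: emeasurable_funD => //; apply: measurable_funeM; exact: measurable_energy.
rewrite ge0_integralD//; last 3 first.
- by move=> z _; rewrite lee_fin mulr_ge0// ltW.
- by move=> z _; rewrite mule_ge0// lee_fin.
- by apply: measurable_funeM; exact: measurable_energy.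
rewrite (integral_cst_on _ mB (lebesgue_ball x r0)) ge0_integralZl//; last 2 first.
- exact: measurable_energy.
- by move=> z _; rewrite lee_fin.
rewrite -/(energy_near x r).
apply: (@le_trans _ _ ((2^-1 * l * (2 * r) ^+ n)%:E + k%:E * (w ^+ 2)%:E)%E).
  by rewrite leeD2l// lee_wpmul2l.
rewrite -!EFinM -EFinD lee_fin.
have rE : r `^ (n%:R - 3 / 4) = r ^+ n * r `^ (- (3 / 4)).
  by rewrite -powR_mulrn ?ltW// -powRD// (gt_eqF r0) implybT.
have kE : k * w ^+ 2 = 2^-1 * (r `^ (n%:R - 3 / 4) * w).
  have -> : n%:R - 3 / 4 = (n%:R - 3 / 2) + 3 / 4 :> R by lra.
  rewrite powRD; last by rewrite (gt_eqF r0) implybT.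
  rewrite /k /l powRN; field.
  by rewrite !gt_eqF// powR_gt0.
rewrite kE exprMn /l.
have -> : 2^-1 * (r `^ (- (3 / 4)) * w) * (2 ^+ n * r ^+ n) =
    2 ^+ n * 2^-1 * (r `^ (n%:R - 3 / 4) * w) by rewrite rE; ring.
have H : 0 <= r `^ (n%:R - 3 / 4) * w by rewrite mulr_ge0 ?powR_ge0// ltW.
have e1 : 1 <= 2 ^+ n :> R by rewrite exprn_ege1// ler1n.
by rewrite -!mulrA; nra.
Qed.

(** AM-GM divides by w, so w = 0 is reached by applying the positive case with arbitrarily small
    w. *)
Lemma integral_ball_energy x r w : f x = 0 -> 0 < r -> 0 <= w ->
  (energy_near x r <= (w ^+ 2)%:E)%E ->
  (\int[leb]_(z in ball x r) (f z)%:E <= (2 ^+ n * r `^ (n%:R - 3 / 4) * w)%:E)%E.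
Proof.
move=> fx r0; rewrite le_eqVlt => /predU1P[<-|]; last exact: integral_ball_gt0.
rewrite expr0n/= mulr0 => V0; apply/lee_addgt0Pr => e e0; rewrite add0e.
pose k := 2 ^+ n * r `^ (n%:R - 3 / 4).
have k0 : 0 < k by rewrite mulr_gt0 ?exprn_gt0 ?powR_gt0.
apply: le_trans (integral_ball_gt0 (w := e / k) fx r0 _ _) _.
- by rewrite divr_gt0.
- by rewrite (le_trans V0)// lee_fin sqr_ge0.
- by rewrite lee_fin -/k mulrCA divff ?mulr1// gt_eqF.
Qed.

(** The product of n (2 r) (4 r)^n from Poincare and 2^n r^(n - 3/4) from the energy bound is C1
    r^(2 n) r^(1/4). *)
Let C1 : R := n%:R * 2 * 8 ^+ n.

Lemma oscillation_energy x r w : f x = 0 -> 0 < r -> 0 <= w ->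
  (energy_near x r <= (w ^+ 2)%:E)%E ->
  (\int[leb]_(y in ball x r) \int[leb]_(z in ball x r) (`|u z - u y|)%:E <=
   (C1 * (r ^+ n * r ^+ n) * (r `^ (1 / 4) * w))%:E)%E.
Proof.
move=> fx r0 w0 Vw; apply: (le_trans (poincare x r0)).
apply: (@le_trans _ _ ((n%:R * (2 * r) * (4 * r) ^+ n)%:E *
    (2 ^+ n * r `^ (n%:R - 3 / 4) * w)%:E)%E).
  rewrite lee_wpmul2l//; last exact: integral_ball_energy.
  by have r0' := ltW r0; rewrite lee_fin !mulr_ge0// exprn_ge0// mulr_ge0.
rewrite -EFinM lee_fin le_eqVlt; apply/orP; left; apply/eqP.
have -> : r `^ (n%:R - 3 / 4) = r ^+ n * r^-1 * r `^ (1 / 4).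
  rewrite -powR_mulrn ?ltW// -[r^-1]powR_inv1 ?ltW// -!powRD ?(gt_eqF r0) ?implybT//.
  by congr (_ `^ _); lra.
have e8 : 8 ^+ n = 4 ^+ n * 2 ^+ n :> R by rewrite -exprMn; congr (_ ^+ _); lra.
by rewrite /C1 e8 exprMn; field; rewrite gt_eqF.
Qed.

End averages.

(** * Means and mean oscillation in a measure space *)

Section mean.
Context d (T : measurableType d) (R : realType)
  (mu : {sigma_finite_measure set T -> \bar R}) (u : T -> R).
Hypothesis mu_u : measurable_fun setT u.
Implicit Types (A B Q : set T).

Definition mean A : R := (fine (mu A))^-1 * \int[mu]_(y in A) u y.

Let mdist : measurable_fun setT (fun p : T * T => (`|u p.2 - u p.1|)%:E).
Proof.
apply/measurable_EFinP; apply: measurableT_comp => //; apply: measurable_funB.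
  exact: (measurableT_comp mu_u).
exact: (measurableT_comp mu_u).
Qed.

Lemma measurable_inner_dist A : measurable A ->
  measurable_fun setT (fun z => \int[mu]_(y in A) (`|u y - u z|)%:E)%E.
Proof.
move=> mA.
pose h (p : T * T) := (`|u p.2 - u p.1| * \1_A p.2)%:E.
rewrite (_ : (fun z => _) = fubini_F mu h).
  apply: measurable_fun_fubini_tonelli_F => //.
    apply/measurable_EFinP; apply: measurable_funM.
      by apply/measurable_EFinP.
    by apply: measurableT_comp => //; exact: measurable_indic.
  by move=> p; rewrite lee_fin mulr_ge0.
apply/funext => z; rewrite integral_mkcond; apply: eq_integral => y _.
by rewrite patchE /h indicE; case: ifP; rewrite ?mulr1 ?mulr0.
Qed.

(** A finite double integral over a set of positive measure provides one z for which |u y - u z| is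
    integrable in y, and then |u y| <= |u y - u z| + |u z|. This gives local integrability up to
    G. *)
Lemma integrable_oscillation Q : measurable Q -> (0 < mu Q < +oo)%E ->
  (\int[mu]_(z in Q) \int[mu]_(y in Q) (`|u y - u z|)%:E < +oo)%E ->
  mu.-integrable Q (EFin \o u).
Proof.
move=> mQ /andP[Q0 Qoo] H.
have [z Hz] : exists z, (\int[mu]_(y in Q) (`|u y - u z|)%:E < +oo)%E.
  apply/not_existsP => Hn; move: H; rewrite ltNge => /negP; apply.
  rewrite (_ : +oo = +oo * mu Q)%E; last by rewrite gt0_mulye.
  rewrite -integral_cst// le_eqVlt; apply/orP; left; apply/eqP.
  apply: eq_integral => z _ /=; apply/esym/eqP.
  by rewrite eq_le leey/= leNgt; apply/negP; exact: Hn.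
apply/integrableP; split; first by apply/measurable_EFinP; exact: measurable_funTS.
apply: (@le_lt_trans _ _ (\int[mu]_(y in Q) ((`|u y - u z|)%:E + (`|u z|)%:E))%E).
  apply: ge0_le_integral => //.
  - by apply/measurable_EFinP; apply: measurableT_comp => //; exact: measurable_funTS.
  - apply: emeasurable_funD => //; apply/measurable_EFinP; apply: measurableT_comp => //.
    by apply: measurable_funB => //; exact: measurable_funTS.
  - by move=> y _ /=; rewrite lee_fin -[in leLHS](subrK (u z) (u y)) ler_normD.
rewrite ge0_integralD//; last first.
  apply/measurable_EFinP; apply: measurableT_comp => //.
  by apply: measurable_funB => //; exact: measurable_funTS.
rewrite lte_add_pinfty// integral_cst//.
by rewrite lte_mul_pinfty// ge0_fin_numE.
Qed.

Let integrable_cst_fin A (a c : R) : measurable A -> mu A = a%:E ->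
  mu.-integrable A (EFin \o cst c).
Proof.
move=> mA Aa; apply/integrableP; split; first exact/measurable_EFinP/measurable_cst.
by rewrite (integral_cst_on `|c| mA Aa) ltry.
Qed.

Variable Q : set T.
Hypotheses (mQ : measurable Q) (uQ : mu.-integrable Q (EFin \o u)).

(** The deviation of u z from the mean over A is at most the mean over y in A of |u y - u z|.
    Integrating over z in B and enlarging both domains to Q gives the double integral divided by
    a. *)
Lemma mean_deviation A B (a b K : R) : measurable A -> measurable B ->
  A `<=` Q -> B `<=` Q -> 0 < a -> mu A = a%:E ->
  (\int[mu]_(z in Q) \int[mu]_(y in Q) (`|u y - u z|)%:E <= (K * (a * b))%:E)%E ->
  (\int[mu]_(z in B) (`|u z - mean A|)%:E <= (K * b)%:E)%E.
Proof.
move=> mA mB AQ BQ a0 Aa H.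
have uA : mu.-integrable A (EFin \o u) by exact: integrableS uQ.
have mi D : measurable D -> measurable_fun D (fun z => \int[mu]_(y in A) (`|u y - u z|)%:E)%E.
  by move=> mD; apply: measurable_funTS; exact: measurable_inner_dist.
apply: (@le_trans _ _ (\int[mu]_(z in B) (a^-1%:E *
    \int[mu]_(y in A) (`|u y - u z|)%:E))%E).
  apply: ge0_le_integral => //.
  - apply/measurable_EFinP; apply: measurableT_comp => //.
    by apply: measurable_funB => //; exact: measurable_funTS.
  - by apply: measurable_funeM; exact: mi.
  - move=> z Bz; rewrite -[leLHS]mul1e -[1%E]/(1%:E) -(mulVf (lt0r_neq0 a0)) EFinM -muleA.
    rewrite lee_pmul2l ?lte_fin ?invr_gt0//.
    have cA : mu.-integrable A (EFin \o cst (u z)).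
      exact: integrable_cst_fin Aa.
    have -> : (a%:E * `|u z - mean A|%:E = `|\int[mu]_(y in A) ((u y)%:E - (u z)%:E)|)%E.
      rewrite integralB// (integral_cst_on _ mA Aa) -(fineK (integrable_fin_num mA uA)).
      rewrite -EFinB/= -EFinM; congr EFin.
      rewrite -{1}(gtr0_norm a0) -normrM distrC /mean Aa/=; congr (`| _ |).
      by rewrite mulrBr mulrA divff ?gt_eqF// mul1r mulrC.
    apply: le_trans (le_abse_integral _ _ _) _ => //.
    by apply: emeasurable_funB; apply/measurable_EFinP => //; exact: measurable_funTS.
rewrite ge0_integralZl//; last 3 first.
- exact: mi.
- by move=> z _; apply: integral_ge0 => y _; rewrite lee_fin.
- by rewrite lee_fin invr_ge0 ltW.
rewrite -(mul1r (K * b)) -(mulVf (lt0r_neq0 a0)) -mulrA EFinM lee_pmul2l ?lte_fin ?invr_gt0//.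
rewrite mulrCA; apply: le_trans H.
apply: (@le_trans _ _ (\int[mu]_(z in B) \int[mu]_(y in Q) (`|u y - u z|)%:E)%E).
  apply: ge0_le_integral => //.
  - by move=> z _; apply: integral_ge0 => y _; rewrite lee_fin.
  - exact: mi.
  - by apply: measurable_funTS; exact: measurable_inner_dist.
  - move=> z _; apply: ge0_subset_integral => //.
    apply/measurable_EFinP; apply: measurableT_comp => //.
    by apply: measurable_funB => //; exact: measurable_funTS.
apply: ge0_subset_integral => //.
- by apply: measurable_funTS; exact: measurable_inner_dist.
- by move=> z _; apply: integral_ge0 => y _; rewrite lee_fin.
Qed.

Lemma mean_dist B (b c K : R) : measurable B -> B `<=` Q -> 0 < b -> mu B = b%:E ->
  (\int[mu]_(z in B) (`|u z - c|)%:E <= (K * b)%:E)%E -> `|mean B - c| <= K.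
Proof.
move=> mB BQ b0 Bb H.
have uB : mu.-integrable B (EFin \o u) by exact: integrableS uQ.
have cB : mu.-integrable B (EFin \o cst c) by exact: integrable_cst_fin Bb.
rewrite -(ler_pM2r b0) -lee_fin; apply: le_trans H.
have -> : ((`|mean B - c| * b)%:E = `|\int[mu]_(y in B) ((u y)%:E - c%:E)|)%E.
  rewrite integralB// (integral_cst_on _ mB Bb) -(fineK (integrable_fin_num mB uB)).
  rewrite -EFinB/=; congr EFin.
  rewrite -[in LHS](gtr0_norm b0) -normrM /mean Bb/=; congr (`| _ |).
  by rewrite mulrBl mulrAC mulVf ?gt_eqF// mul1r.
apply: le_abse_integral => //.
by apply: emeasurable_funB; apply/measurable_EFinP => //; exact: measurable_funTS.
Qed.

End mean.

Lemma measurable_eball (R : realType) n (x : 'rV[R]_n) r : measurable (eball x r).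
Proof.
rewrite (_ : eball x r = (fun y => enorm (x - y)) @^-1` `]-oo, r[).
  rewrite -[X in measurable X]setTI.
  have m : measurable_fun setT (fun y : 'rV[R]_n => enorm (x - y)).
    apply: (measurableT_comp (@measurable_enorm R n)).
    apply: measurable_rV_coord => i; under eq_fun do rewrite !mxE.
    by apply: measurable_funB => //; exact: measurable_coord_rV.
  by apply: m => //; exact: measurable_itv.
by apply/seteqP; split => y; rewrite /eball /= in_itv.
Qed.

Lemma enorm_le (R : realType) n (v : 'rV[R]_n) : enorm v <= n%:R * `|v|.
Proof.
have H i : `|v ord0 i| <= `|v|.
  by rewrite [leRHS]/Num.norm/= mx_normrE; apply: (le_bigmax _ _ (ord0, i)).
rewrite -[leRHS]ger0_norm ?mulr_ge0// -sqrtr_sqr ler_wsqrtr//.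
apply: (@le_trans _ _ (\sum_(i < n) `|v| ^+ 2)).
  apply: ler_sum => i _; rewrite -real_normK ?num_real//.
  by rewrite lerXn2r ?nnegrE.
rewrite sumr_const card_ord -[leLHS]mulr_natl exprMn ler_wpM2r ?sqr_ge0//.
by rewrite -natrX ler_nat -mulnn; clear; nia.
Qed.

Lemma enormN (R : realType) n (v : 'rV[R]_n) : enorm (- v) = enorm v.
Proof. by congr Num.sqrt; apply: eq_bigr => i _; rewrite mxE sqrrN. Qed.

Lemma norm_lt_ball (R : realType) n (x y : 'rV[R]_n) r : 0 < r ->
  `|x - y| < r -> ball x r y.
Proof.
move=> r0 xy; split => // i j; rewrite (_ : i = ord0); last exact: ord1.
apply: le_lt_trans xy; rewrite [leRHS]/Num.norm/= mx_normrE.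
by apply: le_trans (le_bigmax _ _ (ord0, j)); rewrite /= !mxE.
Qed.

Lemma eball_ball (R : realType) n (x : 'rV[R]_n) r : 0 < r -> eball x r `<=` ball x r.
Proof. by move=> r0 y xy; apply: norm_lt_ball => //; exact: le_lt_trans (ler_norm_enorm _) xy. Qed.

Lemma ball_eball (R : realType) n (x : 'rV[R]_n) r : (0 < n)%N -> 0 < r ->
  ball x (r / n%:R) `<=` eball x r.
Proof.
move=> n0 r0 y [rn xy]; rewrite /eball/=; apply: le_lt_trans (enorm_le _) _.
rewrite -ltr_pdivlMl ?ltr0n// mulrC [ltLHS]/Num.norm/= mx_normrE.
by apply: bigmax_lt => // -[i j] _ /=; have := xy i j; rewrite /ball/= !mxE.
Qed.

Lemma lebesgue_eball (R : realType) n (x : 'rV[R]_n) r : (0 < n)%N -> 0 < r ->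
  exists2 a : R, (2 * r / n%:R) ^+ n <= a & lebesgue_rV R n (eball x r) = a%:E.
Proof.
move=> n0 r0; have rn : 0 < r / n%:R by rewrite divr_gt0 ?ltr0n.
have mE := measurable_eball x r.
have H : (lebesgue_rV R n (eball x r) <= ((2 * r) ^+ n)%:E)%E.
  rewrite -(lebesgue_ball x r0); apply: le_measure; rewrite ?inE//.
    by apply: open_measurable_rV; exact: ball_open.
  exact: eball_ball.
have fE : lebesgue_rV R n (eball x r) \is a fin_num.
  by rewrite ge0_fin_numE// (le_lt_trans H)// ltry.
exists (fine (lebesgue_rV R n (eball x r))); last by rewrite fineK.
rewrite -lee_fin fineK// -mulrA -(lebesgue_ball x rn); apply: le_measure; rewrite ?inE//.
  by apply: open_measurable_rV; exact: ball_open.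
exact: ball_eball.
Qed.

(** * Limits of averages at one point and comparison of two points *)

Section trace_value.
Variables (R : realType) (n : nat) (u : 'rV[R]_n -> R) (C1 : R).
Hypotheses (n_gt0 : (0 < n)%N) (mu_u : measurable_fun setT u) (C1_ge0 : 0 <= C1).
Local Notation leb := (lebesgue_rV R n).
Implicit Types (x y z : 'rV[R]_n) (A B : set 'rV[R]_n) (r s : R) (w : R -> R).

(* A Campanato-type bound on the oscillation of u at the point x. *)
Definition oscillates_less x w := [/\ forall r, 0 <= w r,
  {homo w : r s / r <= s} &
  forall r, 0 < r -> (\int[leb]_(z in ball x r) \int[leb]_(y in ball x r)
    (`|u y - u z|)%:E <= (C1 * (r ^+ n * r ^+ n) * (r `^ (1 / 4) * w r))%:E)%E].

Definition avg x r := mean leb u (eball x r).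

(** The oscillation bound is normalized by r^n r^n, the means by measures that are only known to be
    at least (r/n)^n each, because a Euclidean ball of radius r contains the cube of radius r/n. The
    exchange costs n^n n^n. *)
Definition osc_const : R := C1 * (n%:R ^+ n * n%:R ^+ n).

Let osc_const_ge0 : 0 <= osc_const.
Proof. by rewrite !mulr_ge0// exprn_ge0. Qed.

Lemma oscillates_less_integrable x w r : oscillates_less x w -> 0 < r ->
  leb.-integrable (ball x r) (EFin \o u).
Proof.
case=> _ _ H r0; apply: integrable_oscillation => //.
- by apply: open_measurable_rV; exact: ball_open.
- rewrite [X in (0 < X < _)%E](lebesgue_ball x r0) lte_fin ltry andbT.
  by rewrite exprn_gt0 ?mulr_gt0.
- by apply: le_lt_trans (H _ r0) _; rewrite ltry.
Qed.

Lemma oscillates_less_integrable_eball x w r : oscillates_less x w -> 0 < r ->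
  leb.-integrable (eball x r) (EFin \o u).
Proof.
move=> H r0; apply: integrableS (oscillates_less_integrable H r0) => //.
- by apply: open_measurable_rV; exact: ball_open.
- exact: measurable_eball.
- exact: eball_ball.
Qed.

Let osc_const_le (r a b : R) : 0 < r -> (r / n%:R) ^+ n <= a ->
  (r / n%:R) ^+ n <= b -> C1 * (r ^+ n * r ^+ n) <= osc_const * (a * b).
Proof.
move=> r0 ra rb; rewrite /osc_const -!mulrA ler_wpM2l//.
have nn : n%:R ^+ n != 0 :> R by rewrite expf_neq0// pnatr_eq0 -lt0n.
have rn : 0 <= (r / n%:R) ^+ n by rewrite exprn_ge0// divr_ge0// ltW.
have -> : r ^+ n = n%:R ^+ n * (r / n%:R) ^+ n.
  by rewrite -exprMn mulrC divfK// pnatr_eq0 -lt0n.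
have -> : forall N P : R, N * P * (N * P) = N * (N * (P * P)) by move=> *; ring.
by rewrite !ler_wpM2l ?exprn_ge0// ler_pM.
Qed.

Lemma integral_sub_mean x w r A B (a b : R) : oscillates_less x w -> 0 < r ->
  measurable A -> measurable B -> A `<=` ball x r -> B `<=` ball x r ->
  leb A = a%:E -> leb B = b%:E -> (r / n%:R) ^+ n <= a -> (r / n%:R) ^+ n <= b ->
  (\int[leb]_(z in B) (`|u z - mean leb u A|)%:E <=
    (osc_const * (r `^ (1 / 4) * w r) * b)%:E)%E.
Proof.
move=> H r0 mA mB Ar Br Aa Bb ra rb; have [w0 _ Hr] := H.
have a0 : 0 < a.
  by apply: lt_le_trans ra; rewrite exprn_gt0// divr_gt0// ltr0n.
apply: (@mean_deviation _ _ _ leb u mu_u (ball x r) _ _ A B a b) => //.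
- by apply: open_measurable_rV; exact: ball_open.
- exact: oscillates_less_integrable H r0.
apply: le_trans (Hr _ r0) _; rewrite lee_fin.
rewrite [leRHS]mulrAC; apply: ler_wpM2r; first by rewrite mulr_ge0// powR_ge0.
exact: osc_const_le.
Qed.

Lemma dist_mean x w r A B (a b : R) : oscillates_less x w -> 0 < r ->
  measurable A -> measurable B -> A `<=` ball x r -> B `<=` ball x r ->
  leb A = a%:E -> leb B = b%:E -> (r / n%:R) ^+ n <= a -> (r / n%:R) ^+ n <= b ->
  `|mean leb u B - mean leb u A| <= osc_const * (r `^ (1 / 4) * w r).
Proof.
move=> H r0 mA mB Ar Br Aa Bb ra rb.
apply: (@mean_dist _ _ _ leb u mu_u (ball x r) _ _ B b) => //.
- by apply: open_measurable_rV; exact: ball_open.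
- exact: oscillates_less_integrable H r0.
- by apply: lt_le_trans rb; rewrite exprn_gt0// divr_gt0// ltr0n.
- exact: (integral_sub_mean H r0 mA mB Ar Br Aa Bb).
Qed.

Let half_eball x r : 0 < r -> exists2 a : R, (r / n%:R) ^+ n <= a &
  leb (eball x r) = a%:E.
Proof.
move=> r0; have [a ra Ea] := lebesgue_eball x n_gt0 r0; exists a => //.
apply: le_trans ra; have r0' := ltW r0.
rewrite lerXn2r ?nnegrE ?divr_ge0 ?mulr_ge0//.
by rewrite ler_pM2r ?invr_gt0 ?ltr0n//; lra.
Qed.

Let avg_step x w r s : oscillates_less x w -> 0 < r -> r / 2 <= s <= r ->
  `|avg x s - avg x r| <= osc_const * (r `^ (1 / 4) * w r).
Proof.
move=> H r0 /andP[rs sr].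
have s0 : 0 < s by apply: lt_le_trans rs; rewrite divr_gt0.
have [a ra Ea] := half_eball x r0.
have [b sb Eb] := lebesgue_eball x n_gt0 s0.
apply: (dist_mean H r0 _ _ _ _ Ea Eb) => //; try exact: measurable_eball.
- exact: eball_ball.
- by apply: subset_trans (eball_ball s0) _; exact: le_ball.
(* The factor 2 in the lower bound (2 s / n)^n pays for s being as small as r / 2. *)
- apply: le_trans sb; have r0' := ltW r0; have s0' := ltW s0.
  rewrite lerXn2r ?nnegrE ?divr_ge0 ?mulr_ge0//.
  by rewrite ler_pM2r ?invr_gt0 ?ltr0n//; lra.
Qed.

Let q : R := 2^-1 `^ (1 / 4).

Let q_gt0 : 0 < q. Proof. by rewrite powR_gt0. Qed.

Let q_lt1 : q < 1.
Proof.
rewrite /q -[ltRHS](congr1 (fun f => f (1 / 4)) (powR1 R)); apply: gt0_ltr_powR; rewrite ?nnegrE//.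
by rewrite invf_lt1// ltr1n.
Qed.

(* The fixed point of M = osc_const + 2^(-1/4) M, i.e. the sum of the geometric
   series arising from the dyadic scales. *)
Definition avg_const : R := osc_const / (1 - 2^-1 `^ (1 / 4)).

Let avg_constE : osc_const + q * avg_const = avg_const.
Proof. by rewrite /avg_const -/q; field; move: q_lt1; lra. Qed.

Lemma avg_const_ge0 : 0 <= avg_const.
Proof. by rewrite divr_ge0// subr_ge0 ltW. Qed.

(** Induction on the number of halvings from r to s. As w is monotone, passing from r to r / 2
    multiplies the bound by at most 2^(-1/4), and [avg_const] is the constant that reproduces itself
    under one such step. *)
Lemma dist_avg x w r s : oscillates_less x w -> 0 < s -> s <= r ->
  `|avg x s - avg x r| <= avg_const * (r `^ (1 / 4) * w r).
Proof.
move=> H s0 sr; have [w0 wle _] := H.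
have M0 := avg_const_ge0.
have [k rk] : exists k : nat, r <= 2 ^+ k * s.
  have rs0 : 0 <= r / s by rewrite divr_ge0 ?(ltW s0)// (le_trans (ltW s0)).
  have := archi_boundP rs0; move: (Num.bound _) => k.
  rewrite ltr_pdivrMr// => rk; exists k; apply: le_trans (ltW rk) _.
  by rewrite (ler_wpM2r (ltW s0))// -natrX ler_nat ltnW// ltn_expl.
elim: k r rk sr => [|k IH] r rk sr.
  have -> : s = r by apply/eqP; rewrite eq_le sr/=; move: rk; rewrite expr0 mul1r.
  by rewrite subrr normr0 mulr_ge0// mulr_ge0// powR_ge0.
have r0 : 0 < r by exact: lt_le_trans sr.
have KM : osc_const * (r `^ (1 / 4) * w r) <= avg_const * (r `^ (1 / 4) * w r).
  apply: ler_wpM2r; first by rewrite mulr_ge0 ?powR_ge0.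
  by rewrite -avg_constE lerDl mulr_ge0// ltW.
have [rs|rs] := leP (r / 2) s.
  by apply: le_trans KM; apply: avg_step H r0 _; rewrite rs sr.
rewrite -(subrKA (avg x (r / 2))); apply: le_trans (ler_normD _ _) _.
rewrite -avg_constE mulrDl addrC lerD//.
  by apply: avg_step => //; rewrite lexx/=; lra.
apply: (le_trans (IH (r / 2) _ (ltW rs))).
  by rewrite ler_pdivrMr// mulrC mulrA -exprS.
have rq : (r / 2) `^ (1 / 4) = q * r `^ (1 / 4).
  by rewrite powRM ?ltW// mulrC.
have rr : r / 2 <= r by lra.
have := ler_wpM2l M0 (ler_wpM2l (ltW q_gt0) (ler_wpM2l (powR_ge0 r (1 / 4)) (wle _ _ rr))).
by rewrite rq; lra.
Qed.

Let powR_small w : (forall r, 0 <= w r) -> {homo w : r s / r <= s} -> forall c,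
  c * (r `^ (1 / 4) * w r) @[r --> 0^'+] --> 0.
Proof.
move=> w0 wle c.
suff S : r `^ (1 / 4) * w r @[r --> 0^'+] --> 0.
  by rewrite -[X in _ --> X](mulr0 c); apply: cvgM => //; exact: cvg_cst.
have H : r `^ (1 / 4) * w 1 @[r --> 0^'+] --> 0.
  have c0 : r `^ (1 / 4) @[r --> 0^'+] --> (0 : R) by apply: powR_cvg0.
  by rewrite -[X in _ --> X](mul0r (w 1)); apply: cvgM => //; exact: cvg_cst.
apply: (squeeze_cvgr _ (cvg_cst 0) H); near=> r.
rewrite mulr_ge0 ?powR_ge0//= ler_wpM2l ?powR_ge0// wle//.
by near: r; exact: nbhs_right_le.
Unshelve. all: by end_near. Qed.

(** [dist_avg] makes the averages Cauchy; letting its smaller radius tend to 0 also keeps the rate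
    of convergence, which the comparison of two points relies on. *)
Lemma cvg_avg x w : oscillates_less x w -> exists L : R,
  (forall r, 0 < r -> `|L - avg x r| <= avg_const * (r `^ (1 / 4) * w r)) /\
  avg x r @[r --> 0^'+] --> L.
Proof.
move=> H; have [w0 wle _] := H; have S := powR_small w0 wle avg_const.
have /cvg_ex[L cL] : cvg (avg x r @[r --> 0^'+]).
  apply/cauchy_cvgP/cauchyP => e e0.
  have [r0 [r0p r0e]] : exists r0 : R, 0 < r0 /\ avg_const * (r0 `^ (1 / 4) * w r0) < e.
    have F : \forall r \near 0^'+, 0 < r /\ avg_const * (r `^ (1 / 4) * w r) < e.
      near=> r; split; first by near: r; exact: nbhs_right_gt.
      near: r; have := @cvgr_lt _ _ _ _ _ _ S e e0; exact.
    have [r Hr] := filter_ex F; by exists r.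
  have F : \forall r \near 0^'+, ball (avg x r0) e (avg x r).
    near=> r; rewrite /ball/= distrC; apply: le_lt_trans r0e; apply: dist_avg H _ _.
      by near: r; exact: nbhs_right_gt.
    by near: r; exact: nbhs_right_le.
  by exists (avg x r0).
exists L; split => // r r0.
have cL' : `|avg x s - avg x r| @[s --> 0^'+] --> `|L - avg x r|.
  by apply: cvg_norm; apply: cvgB => //; exact: cvg_cst.
rewrite -(cvg_lim _ cL')//; apply: limr_le; first by apply/cvg_ex; exists `|L - avg x r|.
near=> s; apply: dist_avg H _ _.
  by near: s; exact: nbhs_right_gt.
by near: s; exact: nbhs_right_le.
Unshelve. all: by end_near. Qed.

Lemma ball_averageE x w r : oscillates_less x w -> 0 < r ->
  ball_average u x r = (avg x r)%:E.
Proof.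
move=> H r0; have [a ra Ea] := half_eball x r0.
have a0 : 0 < a by apply: lt_le_trans ra; rewrite exprn_gt0// divr_gt0// ltr0n.
have iu := oscillates_less_integrable_eball H r0.
rewrite /ball_average /avg /mean Ea inver gt_eqF//= EFinM fineK//.
by apply: integrable_fin_num => //; exact: measurable_eball.
Qed.

Lemma ball_average_dist x w r (L : R) : oscillates_less x w -> 0 < r ->
  `|L - avg x r| <= avg_const * (r `^ (1 / 4) * w r) ->
  (0 <= ball_average (fun y => `|u y - L|)%R x r <=
    ((osc_const + avg_const) * (r `^ (1 / 4) * w r))%:E)%E.
Proof.
move=> H r0 HL; have [a ra Ea] := half_eball x r0.
have a0 : 0 < a by apply: lt_le_trans ra; rewrite exprn_gt0// divr_gt0// ltr0n.
have mE := measurable_eball x r.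
have iu := oscillates_less_integrable_eball H r0.
rewrite /ball_average Ea inver gt_eqF//= mule_ge0 ?integral_ge0//=; last first.
  by rewrite lee_fin invr_ge0 ltW.
have -> : ((osc_const + avg_const) * (r `^ (1 / 4) * w r))%:E = (a^-1%:E *
    ((osc_const + avg_const) * (r `^ (1 / 4) * w r) * a)%:E)%E.
  by rewrite -EFinM; congr EFin; field; rewrite gt_eqF.
rewrite lee_pmul2l ?lte_fin ?invr_gt0//.
have md c : measurable_fun (eball x r) (fun y => (`|u y - c|)%:E).
  apply/measurable_EFinP; apply: measurableT_comp => //.
  by apply: measurable_funB => //; exact: measurable_funTS.
apply: (@le_trans _ _ (\int[leb]_(y in eball x r) ((`|u y - avg x r|)%:E +
    (avg_const * (r `^ (1 / 4) * w r))%:E))%E).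
  apply: ge0_le_integral => //.
    by apply: emeasurable_funD.
  move=> y _; rewrite -EFinD lee_fin -(subrKA (avg x r)).
  by apply: le_trans (ler_normD _ _) _; rewrite lerD2l distrC.
rewrite ge0_integralD//; last first.
  by move=> y _; rewrite lee_fin; exact: le_trans HL.
rewrite (integral_cst_on _ mE Ea) !mulrDl EFinD leeD2r//.
by apply: (integral_sub_mean H r0 mE mE _ _ Ea Ea ra ra); exact: eball_ball.
Qed.

Lemma cvg_ball_average_dist x w (L : R) : oscillates_less x w ->
  (forall r, 0 < r -> `|L - avg x r| <= avg_const * (r `^ (1 / 4) * w r)) ->
  ball_average (fun y => `|u y - L|) x r @[r --> 0^'+] --> 0%E.
Proof.
move=> H HL; have [w0 wle _] := H.
have S := powR_small w0 wle (osc_const + avg_const).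
apply: (@squeeze_cvge _ _ _ _ (cst 0%E) _
    (fun r => ((osc_const + avg_const) * (r `^ (1 / 4) * w r))%:E)).
- near=> r; apply: ball_average_dist H _ _.
    by near: r; exact: nbhs_right_gt.
  by apply: HL; near: r; exact: nbhs_right_gt.
- exact: cvg_cst.
- by apply: cvg_EFin => //; near=> r.
Unshelve. all: by end_near. Qed.

(** With r = |x - y|, go from L to the average on the r-ball at x, to the one at y, to L'. Both
    balls lie in the cube of radius s = 2 r about x, so the middle step is an oscillation at x. The
    last factor 2 is (w + w')^2 <= 2 (w^2 + w'^2). *)
Lemma trace_pair x y w w' (L L' : R) : oscillates_less x w -> oscillates_less y w' ->
  (forall r, 0 < r -> `|L - avg x r| <= avg_const * (r `^ (1 / 4) * w r)) ->
  (forall r, 0 < r -> `|L' - avg y r| <= avg_const * (r `^ (1 / 4) * w' r)) ->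
  0 < enorm (x - y) -> forall s, s = 2 * enorm (x - y) ->
  `|L - L'| ^+ 2 <= 2 * (osc_const + avg_const) ^+ 2 *
    (s `^ (1 / 2) * (w s ^+ 2 + w' s ^+ 2)).
Proof.
move=> H H' HL HL'; set r := enorm (x - y) => r0 s sE.
have [w0 wle _] := H; have [w0' wle' _] := H'.
have s0 : 0 < s by rewrite sE mulr_gt0.
have rs : r <= s by rewrite sE; lra.
have rp : r `^ (1 / 4) <= s `^ (1 / 4).
  by apply: ge0_ler_powR; rewrite ?nnegrE// ltW.
have Ex : eball x r `<=` ball x s.
  by apply: subset_trans (eball_ball r0) _; exact: le_ball.
have Ey : eball y r `<=` ball x s.
  move=> z yz; apply: norm_lt_ball => //; rewrite -(subrKA y).
  apply: le_lt_trans (ler_normD _ _) _; rewrite sE mulr2n mulrDl mul1r.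
  by rewrite ler_ltD ?ler_norm_enorm//; exact: le_lt_trans (ler_norm_enorm _) yz.
have [a ra Ea] := lebesgue_eball x n_gt0 r0.
have [b rb Eb] := lebesgue_eball y n_gt0 r0.
(* As 2 r = s, the lower bounds (2 r / n)^n on the two measures are the ones that [dist_mean] asks
   for at scale s. *)
rewrite -sE in ra rb.
have := dist_mean H s0 (measurable_eball y r) (measurable_eball x r) Ey Ex Eb Ea rb ra.
rewrite -/(avg x r) -/(avg y r) => Hxy.
have M0 := avg_const_ge0.
have Hb (v : R -> R) : (forall r, 0 <= v r) -> {homo v : r s / r <= s} ->
    avg_const * (r `^ (1 / 4) * v r) <= avg_const * (s `^ (1 / 4) * v s).
  by move=> v0 vle; rewrite ler_wpM2l// ler_pM ?powR_ge0// vle.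
have : `|L - L'| <= (osc_const + avg_const) * (s `^ (1 / 4) * (w s + w' s)).
  have lin (K M S a1 b1 t1 t2 t3 : R) : t1 <= M * (S * a1) -> t2 <= M * (S * b1) ->
      t3 <= K * (S * a1) -> 0 <= K * (S * b1) ->
      t1 + t3 + t2 <= (K + M) * (S * (a1 + b1)) by move=> *; lra.
  have tri (c e : R) : `|L - L'| <= `|L - c| + `|c - e| + `|L' - e|.
    rewrite (distrC L'); apply: le_trans (ler_distD e _ _) _.
    by rewrite lerD2r ler_distD.
  apply: le_trans (tri (avg x r) (avg y r)) _; apply: lin => //.
  - exact: le_trans (HL r r0) (Hb _ w0 wle).
  - exact: le_trans (HL' r r0) (Hb _ w0' wle').
  - by rewrite !mulr_ge0 ?powR_ge0.
move=> HLL.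
have s2 : s `^ (1 / 2) = s `^ (1 / 4) ^+ 2.
  by rewrite -powR_mulrn ?powR_ge0// -powRrM; congr (_ `^ _); lra.
have : `|L - L'| ^+ 2 <= ((osc_const + avg_const) * (s `^ (1 / 4) * (w s + w' s))) ^+ 2.
  rewrite lerXn2r ?nnegrE//; exact: le_trans HLL.
move=> /le_trans; apply; rewrite s2 !exprMn.
have -> : forall a b c : R, 2 * a * (b * c) = a * (b * (2 * c)) by move=> *; ring.
rewrite ler_wpM2l ?sqr_ge0// ler_wpM2l ?sqr_ge0//.
by have := sqr_ge0 (w s - w' s); rewrite sqrrB sqrrD; lra.
Qed.

End trace_value.

Lemma measurable_mx_norm (R : realType) n :
  measurable_fun setT (fun v : 'rV[R]_n => `|v|).
Proof. by apply: continuous_measurable_rV => v; exact: norm_continuous. Qed.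

(** * Integrals over G *)

Section tail.
Variables (R : realType) (n : nat) (sg : {measure set 'rV[R]_n -> \bar R}) (c d a : R).
Hypotheses (c_ge0 : 0 <= c) (d_ge0 : 0 <= d) (a_gt0 : 0 < a) (sg_ball : forall (p : 'rV[R]_n) r, 0 < r ->
  (sg (ball p r) <= (c * r `^ d)%:E)%E).
Variable p : 'rV[R]_n.

Let shell (s t : R) : set 'rV[R]_n := (fun y => `|p - y|) @^-1` `[s, t[.

Let kernel (y : 'rV[R]_n) : \bar R := (`|p - y| `^ (- (d + a)))%:E.

Let measurable_shell (i : interval R) :
  measurable ((fun y : 'rV[R]_n => `|p - y|) @^-1` [set` i]).
Proof.
by rewrite -[X in measurable X]setTI; exact: (measurable_norm_sub p).
Qed.

Let measurable_kernel D : measurable D -> measurable_fun D kernel.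
Proof.
move=> mD; apply: measurable_funTS; apply: measurable_EFin.
exact: (measurableT_comp (measurable_powR _) (measurable_norm_sub p)).
Qed.

Let kernel_ge0 y : (0 <= kernel y)%E. Proof. by rewrite lee_fin powR_ge0. Qed.

Let q : R := 2^-1 `^ a.

Let q_gt0 : 0 < q. Proof. by rewrite powR_gt0. Qed.

Let q_lt1 : q < 1.
Proof.
rewrite /q -[ltRHS](congr1 (fun f => f a) (powR1 R)); apply: gt0_ltr_powR; rewrite ?nnegrE//.
by rewrite invf_lt1// ltr1n.
Qed.

(** Sum of a geometric series: the shell from t to 2 t contributes at most c (2 t)^d t^(-d - a) = c
    2^d t^(-a), and doubling t multiplies this by 2^(-a). *)
Definition tail_const : R := c * 2 `^ d / (1 - 2^-1 `^ a).

Lemma tail_const_ge0 : 0 <= tail_const.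
Proof. by rewrite divr_ge0 ?mulr_ge0 ?powR_ge0// subr_ge0 ltW. Qed.

Let one_shell t : 0 < t ->
  (\int[sg]_(y in shell t (2 * t)) kernel y <= (c * 2 `^ d * t `^ (- a))%:E)%E.
Proof.
move=> t0; have t20 : 0 < 2 * t by rewrite mulr_gt0.
have k0 : 0 <= t `^ (- (d + a)) by exact: powR_ge0.
have mS := measurable_shell `[t, 2 * t[.
apply: (@le_trans _ _ (\int[sg]_(y in shell t (2 * t)) (t `^ (- (d + a)))%:E)%E).
  apply: ge0_le_integral => //; first exact: measurable_kernel.
  move=> y; rewrite /shell /= in_itv/= => /andP[ty _]; rewrite lee_fin.
  rewrite !powRN lef_pV2 ?posrE ?powR_gt0//; last exact: lt_le_trans ty.
  apply: ge0_ler_powR; rewrite ?nnegrE ?addr_ge0//; exact: ltW.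
rewrite integral_cst//.
apply: (@le_trans _ _ ((t `^ (- (d + a)))%:E * (c * (2 * t) `^ d)%:E)%E).
  rewrite lee_wpmul2l// ?lee_fin//; apply: le_trans (sg_ball p t20).
  apply: le_measure; rewrite ?inE//; first by apply: open_measurable_rV; exact: ball_open.
  by move=> y; rewrite /shell /= in_itv/= => /andP[_ yt]; exact: norm_lt_ball.
rewrite -EFinM lee_fin powRM ?(ltW t0)// opprD powRD ?(gt_eqF t0) ?implybT//.
rewrite (powRN t d) [leLHS](_ : _ = c * 2 `^ d * t `^ (- a))//; field.
by rewrite gt_eqF// powR_gt0.
Qed.

(** Removing the innermost shell leaves the same integral started at 2 t, with one shell fewer;
    hence the induction on N for all t. *)
Let shells N t : 0 < t ->
  (\int[sg]_(y in shell t (2 ^+ N * t)) kernel y <= (tail_const * t `^ (- a))%:E)%E.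
Proof.
elim: N t => [|N IH] t t0.
  have M0 := mulr_ge0 tail_const_ge0 (powR_ge0 t (- a)).
  rewrite mul1r (_ : shell t t = set0) ?integral_set0 ?lee_fin//.
  by apply/seteqP; split => // y; rewrite /shell /= in_itv/=; lra.
have t20 : 0 < 2 * t by rewrite mulr_gt0.
have Nt : 2 * t <= 2 ^+ N.+1 * t.
  by rewrite ler_pM2r// exprS ler_peMr// exprn_ege1// ler1n.
have -> : shell t (2 ^+ N.+1 * t) = shell t (2 * t) `|` shell (2 * t) (2 ^+ N * (2 * t)).
  rewrite mulrA -exprSr; apply/seteqP; split => y; rewrite /shell /= !in_itv/=.
    by have [yt|yt] := ltP `|p - y| (2 * t); move=> /andP[-> ->]; [left|right].
  move=> [/andP[-> yt]|/andP[yt ->]] /=; first exact: lt_le_trans Nt.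
  by rewrite andbT; lra.
rewrite (ge0_integral_setU _ (measurable_shell _) (measurable_shell _))//; last 2 first.
- by apply: measurable_kernel; apply: measurableU; exact: measurable_shell.
- apply/disj_setPS => y []; rewrite /shell /= !in_itv/=; lra.
apply: le_trans (leeD (one_shell t0) (IH _ t20)) _.
rewrite -EFinD lee_fin.
have -> : (2 * t) `^ (- a) = q * t `^ (- a).
  rewrite powRM ?(ltW t0)//; congr (_ * _).
  by rewrite /q -[2^-1](powR_inv1 (ler0n R 2)) -powRrM mulN1r.
rewrite mulrA -mulrDl ler_wpM2r ?powR_ge0// /tail_const -/q le_eqVlt.
by apply/orP; left; apply/eqP; field; move: q_lt1; lra.
Qed.

Lemma tail_integral t : 0 < t ->
  (\int[sg]_(y in [set y : 'rV[R]_n | (t <= `|p - y|)%R]) (`|p - y| `^ (- (d + a)))%:E <=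
    (tail_const * t `^ (- a))%:E)%E.
Proof.
move=> t0.
have -> : [set y : 'rV[R]_n | t <= `|p - y|] = \bigcup_N shell t (2 ^+ N * t).
  apply/seteqP; split => y /=; last first.
    by move=> [N _]; rewrite /shell /= in_itv/= => /andP[].
  move=> ty; exists (Num.bound (`|p - y| / t)) => //; rewrite /shell /= in_itv/= ty/=.
  rewrite -ltr_pdivrMr//; apply: lt_le_trans (archi_boundP _) _; first by rewrite divr_ge0// ltW.
  by rewrite -natrX ler_nat ltnW// ltn_expl.
have nd : {homo (fun N => shell t (2 ^+ N * t)) : N M / (N <= M)%N >-> (N <= M)%O}.
  move=> N M NM; apply/subsetPset => y; rewrite /shell /= !in_itv/= => /andP[-> yN]/=.
  by apply: lt_le_trans yN _; rewrite ler_pM2r// ler_weXn2l// ler1n.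
have cv := ge0_nondecreasing_set_cvg_integral nd
  (fun N => measurable_shell _) (fun N => measurable_kernel (measurable_shell _))
  (fun N y _ => kernel_ge0 y) (mu := sg).
rewrite -(cvg_lim _ cv)//; apply: lime_le; first by apply/cvg_ex; eexists; exact: cv.
by apply: nearW => N; exact: shells.
Qed.

End tail.

Section ahlfors_measure.
Variables (R : realType) (n : nat) (d : R) (G : set 'rV[R]_n).
Hypotheses (n_gt0 : (0 < n)%N) (d_gt0 : 0 < d) (G_closed : closed G)
  (G_regular : ahlfors_regular d G).

(** Regularity only concerns Euclidean balls centred on G. A cube of radius r that meets G at x lies
    in the cube of radius 2 r about x, hence in the Euclidean ball of radius 2 n r there. *)
Lemma ahlfors_sigma_ball : exists2 c : R, 0 <= c & forall (p : 'rV[R]_n) r, 0 < r ->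
  (sigma d G (ball p r) <= (c * r `^ d)%:E)%E.
Proof.
have [C0 C1 HG] := G_regular.
have C00 : 0 <= C0 by lra.
exists (C0 * (2 * n%:R) `^ d); first by rewrite mulr_ge0 ?powR_ge0.
move=> p r r0.
have [E|/set0P[x [px Gx]]] := eqVneq (ball p r `&` G) set0.
  by rewrite /sigma /hausdorff_restr E outer_measure0 lee_fin !mulr_ge0 ?powR_ge0.
have n0 : 0 < n%:R :> R by rewrite ltr0n.
have r1 : 0 < 2 * n%:R * r by rewrite !mulr_gt0.
rewrite -mulrA -powRM ?(ltW r0)//.
apply: le_trans (HG x _ Gx r1).2; apply: le_outer_measure => y [py Gy]; split => //.
apply: ball_eball => //.
have -> : 2 * n%:R * r / n%:R = r + r by field; rewrite gt_eqF.
by apply: ball_triangle py; exact: ball_sym.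
Qed.

Lemma ahlfors_sigma_finite : sigma_finite setT (sigma d G).
Proof.
have [c c0 Hc] := ahlfors_sigma_ball.
exists (fun k => ball 0 k.+1%:R).
  apply/seteqP; split => // v _; exists (Num.bound `|v|) => //.
  apply: norm_lt_ball => //; rewrite sub0r normrN.
  by apply: lt_trans (archi_boundP _) _ => //; rewrite ltr_nat.
move=> k; split; first by apply: open_measurable_rV; exact: ball_open.
by apply: le_lt_trans (Hc _ _ _) _ => //; rewrite ltry.
Qed.

Lemma ae_sigma : {ae sigma d G, forall x, G x}.
Proof.
have mG : measurable G.
  by rewrite -(setCK G); apply: measurableC; apply: open_measurable_rV; exact: closed_openC.
exists (~` G); split => //; first exact: measurableC.
by rewrite /sigma /hausdorff_restr setICl outer_measure0.
Qed.

(** Tonelli asks for a structure of sigma-finite measure, which [sigma] has only under the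
    hypotheses on G; the equality carries the results back to [sigma]. *)
Lemma ahlfors_sigma_bundle :
  exists (sg : {sigma_finite_measure set 'rV[R]_n -> \bar R}) (c : R),
    [/\ 0 <= c, (sg : set 'rV[R]_n -> \bar R) = sigma d G, {ae sg, forall x, G x} &
      forall (p : 'rV[R]_n) r, 0 < r -> (sg (ball p r) <= (c * r `^ d)%:E)%E].
Proof.
have [c c0 Hc] := ahlfors_sigma_ball.
pose sg : {sigma_finite_measure set 'rV[R]_n -> \bar R} := HB.pack (sigma d G)
  (@Measure_isSigmaFinite.Build _ _ _ (sigma d G) ahlfors_sigma_finite).
by exists sg, c; split => //; exact: ae_sigma.
Qed.

Lemma delta_le z x : G x -> delta G z <= enorm (z - x).
Proof.
move=> Gx; apply: ge_inf; last by exists x.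
by exists 0 => _ [y _ <-]; exact: enorm_ge0.
Qed.

Lemma delta_gt0 z : G !=set0 -> Omega G z -> 0 < delta G z.
Proof.
move=> [x0 Gx0] Oz.
have /nbhs_ballP[e /= e0 eO] : nbhs z (Omega G).
  by apply: open_nbhs_nbhs; split => //; exact: closed_openC.
apply: (lt_le_trans e0); apply: lb_le_inf; first by exists (enorm (z - x0)); exists x0.
move=> _ [y Gy <-]; rewrite leNgt; apply/negP => ye; apply: (eO y) => //.
by apply: norm_lt_ball => //; exact: le_lt_trans (ler_norm_enorm _) ye.
Qed.

End ahlfors_measure.

Lemma ball_rVE (R : realType) n (x y : 'rV[R]_n) r : ball x r y <-> `|x - y| < r.
Proof.
split => [[r0 xy]|xy]; last by apply: norm_lt_ball => //; exact: le_lt_trans xy.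
rewrite [ltLHS]/Num.norm/= mx_normrE; apply: bigmax_lt => // -[i j] _ /=.
by have := xy i j; rewrite /ball/= !mxE.
Qed.

(** * Energies integrated over G *)

Section energy_integrals.
Variables (R : realType) (n : nat) (c d : R) (f : 'rV[R]_n -> R)
  (sg : {sigma_finite_measure set 'rV[R]_n -> \bar R}).
Local Notation leb := (lebesgue_rV R n).
Hypotheses (n_gt1 : (1 < n)%N) (c_ge0 : 0 <= c) (d_gt0 : 0 < d) (d_lt : d < n%:R - 1)
  (sg_ball : forall (p : 'rV[R]_n) r, 0 < r -> (sg (ball p r) <= (c * r `^ d)%:E)%E)
  (mf : measurable_fun setT f).
Implicit Types (x y z : 'rV[R]_n).

Let n0 : 0 < n%:R :> R. Proof. by rewrite ltr0n ltnW. Qed.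

Let n2 : 2 <= n%:R :> R. Proof. by rewrite ler_nat. Qed.

Let mdist : measurable_fun setT (fun p : 'rV[R]_n * 'rV[R]_n => `|p.1 - p.2|).
Proof. exact: (measurableT_comp (@measurable_mx_norm R n) (@measurable_rVB R n)). Qed.

Let mf2 d' (T : measurableType d') (g : T -> 'rV[R]_n) : measurable_fun setT g ->
  measurable_fun setT (fun p => f (g p) ^+ 2).
Proof. by move=> mg; apply: measurable_funX; exact: (measurableT_comp mf). Qed.

(** The Riesz potential of order 1 of f^2, without normalization and in the sup norm. *)
Definition riesz_energy x := (\int[leb]_z (f z ^+ 2 * `|x - z| `^ (1 - n%:R))%:E)%E.

Let mriesz : measurable_fun setT
  (fun p : 'rV[R]_n * 'rV[R]_n => (f p.2 ^+ 2 * `|p.1 - p.2| `^ (1 - n%:R))%:E).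
Proof.
apply: measurable_EFin; apply: measurable_funM; first exact: mf2.
exact: (measurableT_comp (measurable_powR _) mdist).
Qed.

Let riesz0 x z : (0 <= (f z ^+ 2 * `|x - z| `^ (1 - n%:R))%:E)%E.
Proof. by rewrite lee_fin mulr_ge0 ?sqr_ge0 ?powR_ge0. Qed.

Lemma measurable_riesz_energy : measurable_fun setT riesz_energy.
Proof. by apply: (measurable_fun_fubini_tonelli_F _ mriesz) => p; exact: riesz0. Qed.

Lemma riesz_energy_ge0 x : (0 <= riesz_energy x)%E.
Proof. by apply: integral_ge0 => z _; exact: riesz0. Qed.

(** The exponents differ by 1/2, and |x - z|^(1/2) <= r^(1/2) on the ball. *)
Lemma energy_near_riesz x r : 0 < r ->
  (energy_near f x r <= (r `^ (1 / 2))%:E * riesz_energy x)%E.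
Proof.
move=> r0.
have mr : measurable_fun setT (fun z => (f z ^+ 2 * `|x - z| `^ (1 - n%:R))%:E).
  exact: (measurableT_comp mriesz (pair1_measurable x)).
have mB := measurable_ball_rV x r.
rewrite /riesz_energy -ge0_integralZl ?lee_fin ?powR_ge0//.
apply: (@le_trans _ _ (\int[leb]_(z in ball x r) ((r `^ (1 / 2))%:E *
    (f z ^+ 2 * `|x - z| `^ (1 - n%:R))%:E))%E); last first.
  apply: ge0_subset_integral => //.
    by apply: measurable_funeM.
  by move=> z _; rewrite mule_ge0 ?lee_fin ?powR_ge0//; exact: riesz0.
apply: ge0_le_integral => //.
- by move=> z _; rewrite lee_fin mulr_ge0 ?sqr_ge0 ?powR_ge0.
- apply: measurable_funTS; apply: measurable_EFin; apply: measurable_funM.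
    exact: mf2.
  exact: (measurableT_comp (measurable_powR _) (measurable_norm_sub x)).
- by apply: measurable_funTS; apply: measurable_funeM.
move=> z /ball_rVE xz; rewrite -EFinM lee_fin mulrCA ler_wpM2l ?sqr_ge0//.
have [->|zx] := eqVneq x z.
  by rewrite subrr normr0 !powR0 ?mulr0//; move: n2; lra.
have t0 : 0 < `|x - z| by rewrite normr_gt0 subr_eq0.
have -> : 3 / 2 - n%:R = 1 / 2 + (1 - n%:R) :> R by lra.
rewrite powRD ?(gt_eqF t0) ?implybT// ler_wpM2r ?powR_ge0//.
by apply: ge0_ler_powR; rewrite ?nnegrE// ltW.
Qed.

Section weighted.
Variables (G : set 'rV[R]_n) (dl : 'rV[R]_n -> R).
Hypotheses (ae_G : {ae sg, forall x, G x})
  (dl_le : forall z x, G x -> dl z <= n%:R * `|x - z|)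
  (dl_gt0 : forall z, f z != 0 -> 0 < dl z) (mdl : measurable_fun setT dl).

Definition riesz_const : R := tail_const c d (n%:R - 1 - d) * n%:R `^ (n%:R - 1 - d).

(** After Tonelli, for fixed z all points of G satisfy |x - z| >= dl z / n, so the integral over x
    is a tail with a = n - 1 - d at t = dl z / n. It produces the weight, and the division by n
    produces the second factor of [riesz_const]. *)
Lemma integral_riesz_energy : (\int[sg]_x riesz_energy x <=
  riesz_const%:E * \int[leb]_z (f z ^+ 2 * dl z `^ (d + 1 - n%:R))%:E)%E.
Proof.
have a0 : 0 < n%:R - 1 - d by rewrite subr_gt0.
have T0 := tail_const_ge0 d c_ge0 a0.
rewrite /riesz_energy (fubini_tonelli _ mriesz) => [|p]; last exact: riesz0.
have mw : measurable_fun setT (fun z => (f z ^+ 2 * dl z `^ (d + 1 - n%:R))%:E).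
  apply: measurable_EFin; apply: measurable_funM; first exact: mf2.
  exact: (measurableT_comp (measurable_powR _) mdl).
rewrite -ge0_integralZl//; last 2 first.
- by move=> z _; rewrite lee_fin mulr_ge0 ?sqr_ge0 ?powR_ge0.
- by rewrite lee_fin mulr_ge0 ?powR_ge0.
apply: ge0_le_integral => //.
- by move=> z _; apply: integral_ge0 => x _; exact: riesz0.
- by apply: (measurable_fun_fubini_tonelli_G _ mriesz) => p; exact: riesz0.
- by apply: measurable_funeM.
move=> z _ /=.
have [fz|fz] := eqVneq (f z) 0.
  rewrite fz expr0n/= mul0r mule0 integral0_eq// => x _.
  by rewrite mul0r.
have mk D : measurable D ->
    measurable_fun D (fun x => (`|x - z| `^ (1 - n%:R))%:E).
  move=> mD; apply: measurable_funTS; apply: measurable_EFin.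
  have m1 : measurable_fun setT (fun x : 'rV[R]_n => `|x - z|).
    exact: (measurableT_comp mdist (pair2_measurable z)).
  exact: (measurableT_comp (measurable_powR _) m1).
under eq_integral do rewrite EFinM.
rewrite ge0_integralZl ?lee_fin ?sqr_ge0//; last exact: mk.
rewrite [X in (_ <= _ * X)%E]EFinM muleCA lee_wpmul2l ?lee_fin ?sqr_ge0//.
pose t := dl z / n%:R; have t0 : 0 < t by rewrite divr_gt0// dl_gt0.
pose S := [set x | t <= `|z - x|].
have mS : measurable S.
  rewrite (_ : S = (fun x => `|z - x|) @^-1` `[t, +oo[); last first.
    by apply/seteqP; split => x; rewrite /S /= in_itv/= andbT.
  by rewrite -[X in measurable X]setTI; exact: (measurable_norm_sub z).
have kE x : `|x - z| `^ (1 - n%:R) = `|z - x| `^ (- (d + (n%:R - 1 - d))).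
  by rewrite distrC; congr (_ `^ _); lra.
apply: (@le_trans _ _ (\int[sg]_(x in S) (`|z - x| `^ (- (d + (n%:R - 1 - d))))%:E)%E).
  rewrite [leRHS]integral_mkcond; apply: ae_ge0_le_integral => //.
  - exact: mk.
  - by move=> x _; rewrite erestrict_ge0// => y _; rewrite lee_fin powR_ge0.
  - apply/(measurable_restrictT _ mS) => //.
    by under eq_fun do rewrite -kE; exact: mk.
  - apply: filterS ae_G => x Gx _; rewrite kE patchE ifT// inE /S /= /t.
    by rewrite ler_pdivrMr// mulrC distrC dl_le.
apply: (le_trans (tail_integral c_ge0 (ltW d_gt0) a0 sg_ball z t0)).
rewrite -EFinM lee_fin /riesz_const -(mulrA (tail_const _ _ _)) ler_wpM2l//.
rewrite /t powRM ?invr_ge0 ?(ltW (dl_gt0 fz)) ?(ltW n0)// mulrC.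
have -> : d + 1 - n%:R = - (n%:R - 1 - d) by lra.
rewrite ler_wpM2r ?powR_ge0//.
by rewrite -powR_inv1 ?(ltW n0)// -powRrM mulN1r opprK.
Qed.

End weighted.

(** With s = 2 |x - y|, dividing the factor s^(1/2) of the trace estimate by |x - y|^(d + 1) leaves
    s^-(d + 1/2) up to a constant. The energy at y is accounted for by exchanging the arguments. *)
Definition interaction x y : \bar R :=
  (((2 * enorm (x - y)) `^ (- (d + 1 / 2)))%:E * energy_near f x (2 * enorm (x - y)))%E.

(** Writing the condition |x - z| < 2 |x - y| through this indicator gives a single kernel in (x, y,
    z), measurable jointly, to which Tonelli applies. *)
Let pos (t : R) : R := \1_(`]0, +oo[%classic : set R) t.

Let posE (t : R) : pos t = (0 < t)%R%:R.
Proof. by rewrite /pos indicE mem_setE in_itv/= andbT. Qed.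

Let ker (p : ('rV[R]_n * 'rV[R]_n) * 'rV[R]_n) : \bar R :=
  ((2 * enorm (p.1.1 - p.1.2)) `^ (- (d + 1 / 2)) *
   (pos (2 * enorm (p.1.1 - p.1.2) - `|p.1.1 - p.2|) *
    (f p.2 ^+ 2 * `|p.1.1 - p.2| `^ (3 / 2 - n%:R))))%:E.

Let ker_ge0 p : (0 <= ker p)%E.
Proof.
rewrite /ker posE lee_fin mulr_ge0 ?powR_ge0// mulr_ge0// mulr_ge0 ?sqr_ge0//.
Qed.

Let mker : measurable_fun setT ker.
Proof.
have m1 : measurable_fun setT
    (fun p : ('rV[R]_n * 'rV[R]_n) * 'rV[R]_n => `|p.1.1 - p.2|).
  have mp : measurable_fun setT
      (fun p : ('rV[R]_n * 'rV[R]_n) * 'rV[R]_n => (p.1.1, p.2)).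
    apply: measurable_fun_pair => //.
    exact: (measurableT_comp measurable_fst measurable_fst).
  exact: (measurableT_comp mdist mp).
have m2 : measurable_fun setT
    (fun p : ('rV[R]_n * 'rV[R]_n) * 'rV[R]_n => 2 * enorm (p.1.1 - p.1.2)).
  apply: measurable_funM => //.
  apply: (measurableT_comp (measurableT_comp (@measurable_enorm R n) (@measurable_rVB R n))).
  exact: measurable_fst.
apply: measurable_EFin; apply: measurable_funM.
  exact: (measurableT_comp (measurable_powR _) m2).
apply: measurable_funM.
  have mp : measurable_fun setT pos by exact: measurable_indic.
  by apply: (measurableT_comp mp); exact: measurable_funB.
apply: measurable_funM; first exact: mf2.
exact: (measurableT_comp (measurable_powR _) m1).
Qed.

Let interactionE x y : interaction x y = (\int[leb]_z ker ((x, y), z))%E.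
Proof.
rewrite /interaction /energy_near -ge0_integralZl ?lee_fin ?powR_ge0//; last 3 first.
- exact: measurable_ball_rV.
- apply: measurable_funTS; apply: measurable_EFin; apply: measurable_funM; first exact: mf2.
  exact: (measurableT_comp (measurable_powR _) (measurable_norm_sub x)).
- by move=> z _; rewrite lee_fin mulr_ge0 ?sqr_ge0 ?powR_ge0.
rewrite integral_mkcond; apply: eq_integral => z _.
rewrite patchE /ker /= posE subr_gt0; case: ifPn => [|/negP] zB.
  move: zB; rewrite inE => /ball_rVE ->.
  by rewrite -EFinM; congr ((_ * _)%:E); rewrite mul1r.
case: ltP => [/ball_rVE H|_]; first by exfalso; apply: zB; rewrite inE.
by rewrite mul0r mulr0.
Qed.

Lemma interaction_ge0 x y : (0 <= interaction x y)%E.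
Proof. by rewrite interactionE; apply: integral_ge0 => z _; exact: ker_ge0. Qed.

Lemma measurable_interaction :
  measurable_fun setT (fun p : 'rV[R]_n * 'rV[R]_n => interaction p.1 p.2).
Proof.
under eq_fun do rewrite interactionE.
rewrite (_ : (fun _ => _) = fubini_F leb ker).
  exact: measurable_fun_fubini_tonelli_F mker ker_ge0.
by apply/funext => -[x y].
Qed.

Definition interaction_const : R := tail_const c d (1 / 2) * (2 * n%:R) `^ (1 / 2).

(** For fixed z only those y count with 2 |x - y| > |x - z|, hence with sup-norm distance at least
    |x - z| / (2 n) from x. The tail with a = 1/2 gives |x - z|^(-1/2), which lowers the exponent
    3/2 - n of the energy to 1 - n. *)
Lemma integral_interaction x :
  (\int[sg]_y interaction x y <= interaction_const%:E * riesz_energy x)%E.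
Proof.
have a0 : 0 < 1 / 2 :> R by lra.
have T0 := tail_const_ge0 d c_ge0 a0.
have mx : measurable_fun setT (fun q : 'rV[R]_n * 'rV[R]_n => ker ((x, q.1), q.2)).
  apply: (measurableT_comp mker); apply: measurable_fun_pair => //.
  by apply: (measurableT_comp (pair1_measurable x)).
under eq_integral do rewrite interactionE.
rewrite (fubini_tonelli (fun q : 'rV[R]_n * 'rV[R]_n => ker ((x, q.1), q.2)))//.
have mr : measurable_fun setT (fun z => (f z ^+ 2 * `|x - z| `^ (1 - n%:R))%:E).
  exact: (measurableT_comp mriesz (pair1_measurable x)).
rewrite /riesz_energy -ge0_integralZl//; last by rewrite lee_fin mulr_ge0 ?powR_ge0.
apply: ge0_le_integral => //.
- by move=> z _; apply: integral_ge0 => y _; exact: ker_ge0.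
- by apply: (measurable_fun_fubini_tonelli_G _ mx) => q; exact: ker_ge0.
- by apply: measurable_funeM.
move=> z _ /=.
have [<-|zx] := eqVneq x z.
  have h1 : `|x - x| `^ (1 - n%:R) = 0 by rewrite subrr normr0 powR0//; move: n2; lra.
  have h2 : `|x - x| `^ (3 / 2 - n%:R) = 0 by rewrite subrr normr0 powR0//; move: n2; lra.
  by rewrite h1 mulr0 mule0 integral0_eq// => y _; rewrite /ker /= h2 !mulr0.
pose t := `|x - z|; have t0 : 0 < t by rewrite normr_gt0 subr_eq0.
pose S := [set y | t / (2 * n%:R) <= `|x - y|].
have s0 : 0 < t / (2 * n%:R) by rewrite divr_gt0// mulr_gt0.
have mS : measurable S.
  rewrite (_ : S = (fun y => `|x - y|) @^-1` `[t / (2 * n%:R), +oo[); last first.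
    by apply/seteqP; split => y; rewrite /S /= in_itv/= andbT.
  by rewrite -[X in measurable X]setTI; exact: (measurable_norm_sub x).
have mk D : measurable D -> measurable_fun D (fun y => (`|x - y| `^ (- (d + 1 / 2)))%:E).
  move=> mD; apply: measurable_funTS; apply: measurable_EFin.
  exact: (measurableT_comp (measurable_powR _) (measurable_norm_sub x)).
pose F := f z ^+ 2 * t `^ (3 / 2 - n%:R).
have F0 : 0 <= F by rewrite mulr_ge0 ?sqr_ge0 ?powR_ge0.
apply: (@le_trans _ _ (\int[sg]_(y in S) (F%:E * (`|x - y| `^ (- (d + 1 / 2)))%:E))%E).
  rewrite [leRHS]integral_mkcond; apply: ge0_le_integral.
  - exact: measurableT.
  - by move=> y _; exact: ker_ge0.
  - exact: (measurableT_comp mx (pair2_measurable z)).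
  - apply/(measurable_restrictT _ mS) => //.
    by apply: measurable_funeM; exact: mk.
  move=> y _; rewrite /ker /= posE subr_gt0 -/t -/F.
  have [ty|ty] := ltP t (2 * enorm (x - y)); last first.
    rewrite mul0r mulr0; apply: erestrict_ge0 => y' _.
    by rewrite -EFinM lee_fin mulr_ge0// powR_ge0.
  have xy : t <= 2 * n%:R * `|x - y|.
    by apply: ltW; apply: lt_le_trans ty _; rewrite -mulrA ler_pM2l// enorm_le.
  rewrite patchE ifT; last by rewrite inE /S /= ler_pdivrMr ?mulr_gt0// mulrC.
  rewrite -EFinM lee_fin [true%:R * F]mul1r [leLHS]mulrC ler_wpM2l//.
  have xy0 : 0 < `|x - y|.
    have := lt_le_trans t0 xy; rewrite pmulr_rgt0//; exact: mulr_gt0.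
  have xye : `|x - y| <= 2 * enorm (x - y).
    by have := ler_norm_enorm (x - y); have := enorm_ge0 (x - y); lra.
  rewrite !powRN lef_pV2 ?posrE ?powR_gt0//; last exact: lt_le_trans xye.
  have e0 : 0 <= d + 1 / 2 by rewrite addr_ge0 ?(ltW d_gt0)// ltW.
  by apply: ge0_ler_powR; rewrite ?nnegrE// mulr_ge0// enorm_ge0.
rewrite ge0_integralZl//; last exact: mk.
apply: le_trans (lee_wpmul2l _ (tail_integral c_ge0 (ltW d_gt0) a0 sg_ball x s0)) _.
  by rewrite lee_fin.
rewrite -!EFinM lee_fin /F /interaction_const.
have tE : t `^ (1 - n%:R) = t `^ (3 / 2 - n%:R) * t `^ (- (1 / 2)).
  by rewrite -powRD ?(gt_eqF t0) ?implybT//; congr (_ `^ _); lra.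
have nE : (2 * n%:R)^-1 `^ (- (1 / 2)) = (2 * n%:R) `^ (1 / 2) :> R.
  by rewrite -powR_inv1 ?mulr_ge0 ?ltW// -powRrM mulN1r opprK.
have n2' : 0 <= 2 * n%:R :> R by rewrite mulr_ge0.
have sE : (t / (2 * n%:R)) `^ (- (1 / 2)) = t `^ (- (1 / 2)) * (2 * n%:R) `^ (1 / 2).
  by rewrite -nE -powRM ?(ltW t0) ?invr_ge0.
rewrite -/t tE sE.
by rewrite [leLHS](_ : _ = tail_const c d (1 / 2) * (2 * n%:R) `^ (1 / 2) *
  (f z ^+ 2 * (t `^ (3 / 2 - n%:R) * t `^ (- (1 / 2)))))//; ring.
Qed.

End energy_integrals.

Section double_integral.
Context d (T : measurableType d) (R : realType)
  (mu : {sigma_finite_measure set T -> \bar R}).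
Local Open Scope ereal_scope.
Variables (G : set T) (h k : T * T -> \bar R) (A K : R) (I : \bar R) (P : set T).
Hypotheses (mG : measurable G) (h0 : forall p, 0 <= h p) (mh : measurable_fun setT h)
  (mk : measurable_fun setT k) (k0 : forall p, 0 <= k p) (A0 : (0 <= A)%R)
  (aeP : {ae mu, forall x, P x})
  (hk : forall x y, P x -> P y -> h (x, y) <= A%:E * (k (x, y) + k (y, x))).

(** Tonelli exchanges the variables in the term k (y, x), so both terms have the same integral;
    hence the 2. The pointwise bound is used for almost every x, then for almost every y. *)
Lemma le_double_integral_sym : (0 <= K)%R -> \int[mu]_x \int[mu]_y k (x, y) <= K%:E * I ->
  \int[mu]_(x in G) \int[mu]_(y in G) h (x, y) <= (A * (2 * K))%:E * I.
Proof.
move=> K0 kI.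
have mk' : measurable_fun setT (fun p => k (p.2, p.1)).
  exact: (measurableT_comp mk (measurable_fun_pair measurable_snd measurable_fst)).
pose s p := k p + k (p.2, p.1).
have ms : measurable_fun setT s by exact: emeasurable_funD.
have s0 p : 0 <= s p by rewrite adde_ge0.
have mF f : measurable_fun setT f -> (forall p, 0 <= f p) ->
    measurable_fun setT (fun x : T => \int[mu]_y f (x, y)).
  by move=> mf f0; exact: (measurable_fun_fubini_tonelli_F f mf f0).
have F0 (f : T * T -> \bar R) : (forall p, 0 <= f p) -> forall x, 0 <= \int[mu]_y f (x, y).
  by move=> f0 x; exact: integral_ge0.
have mf1 (f : T * T -> \bar R) : measurable_fun setT f -> forall x, measurable_fun setT (fun y => f (x, y)).
  by move=> mf x; exact: (measurableT_comp mf (pair1_measurable x)).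
apply: (@le_trans _ _ (\int[mu]_x \int[mu]_y h (x, y))).
  have mhG : measurable_fun setT (fun x : T => \int[mu]_(y in G) h (x, y)).
    have mTG : measurable ([set: T] `*` G) by exact: measurableX.
    have mh2 : measurable_fun setT (h \_ ([set: T] `*` G)).
      by apply/(measurable_restrictT _ mTG); exact: measurable_funTS.
    have -> : (fun x : T => \int[mu]_(y in G) h (x, y)) =
        (fun x : T => \int[mu]_y (h \_ ([set: T] `*` G)) (x, y)).
      apply/funext => x; rewrite integral_mkcond; apply: eq_integral => y _.
      by rewrite !patchE in_setX in_setT.
    by apply: mF mh2 _ => p; rewrite erestrict_ge0.
  apply: (@le_trans _ _ (\int[mu]_(x in G) \int[mu]_y h (x, y))).
    apply: ge0_le_integral => //.
    - by move=> x _; exact: integral_ge0.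
    - exact: measurable_funTS.
    - by apply: measurable_funTS; exact: mF.
    - by move=> x _; apply: ge0_subset_integral => //; exact: mf1.
  apply: ge0_subset_integral => //; first exact: mF.
  by move=> x _; exact: F0.
apply: (@le_trans _ _ (\int[mu]_x (A%:E * \int[mu]_y s (x, y)))).
  apply: ae_ge0_le_integral => //.
  - by move=> x _; exact: F0.
  - exact: mF.
  - by move=> x _; rewrite mule_ge0 ?lee_fin// F0.
  - by apply: measurable_funeM; exact: mF.
  apply: filterS aeP => x Px _; rewrite -ge0_integralZl//; last exact: mf1.
  apply: ae_ge0_le_integral => //.
  - exact: mf1.
  - by move=> y _; rewrite mule_ge0 ?lee_fin.
  - by apply: measurable_funeM; exact: mf1.
  by apply: filterS aeP => y Py _; exact: hk.
rewrite ge0_integralZl//; last 2 first.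
- exact: mF.
- by move=> x _; exact: F0.
rewrite EFinM -muleA lee_wpmul2l ?lee_fin//.
have -> : \int[mu]_x \int[mu]_y s (x, y) =
    \int[mu]_x \int[mu]_y k (x, y) + \int[mu]_x \int[mu]_y k (x, y).
  transitivity (\int[mu]_x (\int[mu]_y k (x, y) + \int[mu]_y k (y, x))).
    apply: eq_integral => x _; rewrite /s ge0_integralD//; first exact: mf1.
    exact: (mf1 _ mk').
  rewrite (ge0_integralD mu measurableT (fun x _ => F0 k k0 x) (mF k mk k0)
    (fun x _ => F0 _ (fun p => k0 (p.2, p.1)) x) (mF _ mk' (fun p => k0 (p.2, p.1)))).
  by congr (_ + _); rewrite (fubini_tonelli (fun p => k (p.2, p.1)) mk').
have -> : ((2 * K)%:E = K%:E + K%:E)%E by rewrite -EFinD; congr EFin; ring.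
by rewrite ge0_muleDl ?lee_fin// leeD.
Qed.

End double_integral.

Section pair_energy.
Variables (R : realType) (n : nat) (c d : R) (f : 'rV[R]_n -> R)
  (sg : {sigma_finite_measure set 'rV[R]_n -> \bar R}).
Local Notation leb := (lebesgue_rV R n).
Hypotheses (n_gt1 : (1 < n)%N) (c_ge0 : 0 <= c) (d_gt0 : 0 < d) (d_lt : d < n%:R - 1)
  (sg_ball : forall (p : 'rV[R]_n) r, 0 < r -> (sg (ball p r) <= (c * r `^ d)%:E)%E)
  (mf : measurable_fun setT f).
Variables (G : set 'rV[R]_n) (dl : 'rV[R]_n -> R).
Hypotheses (mG : measurable G) (ae_G : {ae sg, forall x, G x})
  (dl_le : forall z x, G x -> dl z <= n%:R * `|x - z|)
  (dl_gt0 : forall z, f z != 0 -> 0 < dl z) (mdl : measurable_fun setT dl).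

Lemma double_integral_pair (g : 'rV[R]_n -> R) (A : R) (P : set 'rV[R]_n) :
  measurable_fun setT g -> 0 <= A -> {ae sg, forall x, P x} ->
  (forall x y, P x -> P y -> ((`|g x - g y| ^+ 2 / enorm (x - y) `^ (d + 1))%:E <=
    A%:E * (interaction d f x y + interaction d f y x))%E) ->
  (\int[sg]_(x in G) \int[sg]_(y in G) (`|g x - g y| ^+ 2 / enorm (x - y) `^ (d + 1))%:E <=
    (A * (2 * (interaction_const n c d * riesz_const n c d)))%:E *
      \int[leb]_z (f z ^+ 2 * dl z `^ (d + 1 - n%:R))%:E)%E.
Proof.
move=> mg A0 aeP H.
pose h (p : 'rV[R]_n * 'rV[R]_n) := (`|g p.1 - g p.2| ^+ 2 / enorm (p.1 - p.2) `^ (d + 1))%:E.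
have h0 p : (0 <= h p)%E by rewrite lee_fin divr_ge0 ?sqr_ge0 ?powR_ge0.
have mh : measurable_fun setT h.
  apply: measurable_EFin; under eq_fun do rewrite -powRN; apply: measurable_funM.
    apply: measurable_funX; apply: measurableT_comp => //; apply: measurable_funB.
      exact: (measurableT_comp mg measurable_fst).
    exact: (measurableT_comp mg measurable_snd).
  exact: (measurableT_comp (measurable_powR _) (measurableT_comp (@measurable_enorm R n) (@measurable_rVB R n))).
have T0 : 0 <= interaction_const n c d.
  by rewrite mulr_ge0 ?powR_ge0// tail_const_ge0//; lra.
apply: (le_double_integral_sym mG h0 mh (measurable_interaction d mf)
  (fun p => interaction_ge0 d mf p.1 p.2) A0 aeP H).
  by rewrite mulr_ge0// mulr_ge0 ?powR_ge0// tail_const_ge0// subr_gt0.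
apply: (@le_trans _ _ (\int[sg]_x ((interaction_const n c d)%:E * riesz_energy f x))%E).
  apply: ge0_le_integral.
  - exact: measurableT.
  - by move=> x _; apply: integral_ge0 => y _; exact: (interaction_ge0 d mf).
  - exact: (measurable_fun_fubini_tonelli_F _ (measurable_interaction d mf)
      (fun p => interaction_ge0 d mf p.1 p.2)).
  - by apply: measurable_funeM; exact: measurable_riesz_energy.
  - by move=> x _; exact: (integral_interaction n_gt1 c_ge0 d_gt0 sg_ball mf).
rewrite ge0_integralZl//; last 2 first.
- exact: measurable_riesz_energy.
- by move=> x _; exact: riesz_energy_ge0.
rewrite [(interaction_const _ _ _ * _)%:E]EFinM -muleA lee_wpmul2l ?lee_fin//.
exact: (integral_riesz_energy n_gt1 c_ge0 d_gt0 d_lt sg_ball mf ae_G dl_le dl_gt0 mdl).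
Qed.

End pair_energy.

Section delta_measurable.
Variables (R : realType) (n : nat) (G : set 'rV[R]_n).

Lemma continuous_enorm : continuous (@enorm R n).
Proof.
move=> v; apply: (@continuous_comp _ _ _ (fun v : 'rV[R]_n => \sum_(i < n) v ord0 i ^+ 2));
  last exact: sqrt_continuous.
have H : continuous (fun v : 'rV[R]_n => \sum_(i < n) v ord0 i ^+ 2).
  apply: continuous_big => [|i _]; first exact: add_continuous.
  have c (w : 'rV[R]_n) : {for w, continuous (fun v : 'rV[R]_n => v ord0 i ^+ 2)}.
    apply: (@continuous_comp _ _ _ (fun v : 'rV[R]_n => v ord0 i) (fun t : R => t ^+ 2)).
      exact: coord_continuous.
    exact: exprn_continuous.
  exact: c.
exact: H.
Qed.

Lemma open_delta_lt (a : R) : G !=set0 -> open [set z | delta G z < a].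
Proof.
move=> [x0 Gx0].
have -> : [set z | delta G z < a] = \bigcup_(x in G) [set z | enorm (z - x) < a].
  apply/seteqP; split => z /=; last first.
    by move=> [x Gx]; apply: le_lt_trans; exact: delta_le.
  move=> /inf_lt[|_ [x Gx <-] xa]; last by exists x.
  by exists (enorm (z - x0)); exists x0.
apply: bigcup_open => x _.
rewrite (_ : [set _ | _] = (fun z => enorm (z - x)) @^-1` [set t | t < a])//.
apply: open_comp; last exact: open_lt.
move=> z _; apply: (@continuous_comp _ _ _ (fun z : 'rV[R]_n => z - x)).
  by apply: continuousB; [exact: cvg_id|exact: cst_continuous].
exact: continuous_enorm.
Qed.

Lemma measurable_delta : measurable_fun setT (delta G).
Proof.
have [->|/set0P G0] := eqVneq G set0.
  rewrite (_ : delta set0 = cst 0); first exact: measurable_cst.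
  by apply/funext => z; rewrite /delta image_set0 inf0.
apply: (@measurability _ _ _ _ _ _ _ (RGenInftyO.measurableE R)).
move=> _ [_ [a ->] <-]; rewrite setTI.
rewrite (_ : _ @^-1` _ = [set z | delta G z < a]).
  by apply: open_measurable_rV; exact: open_delta_lt.
by apply/seteqP; split => z /=; rewrite in_itv.
Qed.

End delta_measurable.

(** * The trace operator *)

Section ball_average.
Variables (R : realType) (n : nat).
Local Notation leb := (lebesgue_rV R n).
Implicit Types (u v : 'rV[R]_n -> R) (x : 'rV[R]_n).

Lemma lebesgue_eball_translate x r : leb (eball x r) = leb (eball 0 r).
Proof.
rewrite -(lebesgue_rV_translate (- x) (measurable_eball 0 r)); congr (leb _).
by apply/seteqP; split => y; rewrite /eball /= sub0r opprB.
Qed.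

(** By translation invariance the measure of the ball does not depend on x. As [u] need not be
    integrable, Tonelli is applied separately to the positive and negative parts of the joint
    kernel. *)
Lemma measurable_ball_average u r : measurable_fun setT u ->
  measurable_fun setT (fun x => ball_average u x r).
Proof.
move=> mu_u; rewrite /ball_average.
under eq_fun do rewrite lebesgue_eball_translate.
apply: measurable_funeM.
pose k (p : 'rV[R]_n * 'rV[R]_n) :=
  (u p.2 * (\1_(`]-oo, r[%classic : set R) (enorm (p.1 - p.2))))%:E.
have mk : measurable_fun setT k.
  apply: measurable_EFin; apply: measurable_funM.
    exact: (measurableT_comp mu_u measurable_snd).
  have m1 : measurable_fun setT (\1_(`]-oo, r[%classic : set R) : R -> R).
    exact: measurable_indic.
  exact: (measurableT_comp m1 (measurableT_comp (@measurable_enorm R n) (@measurable_rVB R n))).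
have mF (h : 'rV[R]_n * 'rV[R]_n -> \bar R) : measurable_fun setT h -> (forall p, (0 <= h p)%E) ->
    measurable_fun setT (fun x => \int[leb]_y h (x, y))%E.
  by move=> mh h0; exact: (measurable_fun_fubini_tonelli_F h mh h0).
rewrite (_ : (fun _ => _) =
  (fun x => \int[leb]_y (k^\+ (x, y)) - \int[leb]_y (k^\- (x, y)))%E).
  apply: emeasurable_funB; apply: mF => //.
    exact: measurable_funepos.
  exact: measurable_funeneg.
apply/funext => x; rewrite integral_mkcond.
transitivity (\int[leb]_y k (x, y))%E; last first.
  rewrite [LHS]integralE; congr (_ - _)%E; apply: eq_integral => y _.
    by rewrite !funeposE.
  by rewrite !funenegE.
apply: eq_integral => y _; rewrite patchE /k /= indicE.
have -> : (y \in eball x r) = (enorm (x - y) \in (`]-oo, r[%classic : set R)).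
  by apply/idP/idP => /set_mem H; apply/mem_set; move: H; rewrite /eball/= in_itv.
by case: ifP; rewrite ?mulr1 ?mulr0.
Qed.

Lemma ball_average_lin a u v x r : 0 < r -> (0 < n)%N ->
  leb.-integrable (eball x r) (EFin \o u) -> leb.-integrable (eball x r) (EFin \o v) ->
  ball_average (fun z => a * u z + v z) x r =
    (a%:E * ball_average u x r + ball_average v x r)%E.
Proof.
move=> r0 n0 iu iv; have mE := measurable_eball x r.
have [b rb Eb] := lebesgue_eball x n0 r0.
have b0 : 0 < b by apply: lt_le_trans rb; rewrite exprn_gt0// divr_gt0 ?mulr_gt0// ltr0n.
have iau : leb.-integrable (eball x r) (fun z => a%:E * (u z)%:E)%E by exact: integrableZl.
have E : (\int[leb]_(y in eball x r) (a * u y + v y)%:E =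
    a%:E * \int[leb]_(y in eball x r) (u y)%:E + \int[leb]_(y in eball x r) (v y)%:E)%E.
  rewrite -integralZl// -integralD//.
have fu := integrable_fin_num mE iu; have fv := integrable_fin_num mE iv.
rewrite /ball_average E Eb inver gt_eqF// -(fineK fu) -(fineK fv).
by rewrite -!EFinM -?EFinD -?EFinM; congr EFin; ring.
Qed.

End ball_average.

Lemma cvg_dyadic (R : realType) (g : R -> R) l : g r @[r --> 0^'+] --> l ->
  (g (2^-1 ^+ k))%:E @[k --> \oo] --> l%:E.
Proof.
move=> /cvg_at_rightP gl; apply: cvg_EFin; first by apply: nearW.
apply: gl; split => [k|]; first by rewrite exprn_gt0.
apply: cvg_expr; rewrite ger0_norm//; lra.
Qed.

Section trace.
Variables (R : realType) (n : nat) (d : R) (G : set 'rV[R]_n).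
Hypotheses (n_ge2 : (2 <= n)%N) (d_gt0 : 0 < d) (d_lt : d < n%:R - 1)
  (G_neq0 : G !=set0) (G_closed : closed G) (G_regular : ahlfors_regular d G).
Local Notation leb := (lebesgue_rV R n).
Local Notation O := (Omega G).
Implicit Types (u v : 'rV[R]_n -> R) (x y z : 'rV[R]_n).

(** The upper limit along the radii 2^-k is defined at every x and is Borel in x because the
    averages are. It equals the limit wherever the averages converge, and it depends on u only
    through them. *)
Definition trace u x : R := fine (limn_esup (fun k => ball_average u x (2^-1 ^+ k))).

Let n0 : (0 < n)%N. Proof. exact: leq_trans n_ge2. Qed.

Let mG : measurable G. Proof. exact: measurable_closed_rV. Qed.

(** G is Lebesgue-null, so the values there do not count, even where they make u or v
    non-measurable. *)
Lemma eq_ball_average u v x r : {ae leb, forall z, O z -> u z = v z} ->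
  ball_average u x r = ball_average v x r.
Proof.
move=> [N [mN N0 uvN]]; congr (_ * _)%E.
have mNG : measurable (N `|` G) by exact: measurableU.
have NG0 : leb (N `|` G) = 0%E.
  apply/eqP; rewrite -measure_le0 (le_trans (measureU2 _ _ _))//.
  have {}N0 : (leb N <= 0)%E by rewrite N0.
  have G0 := lebesgue_ahlfors0 d_gt0 d_lt G_closed G_regular n0.
  have {}G0 : (leb G <= 0)%E by rewrite G0.
  by rewrite -[leRHS]adde0; exact: leeD.
apply: (eq_integral_off_null mNG NG0) => z _ /not_orP[Nz Gz]; congr EFin.
by apply: contrapT => uv; apply: Nz; apply: uvN => /(_ Gz).
Qed.

Lemma ball_average_extend0 u x r : ball_average u x r = ball_average (extend0 G u) x r.
Proof. by apply: eq_ball_average; apply: aeW => z Oz; rewrite extend0E. Qed.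

Definition grad_norm u := extend0 G (fun x => enorm (grad O u x)).

(** This is the w of [oscillates_less]: a square root, because the Cauchy-Schwarz step bounds the
    oscillation by r^(1/4) times the root of the energy. *)
Definition trace_scale u x r : R := Num.sqrt (fine (energy_near (grad_norm u) x r)).

Definition trace_good u : set 'rV[R]_n :=
  [set x | G x /\ (riesz_energy (grad_norm u) x < +oo)%E].

Let C1 : R := n%:R * 2 * 8 ^+ n.

Let C1_ge0 : 0 <= C1. Proof. by rewrite !mulr_ge0// exprn_ge0. Qed.

Section trace_of.
Variable u : 'rV[R]_n -> R.
Hypothesis Wu : W_space d G u.
Local Notation f := (grad_norm u).

Let weak_grad : weak_gradient O u (grad O u).
Proof. by have [_ wF _] := Wu; exact: (xgetPex (fun=> 0) wF). Qed.

Lemma measurable_extend0_W : measurable_fun setT (extend0 G u).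
Proof. by have [[mu_u _ _] _ _] := Wu; exact: measurable_extend0. Qed.

Let mu0 := measurable_extend0_W.

Let mf : measurable_fun setT f.
Proof. exact: measurable_grad_norm weak_grad. Qed.

Let f_ge0 x : 0 <= f x. Proof. by rewrite mulr_ge0 ?enorm_ge0. Qed.

Let poincare x0 r : 0 < r ->
  (\int[leb]_(y in ball x0 r) \int[leb]_(z in ball x0 r) (`|extend0 G u z - extend0 G u y|)%:E <=
   (n%:R * (2 * r) * (4 * r) ^+ n)%:E * \int[leb]_(y in ball x0 r) (f y)%:E)%E.
Proof.
have [lu _ _] := Wu; apply: (poincare_ball mu0 mf f_ge0) => i s.
exact: (sobolev_line_bound d_gt0 d_lt G_closed G_regular lu weak_grad).
Qed.

Let energy_fin x r : trace_good u x -> energy_near f x r \is a fin_num.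
Proof.
move=> [_ rx]; rewrite ge0_fin_numE; last exact: energy_near_ge0.
(* The scale has to be monotone on all real radii, so r may be nonpositive here. *)
have r1 : 0 < Num.max r 1 by rewrite lt_max ltr01 orbT.
apply: (@le_lt_trans _ _ (energy_near f x (Num.max r 1))).
  by apply: le_energy_near => //; rewrite le_max lexx.
apply: (le_lt_trans (energy_near_riesz n_ge2 mf x r1)).
by rewrite lte_mul_pinfty ?lee_fin ?powR_ge0.
Qed.

Lemma trace_scaleE x r : trace_good u x ->
  ((trace_scale u x r ^+ 2)%:E = energy_near f x r)%E.
Proof.
move=> gx; rewrite sqr_sqrtr; last by rewrite fine_ge0// energy_near_ge0.
by rewrite fineK// energy_fin.
Qed.

Lemma trace_oscillates x : trace_good u x ->
  oscillates_less (extend0 G u) C1 x (trace_scale u x).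
Proof.
move=> gx; split => [r|r s rs|r r0]; first exact: sqrtr_ge0.
  apply: ler_wsqrtr; apply: fine_le; [exact: energy_fin|exact: energy_fin|].
  exact: le_energy_near.
apply: (oscillation_energy n_ge2 mf f_ge0 poincare) => //.
(* The point x lies in G, where the gradient is extended by 0. *)
- by rewrite /f /grad_norm /extend0 indicE memNset ?mulr0//; have [Gx _] := gx; exact.
- exact: sqrtr_ge0.
- by rewrite trace_scaleE.
Qed.

Let ball_average_avg x r : trace_good u x -> 0 < r ->
  ball_average u x r = (avg (extend0 G u) x r)%:E.
Proof.
move=> gx r0; rewrite ball_average_extend0.
exact: (ball_averageE n0 mu0 (trace_oscillates gx) r0).
Qed.

Lemma trace_avg x : trace_good u x ->
  (forall r, 0 < r -> `|trace u x - avg (extend0 G u) x r| <=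
    avg_const n C1 * (r `^ (1 / 4) * trace_scale u x r)) /\
  avg (extend0 G u) x r @[r --> 0^'+] --> trace u x.
Proof.
move=> gx; have [L [HL cL]] := cvg_avg n0 mu0 C1_ge0 (trace_oscillates gx).
suff -> : trace u x = L by [].
have H : ball_average u x (2^-1 ^+ k) @[k --> \oo] --> L%:E.
  have -> : (fun k => ball_average u x (2^-1 ^+ k)) =
      (fun k => (avg (extend0 G u) x (2^-1 ^+ k))%:E).
    by apply/funext => k; rewrite ball_average_avg// exprn_gt0.
  exact: cvg_dyadic.
by rewrite /trace (cvg_limn_einf_sup H).2.
Qed.

Lemma cvg_trace x : trace_good u x ->
  ball_average u x r @[r --> 0^'+] --> (trace u x)%:E.
Proof.
move=> gx; have [_ cL] := trace_avg gx.
have E : {near 0^'+, (fun r => (avg (extend0 G u) x r)%:E) =1 ball_average u x}.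
  by near=> r; rewrite ball_average_avg//; near: r; exact: nbhs_right_gt.
apply: cvg_trans (near_eq_cvg E) _.
by apply: cvg_EFin => //; apply: nearW.
Unshelve. all: by end_near. Qed.

Lemma cvg_trace_dist x : trace_good u x ->
  ball_average (fun y => `|u y - trace u x|) x r @[r --> 0^'+] --> 0%E.
Proof.
move=> gx; have [HL _] := trace_avg gx.
have -> : ball_average (fun y => `|u y - trace u x|) x =
    ball_average (fun y => `|extend0 G u y - trace u x|) x.
  by apply/funext => r; apply: eq_ball_average; apply: aeW => z Oz; rewrite extend0E.
exact: (cvg_ball_average_dist n0 mu0 C1_ge0 (trace_oscillates gx) HL).
Qed.

Lemma measurable_trace : measurable_fun setT (trace u).
Proof.
apply: (measurableT_comp (fine_measurable measurableT)).
apply: measurable_fun_limn_esup => k.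
under eq_fun do rewrite ball_average_extend0.
exact: measurable_ball_average.
Qed.

Definition W_energy : \bar R :=
  (\int[leb]_z (f z ^+ 2 * delta G z `^ (d + 1 - n%:R))%:E)%E.

Lemma W_normE : W_norm d G u = (W_energy `^ 2^-1)%E.
Proof.
rewrite /W_norm /W_energy; congr (_ `^ _)%E.
rewrite integral_mkcond; apply: eq_integral => z _; rewrite patchE /weight.
rewrite /grad_norm /extend0 indicE; case: ifP => _; first by rewrite mulr1.
by rewrite mulr0 expr0n/= mul0r.
Qed.

Lemma W_energy_ge0 : (0 <= W_energy)%E.
Proof. by apply: integral_ge0 => z _; rewrite lee_fin mulr_ge0 ?sqr_ge0 ?powR_ge0. Qed.

Lemma W_energy_lty : (W_energy < +oo)%E.
Proof.
have [_ _] := Wu; rewrite W_normE => H; apply: lty_poweRy H.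
by rewrite invr_eq0.
Qed.

Let delta_le_norm z x : G x -> delta G z <= n%:R * `|x - z|.
Proof. by move=> Gx; rewrite distrC; apply: le_trans (enorm_le _); exact: delta_le. Qed.

Let grad_norm_delta z : f z != 0 -> 0 < delta G z.
Proof.
rewrite /grad_norm /extend0 indicE => fz; apply: delta_gt0 => //.
by apply: contrapT => Oz; move: fz; rewrite memNset// mulr0 eqxx.
Qed.

Section sigma_finite.
Variables (sg : {sigma_finite_measure set 'rV[R]_n -> \bar R}) (c : R).
Hypotheses (c_ge0 : 0 <= c) (aeG : {ae sg, forall x, G x})
  (sg_ball : forall (p : 'rV[R]_n) r, 0 < r -> (sg (ball p r) <= (c * r `^ d)%:E)%E).

Lemma ae_trace_good : {ae sg, forall x, trace_good u x}.
Proof.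
have H := integral_riesz_energy n_ge2 c_ge0 d_gt0 d_lt sg_ball mf aeG delta_le_norm
  grad_norm_delta (@measurable_delta R n G).
have ir : sg.-integrable setT (riesz_energy f).
  apply/integrableP; split; first exact: measurable_riesz_energy.
  under eq_integral do rewrite gee0_abs ?riesz_energy_ge0//.
  apply: (le_lt_trans H); rewrite lte_mul_pinfty ?W_energy_lty// lee_fin mulr_ge0 ?powR_ge0//.
  by rewrite tail_const_ge0// subr_gt0.
apply: filterS2 aeG (integrable_ae measurableT ir) => x Gx /(_ Logic.I) rx; split => //.
by rewrite -ge0_fin_numE// riesz_energy_ge0.
Qed.

(** The constant of [trace_pair], times the 2^(d + 1) that comes from replacing |x - y|^(d + 1) by
    s^(d + 1) with s = 2 |x - y|. *)
Definition trace_pair_const : R := 2 * (osc_const n C1 + avg_const n C1) ^+ 2 * 2 `^ (d + 1).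

Lemma trace_pair_const_ge0 : 0 <= trace_pair_const.
Proof. by rewrite mulr_ge0 ?powR_ge0// mulr_ge0 ?sqr_ge0. Qed.

Lemma trace_interaction x y : trace_good u x -> trace_good u y ->
  ((`|trace u x - trace u y| ^+ 2 / enorm (x - y) `^ (d + 1))%:E <=
    trace_pair_const%:E * (interaction d f x y + interaction d f y x))%E.
Proof.
move=> gx gy; have A0 := trace_pair_const_ge0.
have [->|xy] := eqVneq x y.
  rewrite subrr normr0 expr0n/= mul0r mule_ge0 ?lee_fin//.
  by rewrite adde_ge0 ?(interaction_ge0 d mf).
have e0 : 0 < enorm (x - y).
  by apply: lt_le_trans (ler_norm_enorm _); rewrite normr_gt0 subr_eq0.
pose s := 2 * enorm (x - y); have s0 : 0 < s by rewrite mulr_gt0.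
have := trace_pair n0 mu0 C1_ge0 (trace_oscillates gx) (trace_oscillates gy)
  (trace_avg gx).1 (trace_avg gy).1 e0 (erefl s).
rewrite /interaction -(opprB x y) enormN -/s => H.
rewrite -!trace_scaleE// -!EFinM -?EFinD -?EFinM lee_fin ler_pdivrMr ?powR_gt0//.
apply: le_trans H _; rewrite le_eqVlt; apply/orP; left; apply/eqP.
have eE : enorm (x - y) `^ (d + 1) = s `^ (d + 1) / 2 `^ (d + 1).
  by rewrite /s powRM ?enorm_ge0// mulrC mulKf// gt_eqF// powR_gt0.
have sE : s `^ (1 / 2) = s `^ (- (d + 1 / 2)) * s `^ (d + 1).
  by rewrite -powRD ?(gt_eqF s0) ?implybT//; congr (_ `^ _); lra.
rewrite eE sE /trace_pair_const.
move: (s `^ _) (s `^ (d + 1)) (osc_const _ _ + _) (trace_scale _ _ _) (trace_scale _ _ _) => a b k t1 t2.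
by field; rewrite gt_eqF// powR_gt0.
Qed.

Definition H_const : R :=
  trace_pair_const * (2 * (interaction_const n c d * riesz_const n c d)).

Lemma H_energy_trace : (\int[sg]_(x in G) \int[sg]_(y in G)
  (`|trace u x - trace u y| ^+ 2 / enorm (x - y) `^ (d + 1))%:E <= H_const%:E * W_energy)%E.
Proof.
exact: (double_integral_pair n_ge2 c_ge0 d_gt0 d_lt sg_ball mf mG aeG delta_le_norm
  grad_norm_delta (@measurable_delta R n G) measurable_trace trace_pair_const_ge0
  ae_trace_good trace_interaction).
Qed.

End sigma_finite.

End trace_of.

(** The extensions of u and v by 0 are integrable on the balls about x, so averages are linear at
    each radius; since x is good for both functions, the two limits exist and add up. *)
Lemma trace_lin a u v x : W_space d G u -> W_space d G v ->
  trace_good u x -> trace_good v x ->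
  trace (fun z => a * u z + v z) x = a * trace u x + trace v x.
Proof.
move=> Wu Wv gu gv; have [_ cu] := trace_avg Wu gu; have [_ cv] := trace_avg Wv gv.
have c : a * avg (extend0 G u) x r + avg (extend0 G v) x r @[r --> 0^'+] -->
    a * trace u x + trace v x.
  by apply: cvgD; [apply: cvgM; [exact: cvg_cst|exact: cu]|exact: cv].
rewrite {1}/trace.
rewrite (_ : (fun k => _) =
    (fun k => (a * avg (extend0 G u) x (2^-1 ^+ k) + avg (extend0 G v) x (2^-1 ^+ k))%:E)).
  by rewrite (cvg_limn_einf_sup (cvg_dyadic c)).2.
apply/funext => k; have r0 : 0 < 2^-1 ^+ k :> R by rewrite exprn_gt0.
rewrite (@eq_ball_average _ (fun z => a * extend0 G u z + extend0 G v z)); last first.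
  by apply: aeW => z Oz; rewrite !extend0E.
have ou := trace_oscillates Wu gu; have ov := trace_oscillates Wv gv.
have mu := measurable_extend0_W Wu; have mv := measurable_extend0_W Wv.
rewrite (ball_average_lin a r0 n0 (oscillates_less_integrable_eball mu ou r0)
  (oscillates_less_integrable_eball mv ov r0)).
by rewrite (ball_averageE n0 mu ou r0) (ball_averageE n0 mv ov r0).
Qed.

End trace.

Theorem theorem3p4 (R : realType) (n : nat) (d : R) (G : set 'rV[R]_n)
  (n_ge2 : (2 <= n)%N) (d_gt0 : 0 < d) (d_lt : d < n%:R - 1)
  (G_neq0 : G !=set0) (G_closed : closed G) (G_regular : ahlfors_regular d G) :
  exists T : ('rV[R]_n -> R) -> ('rV[R]_n -> R),
    [/\ (* T maps W to H, and is well defined on classes of functions *)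
        (forall u, W_space d G u -> H_space d G (T u)) /\
        (forall u v, W_space d G u -> W_space d G v ->
          {ae lebesgue_rV R n, forall z, Omega G z -> u z = v z} ->
          {ae sigma d G, forall x, G x -> T u x = T v x}),
        (* T is linear *)
        (forall (a : R) u v, W_space d G u -> W_space d G v ->
          {ae sigma d G, forall x, G x ->
            T (fun z => a * u z + v z) x = a * T u x + T v x}),
        (* T is bounded *)
        (exists C : R, forall u, W_space d G u ->
          (H_norm d G (T u) <= C%:E * W_norm d G u)%E) &
        (* T u is the pointwise limit of the averages of u, sigma-a.e. *)
        (forall u, W_space d G u ->
          {ae sigma d G, forall x, G x ->
            ball_average u x r @[r --> 0^'+] --> (T u x)%:E /\
            ball_average (fun y => `|u y - T u x|) x r @[r --> 0^'+] --> 0%E})].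
Proof.
have [sg [c [c0 sgE aeG sg_ball]]] := ahlfors_sigma_bundle (ltnW n_ge2) G_closed G_regular.
have ae_good u (Wu : W_space d G u) : {ae sigma d G, forall x, trace_good G u x}.
  rewrite -sgE.
  exact: (ae_trace_good n_ge2 d_gt0 d_lt G_neq0 G_closed Wu c0 aeG sg_ball).
(* K depends only on n, d and the constant of the ball bound for [sigma], so it serves all u. The
   seminorms are square roots of the energies, hence the power 1/2 below. *)
pose K := H_const n d c.
have bound u : W_space d G u -> (H_norm d G (@trace R n u) <= (K `^ 2^-1)%:E * W_norm d G u)%E.
  move=> Wu; have E0 := W_energy_ge0 d G u.
  have K0 : 0 <= K.
    rewrite mulr_ge0 ?trace_pair_const_ge0// mulr_ge0// mulr_ge0// mulr_ge0 ?powR_ge0//;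
      by rewrite tail_const_ge0//; lra.
  rewrite W_normE /H_norm -poweR_EFin -poweRM ?lee_fin//.
  have KE0 : (0 <= K%:E * W_energy d G u)%E by rewrite mule_ge0 ?lee_fin.
  have H0 : (0 <= \int[sigma d G]_(x in G) \int[sigma d G]_(y in G)
      (`|trace u x - trace u y| ^+ 2 / enorm (x - y) `^ (d + 1))%:E)%E.
    apply: integral_ge0 => x _; apply: integral_ge0 => y _.
    by rewrite lee_fin divr_ge0 ?sqr_ge0 ?powR_ge0.
  apply: gt0_ler_poweR; rewrite ?in_itv/= ?H0 ?KE0 ?leey ?invr_ge0//.
  rewrite -sgE.
  exact: (H_energy_trace n_ge2 d_gt0 d_lt G_neq0 G_closed G_regular Wu c0 aeG sg_ball).
exists (@trace R n); split.
- split => [u Wu|u v Wu Wv uv].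
    split; first by apply: measurable_funTS; exact: (measurable_trace n_ge2 d_gt0 d_lt G_closed G_regular Wu).
    apply: le_lt_trans (bound u Wu) _; have [_ _ Wfin] := Wu.
    by rewrite lte_mul_pinfty ?lee_fin ?powR_ge0.
  (* The averages of u and v coincide at every x and every radius, so the traces agree everywhere on
     G. *)
  apply: aeW => x Gx; congr (fine (limn_esup _)); apply/funext => k.
  exact: (eq_ball_average n_ge2 d_gt0 d_lt G_closed G_regular).
- move=> a u v Wu Wv; apply: filterS2 (ae_good u Wu) (ae_good v Wv) => x gu gv _.
  exact: (trace_lin n_ge2 d_gt0 d_lt G_closed G_regular).
- by exists (K `^ 2^-1).
- move=> u Wu; apply: filterS (ae_good u Wu) => x gu _; split.
    exact: (cvg_trace n_ge2 d_gt0 d_lt G_closed G_regular).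
  exact: (cvg_trace_dist n_ge2 d_gt0 d_lt G_closed G_regular).
Qed.
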